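(* Let $A_N$ and $\Delta_N$ be as in the spectral norm setting, with $\mathbb EX^{(N)}_{i,j}=0$ for all $i\le j$, satisfying (S.1), (S.2), (S.3) and additionally (S.4): for some $0<r\le1$, $$\lim_{N\to\infty}\sup_{1\le i\le N}\Big|\frac1N\sum_{j=1}^N\sigma_N(i,j)^2-r\Big|=0.$$ Then $\displaystyle\lim_{N\to\infty}\frac{\|\Delta_N\|}{\sqrt{2N\log N}}=\sqrt r$ in probability, where $\|\cdot\|$ is the spectral norm.
   Context: For each $N$, $\{X^{(N)}_{i,j}:1\le i\le j\le N\}$ are independent real random variables, $A_N(i,j)=X^{(N)}_{i\wedge j,i\vee j}$, $\Delta_N(i,j)=A_N(i,j)$ ($i\ne j$), $\Delta_N(i,i)=-\sum_{k\ne i}A_N(i,k)$, $\sigma_N(i,j)^2=\mathrm{Var}(X^{(N)}_{i\wedge j,i\vee j})$. (S.1) $\inf_{N,i,j}\sigma_N(i,j)^2>0$ and $\sup_{N,i,j}\sigma_N(i,j)^2\le1$. (S.2) For some $\delta>0$, $K<\infty$: $\mathbb E|X^{(N)}_{i,j}-\mathbb EX^{(N)}_{i,j}|^{6+\delta}\le K$ for all $i,j,N$. (S.3) The empirical graphon $W_N$ ($W_N=\sigma_N(i,j)^2$ on $I_i\times I_j$, $I_j=[\frac{j-1}N,\frac jN)$, $I_N$ closed) converges in cut metric $\delta_\Box$ to some graphon $W$. *)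

(* Defs.v *)
From HB Require Import structures.
From mathcomp Require Import all_boot all_order all_algebra.
From mathcomp Require Import all_classical all_reals all_analysis.
Set Implicit Arguments.
Unset Strict Implicit.
Unset Printing Implicit Defensive.
Import Order.TTheory GRing.Theory Num.Theory Num.Def.
Import numFieldNormedType.Exports.
Local Open Scope classical_set_scope.
Local Open Scope ring_scope.

Definition mutually_independent {d} {T : measurableType d} {R : realType}
  (P : probability T R) {I : eqType} (D : set I) (X : I -> T -> R) : Prop :=
  forall (s : seq I) (B : I -> set R),
    uniq s -> (forall i, i \in s -> D i) ->
    (forall i, i \in s -> measurable (B i)) ->
    P (\bigcap_(i in [set j | j \in s]) (X i @^-1` B i)) =
    (\big[*%E/1%E]_(i <- s) P (X i @^-1` B i))%E.

Section Mat.
Context {R : realType} {d} {T : measurableType d}.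

Definition Aentry (X : nat -> nat -> T -> R) (i j : nat) (w : T) : R :=
  X (minn i j) (maxn i j) w.

(* A_N as an N x N matrix; row/column k : 'I_N corresponds to index k+1 *)
Definition Amat (N : nat) (X : nat -> nat -> T -> R) (w : T) : 'M[R]_N :=
  \matrix_(i < N, j < N) Aentry X i.+1 j.+1 w.

Definition Deltamat (N : nat) (X : nat -> nat -> T -> R) (w : T) : 'M[R]_N :=
  \matrix_(i < N, j < N)
    (if i == j then - \sum_(k < N | k != i) Aentry X i.+1 k.+1 w
     else Aentry X i.+1 j.+1 w).
End Mat.

Definition vnorm {R : realType} {n : nat} (v : 'cV[R]_n) : R :=
  Num.sqrt (\sum_(i < n) (v i ord0) ^+ 2).

Definition spectral_norm {R : realType} {n : nat} (M : 'M[R]_n) : R :=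
  sup [set vnorm (M *m v) | v in [set v : 'cV[R]_n | vnorm v = 1]].

Section Graphon.
Context {R : realType}.
Local Notation RR := (measurableTypeR R).
Local Notation lam := (@lebesgue_measure R).

Definition unit_itv : set RR := [set x | 0 <= x <= 1].

Definition is_graphon (W : RR -> RR -> R) : Prop :=
  measurable_fun (unit_itv `*` unit_itv) (fun z : RR * RR => W z.1 z.2) /\
  (forall x y, unit_itv x -> unit_itv y -> W x y = W y x) /\
  (forall x y, unit_itv x -> unit_itv y -> 0 <= W x y <= 1).

Definition cut_norm_dist (U W : RR -> RR -> R) : \bar R :=
  ereal_sup [set `| (\int[(lam \x lam)%E]_(z in S `*` T)
                       ((U z.1 z.2 - W z.1 z.2)%:E))%E |%E
            | S in [set S | measurable S /\ S `<=` unit_itv] &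
              T in [set T | measurable T /\ T `<=` unit_itv]].

Definition invertible_mp (phi : RR -> RR) : Prop :=
  exists psi : RR -> RR,
    set_bij unit_itv unit_itv phi /\
    (forall x, unit_itv x -> psi (phi x) = x) /\
    (forall y, unit_itv y -> phi (psi y) = y) /\
    measurable_fun unit_itv phi /\ measurable_fun unit_itv psi /\
    (forall A, measurable A -> A `<=` unit_itv ->
       lam (unit_itv `&` phi @^-1` A) = lam A).

Definition cut_distance (U W : RR -> RR -> R) : \bar R :=
  ereal_inf [set cut_norm_dist U (fun x y => W (phi x) (phi y))
            | phi in [set phi | invertible_mp phi]].

(* index j in {1..N} of the block I_j = [(j-1)/N, j/N) containing x
   (I_N closed) *)
Definition block_index (N : nat) (x : R) : nat :=
  (minn (Num.truncn (x * N%:R)) N.-1).+1.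

Definition empirical_graphon (N : nat) (s : nat -> nat -> R) : RR -> RR -> R :=
  fun x y => if `[< unit_itv x /\ unit_itv y >]
             then s (block_index N x) (block_index N y) else 0.
End Graphon.

(* Main.v *)
Require Import Defs.
From HB Require Import structures.
From mathcomp Require Import all_boot all_order all_algebra.
From mathcomp Require Import all_classical all_reals all_analysis.
From mathcomp Require Import measurable_realfun ring lra zify.
Set Implicit Arguments.
Unset Strict Implicit.
Unset Printing Implicit Defensive.
Import Order.TTheory GRing.Theory Num.Theory Num.Def.
Import numFieldNormedType.Exports.
Local Open Scope classical_set_scope.
Local Open Scope ring_scope.

(* Write Delta = A - diag(S), where S_i is the sum of the whole i-th row of A. With L = log N and rho = N^(1/10), truncate the entries at rho^4 and recentre them: six moments make all truncations inactive with high probability, and the means lost are negligible. The trace method, with exponent of order log N, gives |A| = O(sqrt N), which is negligible against sqrt (N L); so only max_i |S_i| and max_i S_i matter.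
   Upper bound: the exponential moments of S_i are Gaussian up to a factor exp (o(L)) with variance N r, by (S.4), and Chernoff's bound with a union over the rows gives |S_i| <= (sqrt (2 r) + o(1)) sqrt (N L).
   Lower bound: for i < m = N / q, the partial sums over the columns k >= m are independent. By Cramer's tilting each exceeds (sqrt (2 r) - o(1)) sqrt (N L) with probability at least N^(gamma - 1), so one of them does; the missing m columns contribute a small multiple of sqrt (N L) when q is large. *)

(** The truncation level [b = N^(2/5)] is squeezed from two sides. A union bound over the entries
    costs [N^2 / b^6], which vanishes only if [b] is well above [N^(1/3)]; the walk count and the
    exponential moments need [b] well below [N^(1/2)]. As [sqrt N = rho^5], one factor [rho] is left
    over; it pays for [2^n (n + 1)] in the trace method and for [sqrt L] in the moment estimates.
    All tilts have the form [c * ell] with [ell = sqrt (L / N)], and all thresholds the form [t * s]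
    with [s = sqrt (N L)]. Since [ell * s = L], every probability becomes [exp (const * L)], a power
    of [N]. The Gaussian rate gives [N^(- t^2 / (2 r))], which balances the [N] rows exactly at
    [t = sqrt (2 r)]. The gap [sqrt L] between [|A|] and the row sums allows a very wasteful
    constant in [|A| = O(sqrt N)]. Hence a coarse recursive count of walks suffices, without
    eigenvalues or Catalan numbers. *)

(** * Linear algebra: spectral norm, powers and traces *)

Section LinearAlgebra.
Context {R : realType}.
Implicit Types (n : nat) (c : R).

(** Lagrange's identity: twice the deficit is the sum of [(a i * b j - a j * b i) ^+ 2] over all
    pairs. *)
Lemma sum_cauchy_schwarz (I : finType) (a b : I -> R) :
  (\sum_i a i * b i) ^+ 2 <= (\sum_i a i ^+ 2) * (\sum_i b i ^+ 2).
Proof.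
have H : 0 <= \sum_i \sum_j (a i * b j - a j * b i) ^+ 2.
  by apply: sumr_ge0 => i _; apply: sumr_ge0 => j _; apply: sqr_ge0.
have E : \sum_i \sum_j (a i * b j - a j * b i) ^+ 2 =
   ((\sum_i a i ^+ 2) * (\sum_i b i ^+ 2) - (\sum_i a i * b i) ^+ 2) *+ 2.
  have E1 : (\sum_i a i ^+ 2) * (\sum_i b i ^+ 2) =
      \sum_i \sum_j (a i ^+ 2 * b j ^+ 2).
    by rewrite mulr_suml; apply: eq_bigr => i _; rewrite mulr_sumr.
  have E2 : (\sum_i a i * b i) ^+ 2 = \sum_i \sum_j (a i * b i * (a j * b j)).
    by rewrite expr2 mulr_suml; apply: eq_bigr => i _; rewrite mulr_sumr.
  have E3 : \sum_i \sum_j (a i ^+ 2 * b j ^+ 2) =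
            \sum_i \sum_j (a j ^+ 2 * b i ^+ 2) by rewrite exchange_big.
  rewrite mulr2n {1}E1 E1 E3 -E3 {1}E3 E2 -!sumrB -big_split /=.
  apply: eq_bigr => i _; rewrite -!sumrB -big_split /=.
  by apply: eq_bigr => j _; ring.
by move: H; rewrite E -mulr_natr pmulr_lge0 // subr_ge0.
Qed.

Lemma vnorm_ge0 n (v : 'cV[R]_n) : 0 <= vnorm v.
Proof. exact: sqrtr_ge0. Qed.

Lemma vnorm_sqr n (v : 'cV[R]_n) : vnorm v ^+ 2 = \sum_i v i ord0 ^+ 2.
Proof. by rewrite sqr_sqrtr // sumr_ge0 // => i _; apply: sqr_ge0. Qed.

Lemma vnorm_le n (v : 'cV[R]_n) c : 0 <= c ->
  (vnorm v <= c) = (\sum_i v i ord0 ^+ 2 <= c ^+ 2).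
Proof. by move=> c0; rewrite -vnorm_sqr ler_sqr // nnegrE ?vnorm_ge0. Qed.

Lemma dot_le_vnorm n (u v : 'cV[R]_n) :
  \sum_i u i ord0 * v i ord0 <= vnorm u * vnorm v.
Proof.
apply: (le_trans (ler_norm _)).
rewrite -ler_sqr ?nnegrE ?normr_ge0 ?mulr_ge0 ?vnorm_ge0 //.
by rewrite exprMn !vnorm_sqr real_normK ?num_real // sum_cauchy_schwarz.
Qed.

Lemma vnormD n (u v : 'cV[R]_n) : vnorm (u + v) <= vnorm u + vnorm v.
Proof.
rewrite vnorm_le ?addr_ge0 ?vnorm_ge0 //.
have -> : \sum_i (u + v) i ord0 ^+ 2 = \sum_i u i ord0 ^+ 2
    + (\sum_i u i ord0 * v i ord0) * 2 + \sum_i v i ord0 ^+ 2.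
  by rewrite mulr_suml -!big_split /=; apply: eq_bigr => i _; rewrite mxE; ring.
rewrite -!vnorm_sqr sqrrD lerD2r lerD2l mulr_natr lerMn2r.
exact: dot_le_vnorm.
Qed.

Lemma vnormZ n c (v : 'cV[R]_n) : vnorm (c *: v) = `|c| * vnorm v.
Proof.
rewrite /vnorm -sqrtr_sqr -sqrtrM ?sqr_ge0 // mulr_sumr.
by congr (Num.sqrt _); apply: eq_bigr => i _; rewrite mxE exprMn.
Qed.

Lemma vnormN n (v : 'cV[R]_n) : vnorm (- v) = vnorm v.
Proof. by rewrite -scaleN1r vnormZ normrN1 mul1r. Qed.

Lemma vnorm0_eq n (v : 'cV[R]_n) : vnorm v = 0 -> v = 0.
Proof.
move=> v0; have : \sum_i v i ord0 ^+ 2 = 0 by rewrite -vnorm_sqr v0 expr0n.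
move=> /eqP; rewrite psumr_eq0 => [/allP h|i _]; last exact: sqr_ge0.
apply/colP => i; rewrite mxE; apply/eqP.
by have := h i; rewrite mem_index_enum sqrf_eq0 => /(_ isT).
Qed.

Lemma frobenius_ge0 n (M : 'M[R]_n) : 0 <= \sum_i \sum_j M i j ^+ 2.
Proof. by apply: sumr_ge0 => i _; apply: sumr_ge0 => j _; apply: sqr_ge0. Qed.

Lemma vnorm_mulmx_sqr n (M : 'M[R]_n) v :
  vnorm (M *m v) ^+ 2 <= (\sum_i \sum_j M i j ^+ 2) * vnorm v ^+ 2.
Proof.
rewrite !vnorm_sqr mulr_suml; apply: ler_sum => i _.
by rewrite mxE sum_cauchy_schwarz.
Qed.

Lemma vnorm_mulmx_frob n (M : 'M[R]_n) v :
  vnorm (M *m v) <= Num.sqrt (\sum_i \sum_j M i j ^+ 2) * vnorm v.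
Proof.
rewrite -ler_sqr ?nnegrE ?mulr_ge0 ?vnorm_ge0 ?sqrtr_ge0 //.
by rewrite exprMn [X in X * _]sqr_sqrtr ?frobenius_ge0 // vnorm_mulmx_sqr.
Qed.

(** Meant for the matrix of means removed by recentring, whose entries are so small that the lossy
    factor [n] does no harm. *)
Lemma vnorm_mulmx_entries n (M : 'M[R]_n) c v : 0 <= c ->
  (forall i j, `|M i j| <= c) -> vnorm (M *m v) <= n%:R * c * vnorm v.
Proof.
move=> c0 Mc; apply: (le_trans (vnorm_mulmx_frob _ _)).
rewrite ler_wpM2r ?vnorm_ge0 // -(ger0_norm (mulr_ge0 (ler0n R n) c0)).
rewrite -sqrtr_sqr ler_wsqrtr // exprMn.
apply: (@le_trans _ _ (\sum_(i < n) \sum_(j < n) c ^+ 2)).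
  apply: ler_sum => i _; apply: ler_sum => j _.
  by rewrite -(real_normK (num_real (M i j))) ler_sqr // nnegrE.
by rewrite !sumr_const card_ord expr2 -mulrA !mulr_natl.
Qed.

Lemma vnorm_mulmx_diag n (d : 'I_n -> R) c (v : 'cV[R]_n) : 0 <= c ->
  (forall i, `|d i| <= c) ->
  vnorm (\col_i (d i * v i ord0)) <= c * vnorm v.
Proof.
move=> c0 dc; rewrite -(ger0_norm c0) -vnormZ vnorm_le ?vnorm_ge0 // vnorm_sqr.
apply: ler_sum => i _; rewrite !mxE !exprMn ler_wpM2r ?sqr_ge0 //.
by rewrite -(real_normK (num_real (d i))) ler_sqr // nnegrE.
Qed.

(** The Frobenius norm is a bound. Without one, [sup] would be a default value and would not
    dominate the set. *)
Lemma spectral_norm_has_ubound n (M : 'M[R]_n) :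
  has_ubound [set vnorm (M *m v) | v in [set v : 'cV[R]_n | vnorm v = 1]].
Proof.
exists (Num.sqrt (\sum_i \sum_j M i j ^+ 2)) => _ [v /= v1 <-].
by rewrite -[leRHS]mulr1 -v1 vnorm_mulmx_frob.
Qed.

Lemma le_spectral_norm n (M : 'M[R]_n) v :
  vnorm v = 1 -> vnorm (M *m v) <= spectral_norm M.
Proof.
by move=> v1; apply: (ub_le_sup (spectral_norm_has_ubound M)); exists v.
Qed.

Lemma spectral_norm_le n (M : 'M[R]_n) c : 0 <= c ->
  (forall v, vnorm v = 1 -> vnorm (M *m v) <= c) -> spectral_norm M <= c.
Proof.
move=> c0 Mc; rewrite /spectral_norm.
(* For [n = 0] there is no unit vector and the [sup] of the empty set is 0, whence the hypothesis
   [0 <= c]. *)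
have [->|/set0P ne] := eqVneq
  [set vnorm (M *m v) | v in [set v : 'cV[R]_n | vnorm v = 1]] set0.
  by rewrite sup0.
by apply: ge_sup => // _ [v v1 <-]; exact: Mc.
Qed.

Lemma spectral_norm_ge0 n (M : 'M[R]_n) : 0 <= spectral_norm M.
Proof.
rewrite /spectral_norm.
have [->|/set0P [_ [v v1 _]]] := eqVneq
  [set vnorm (M *m v) | v in [set v : 'cV[R]_n | vnorm v = 1]] set0.
  by rewrite sup0.
by apply: (le_trans (vnorm_ge0 _)); apply: le_spectral_norm v1.
Qed.

Lemma vnorm_delta n (i : 'I_n) : vnorm (delta_mx i ord0 : 'cV[R]_n) = 1.
Proof.
rewrite /vnorm (bigD1 i) //= big1 ?addr0 ?mxE ?eqxx ?expr1n ?sqrtr1 //.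
by move=> j /negPf ji; rewrite mxE ji expr0n.
Qed.

(* [A^2 v] dominates [|A v|^2 = <v, A^2 v>]; iterating this squares the power of the matrix at each step. *)
Lemma vnorm_sym_exp n (A : 'M[R]_n) v p : A^T = A -> vnorm v = 1 ->
  vnorm (A *m v) ^+ (2 ^ p) <= vnorm (A ^+ (2 ^ p) *m v).
Proof.
elim: p A => [|p IH] A At v1; first by rewrite expn0 !expr1.
have h : vnorm (A *m v) ^+ 2 <= vnorm (A ^+ 2 *m v).
  rewrite vnorm_sqr -[leRHS]mul1r -v1.
  rewrite (_ : \sum_i _ = \sum_i v i ord0 * (A ^+ 2 *m v) i ord0);
    first exact: dot_le_vnorm.
  have E : ((A *m v)^T *m (A *m v)) ord0 ord0 = (v^T *m (A ^+ 2 *m v)) ord0 ord0.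
    by rewrite trmx_mul At expr2 -mulmxE !mulmxA.
  rewrite !mxE in E; rewrite (eq_bigr (fun j => (A *m v)^T ord0 j * (A *m v) j ord0)).
    by rewrite E; apply: eq_bigr => i _; rewrite [v^T _ _]mxE.
  by move=> i _; rewrite [(A *m v)^T _ _]mxE expr2.
rewrite expnS !exprM.
apply: (le_trans (lerXn2r _ _ _ h)); rewrite ?nnegrE ?exprn_ge0 ?vnorm_ge0 //.
apply: IH => //.
by rewrite expr2 -mulmxE trmx_mul At.
Qed.

Lemma trmx_exp n (A : 'M[R]_n) k : A^T = A -> (A ^+ k)^T = A ^+ k.
Proof.
move=> At; elim: k => [|k IH]; first by rewrite expr0 trmx1.
by rewrite exprS -mulmxE trmx_mul IH At mulmxE -exprSr exprS.
Qed.

(** The squared Frobenius norm of the symmetric matrix [A ^+ (2 ^ p)] is the trace of its square.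
    This replaces the spectral theorem, at the price of exponents that are powers of two. *)
Lemma vnorm_sym_trace n (A : 'M[R]_n) v p : A^T = A -> vnorm v = 1 ->
  vnorm (A *m v) ^+ (2 * 2 ^ p) <= \tr (A ^+ (2 * 2 ^ p)).
Proof.
move=> At v1; rewrite mulnC exprM.
apply: (@le_trans _ _ (vnorm (A ^+ (2 ^ p) *m v) ^+ 2)).
  by rewrite lerXn2r ?nnegrE ?exprn_ge0 ?vnorm_ge0 ?vnorm_sym_exp.
apply: (le_trans (vnorm_mulmx_sqr _ _)); rewrite v1 expr1n mulr1.
rewrite exprM /mxtrace; apply: ler_sum => i _.
rewrite expr2 -mulmxE mxE; apply: ler_sum => j _.
by rewrite expr2 -{2}(trmx_exp _ At) mxE.
Qed.

Lemma spectral_norm_sub_diag_le n (M A : 'M[R]_n) (S : 'I_n -> R) (c s : R) :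
  (forall i j, M i j = A i j - S i *+ (i == j)) ->
  (forall v, vnorm v = 1 -> vnorm (A *m v) <= c) -> 0 <= c -> 0 <= s ->
  (forall i, `|S i| <= s) -> spectral_norm M <= c + s.
Proof.
move=> ME Ac c0 s0 Ss; apply: spectral_norm_le; first exact: addr_ge0.
move=> v v1.
have -> : M *m v = A *m v - \col_i (S i * v i ord0).
  apply/colP => i; rewrite !mxE.
  have <- : \sum_j (S i *+ (i == j)) * v j ord0 = S i * v i ord0; last first.
    by rewrite -sumrB; apply: eq_bigr => j _; rewrite ME mulrBl.
  rewrite (bigD1 i) //= eqxx mulr1n big1 ?addr0 // => j /negPf ji.
  by rewrite eq_sym ji mulr0n mul0r.
apply: (le_trans (vnormD _ _)); rewrite vnormN lerD ?Ac //.
by rewrite -[leRHS]mulr1 -v1 vnorm_mulmx_diag.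
Qed.

(** Evaluate at the basis vector [v] of index [i]: there [S i *: v = A *m v - M *m v]. *)
Lemma spectral_norm_sub_diag_ge n (M A : 'M[R]_n) (S : 'I_n -> R) c i :
  (forall i j, M i j = A i j - S i *+ (i == j)) ->
  (forall v, vnorm v = 1 -> vnorm (A *m v) <= c) -> S i - c <= spectral_norm M.
Proof.
move=> ME Ac; pose v : 'cV[R]_n := delta_mx i ord0.
have v1 : vnorm v = 1 by exact: vnorm_delta.
apply: le_trans (le_spectral_norm M v1); rewrite lerBlDr.
have E : S i *: v = A *m v - M *m v.
  rewrite -mulmxBl -!colE; apply/colP => k; rewrite !mxE ME opprB addrC subrK.
  by case: eqVneq => [->|_] /=; rewrite ?mulr1 ?mulr0.
apply: (le_trans (ler_norm _)); rewrite -[leLHS]mulr1 -v1 -vnormZ E.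
by apply: (le_trans (vnormD _ _)); rewrite vnormN addrC lerD2l Ac.
Qed.

(** Reduces a bound on the norm to countably many conditions, which makes the norm a measurable
    function of the entries. A unit vector is approximated by a rational one, and the Frobenius norm
    [F] controls the error. *)
Lemma spectral_norm_le_rat n (M : 'M[R]_n) (a : R) : 0 <= a ->
  (forall q : 'cV[rat]_n, vnorm (M *m map_mx ratr q) <= a * vnorm (map_mx (@ratr R) q)) ->
  spectral_norm M <= a.
Proof.
move=> a0 Mq; apply: spectral_norm_le => // v v1; apply/ler_addgt0Pr => e e0.
pose F := Num.sqrt (\sum_i \sum_j M i j ^+ 2).
have F0 : 0 <= F by exact: sqrtr_ge0.
(* Makes the total error [(a + F) * n.+1 * (e / K)] at most [e]; the [+ 1] keeps [K] positive. *)
pose K := (a + F) * n.+1%:R + 1.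
have K0 : 0 < K by rewrite ltr_wpDl // mulr_ge0 ?addr_ge0.
pose h := e / K.
have h0 : 0 < h by rewrite divr_gt0.
have ex i : exists q : rat, `|v i ord0 - ratr q| <= h.
  have [q] := @rat_in_itvoo R (v i ord0 - h) (v i ord0 + h) ltac:(lra).
  by rewrite in_itv /= => /andP[q1 q2]; exists q; rewrite ler_norml; lra.
pose q : 'cV[rat]_n := \col_i xchoose (ex i).
pose u := v - map_mx ratr q.
have uh : vnorm u <= n.+1%:R * h.
  rewrite vnorm_le; last by apply: mulr_ge0 => //; exact: ltW.
  apply: (@le_trans _ _ (\sum_(i < n) h ^+ 2)).
    apply: ler_sum => i _; rewrite !mxE -(real_normK (num_real _)).
    by rewrite ler_sqr ?nnegrE ?(ltW h0) //; exact: (xchooseP (ex i)).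
  rewrite sumr_const card_ord -[leLHS]mulr_natl [leRHS]exprMn ler_wpM2r ?sqr_ge0 //.
  rewrite -natrX ler_nat expnS expn1; apply: (@leq_trans n.+1) => //.
  by rewrite leq_pmulr.
have Mu : vnorm (M *m u) <= F * vnorm u by exact: vnorm_mulmx_frob.
have qv : vnorm (map_mx (@ratr R) q) <= 1 + vnorm u.
  rewrite (_ : map_mx _ _ = v + - u); last by rewrite /u opprB addrC subrK.
  by apply: (le_trans (vnormD _ _)); rewrite vnormN v1.
rewrite (_ : M *m v = M *m map_mx ratr q + M *m u); last first.
  by rewrite -mulmxDr /u addrC subrK.
apply: (le_trans (vnormD _ _)).
apply: (@le_trans _ _ (a * (1 + vnorm u) + F * vnorm u)).
  by rewrite lerD //; apply: (le_trans (Mq q)); rewrite ler_wpM2l.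
rewrite mulrDr mulr1 -addrA lerD2l -mulrDl.
apply: (@le_trans _ _ ((a + F) * (n.+1%:R * h))).
  by rewrite ler_wpM2l ?addr_ge0.
rewrite mulrA /h mulrA ler_pdivrMr // mulrC ler_wpM2l ?(ltW e0) //.
by rewrite /K lerDl.
Qed.

End LinearAlgebra.

(** * Real-valued probability and expectation, bounded random variables *)

Section RealExpectation.
Context {R : realType} {d} {T : measurableType d} (P : probability T R).
Implicit Types (A : set T) (f g : T -> R).

Definition pr A : R := fine (P A).
Definition Ex f : R := \int[P]_w f w.
(** A class closed under sums, products, powers and [expR], so that integrability can be read off
    the shape of an expression. All truncated variables belong to it. *)
Definition bmf f : Prop :=
  measurable_fun setT f /\ exists M, forall w, `|f w| <= M.

Lemma prE A : measurable A -> P A = (pr A)%:E.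
Proof. by move=> mA; rewrite fineK // fin_num_measure. Qed.

Lemma pr_ge0 A : 0 <= pr A.
Proof. by rewrite fine_ge0. Qed.

Lemma pr_setT : pr setT = 1.
Proof. by rewrite /pr probability_setT. Qed.

Lemma pr_set0 : pr set0 = 0.
Proof. by rewrite /pr measure0. Qed.

Lemma le_pr A B : measurable A -> measurable B -> A `<=` B -> pr A <= pr B.
Proof.
by move=> mA mB AB; rewrite -lee_fin -!prE // le_measure ?inE.
Qed.

Lemma pr_setU A B : measurable A -> measurable B ->
  pr (A `|` B) <= pr A + pr B.
Proof.
move=> mA mB; rewrite -lee_fin EFinD -!prE //; last exact: measurableU.
exact: measureU2.
Qed.

Lemma pr_bigsetU (I : Type) (s : seq I) (F : I -> set T) :
  (forall i, measurable (F i)) ->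
  pr (\big[setU/set0]_(i <- s) F i) <= \sum_(i <- s) pr (F i).
Proof.
move=> mF; elim: s => [|i s IH]; first by rewrite !big_nil pr_set0.
rewrite !big_cons; apply: (le_trans (pr_setU _ _)) => //.
  by apply: bigsetU_measurable.
by rewrite lerD2l.
Qed.

Lemma bmf_integrable f : bmf f -> P.-integrable setT (EFin \o f).
Proof.
move=> [mf [M fM]]; apply: measurable_bounded_integrable => //.
  by apply: (le_lt_trans (probability_le1 P measurableT)); rewrite ltry.
exists M; split; first exact: num_real.
by move=> x Mx w _ /=; apply: (le_trans (fM w)); apply: ltW.
Qed.

Lemma bmf_cst c : bmf (fun=> c).
Proof. by split; [exact: measurable_cst|exists `|c|]. Qed.

Lemma bmfD f g : bmf f -> bmf g -> bmf (fun w => f w + g w).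
Proof.
move=> [mf [M fM]] [mg [M' gM]]; split; first exact: measurable_funD.
by exists (M + M') => w; apply: (le_trans (ler_normD _ _)); rewrite lerD.
Qed.

Lemma bmfM f g : bmf f -> bmf g -> bmf (fun w => f w * g w).
Proof.
move=> [mf [M fM]] [mg [M' gM]]; split; first exact: measurable_funM.
by exists (M * M') => w; rewrite normrM ler_pM.
Qed.

Lemma bmfZ c f : bmf f -> bmf (fun w => c * f w).
Proof. by move=> ?; apply: bmfM => //; exact: bmf_cst. Qed.

Lemma bmfN f : bmf f -> bmf (fun w => - f w).
Proof.
move=> [mf [M fM]]; split; first exact: measurableT_comp.
by exists M => w; rewrite normrN.
Qed.

Lemma bmfB f g : bmf f -> bmf g -> bmf (fun w => f w - g w).
Proof. by move=> ? ?; apply: bmfD => //; exact: bmfN. Qed.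

Lemma bmf_sum (I : Type) (s : seq I) (F : I -> T -> R) (Q : pred I) :
  (forall i, bmf (F i)) -> bmf (fun w => \sum_(i <- s | Q i) F i w).
Proof.
move=> hF; elim: s => [|i s IH].
  by under eq_fun do rewrite big_nil; exact: bmf_cst.
under eq_fun do rewrite big_cons.
by case: (Q i) => //; apply: bmfD.
Qed.

Lemma bmf_prod (I : Type) (s : seq I) (F : I -> T -> R) (Q : pred I) :
  (forall i, bmf (F i)) -> bmf (fun w => \prod_(i <- s | Q i) F i w).
Proof.
move=> hF; elim: s => [|i s IH].
  by under eq_fun do rewrite big_nil; exact: bmf_cst.
under eq_fun do rewrite big_cons.
by case: (Q i) => //; apply: bmfM.
Qed.

Lemma bmfX f k : bmf f -> bmf (fun w => f w ^+ k).
Proof.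
move=> hf; elim: k => [|k IH].
  by under eq_fun do rewrite expr0; exact: bmf_cst.
by under eq_fun do rewrite exprS; exact: bmfM.
Qed.

Lemma bmf_expR f : bmf f -> bmf (fun w => expR (f w)).
Proof.
move=> [mf [M fM]]; split; first exact: measurableT_comp.
exists (expR M) => w; rewrite ger0_norm ?expR_ge0 // ler_expR.
exact: le_trans (ler_norm _) (fM w).
Qed.

Lemma bmf_indic A : measurable A -> bmf (\1_A : T -> R).
Proof.
move=> mA; split; first exact: measurable_indic.
by exists 1 => w; rewrite indicE ger0_norm ?ler0n // lern1 leq_b1.
Qed.

Lemma ExD f g : P.-integrable setT (EFin \o f) -> P.-integrable setT (EFin \o g) ->
  Ex (fun w => f w + g w) = Ex f + Ex g.
Proof. by move=> ? ?; rewrite /Ex RintegralD. Qed.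

Lemma ExZ c f : P.-integrable setT (EFin \o f) ->
  Ex (fun w => c * f w) = c * Ex f.
Proof. by move=> ?; rewrite /Ex RintegralZl. Qed.

Lemma Ex_cst c : Ex (fun=> c) = c.
Proof. by rewrite /Ex Rintegral_cst //= probability_setT mulr1. Qed.

Lemma Ex_le f g : P.-integrable setT (EFin \o f) -> P.-integrable setT (EFin \o g) ->
  (forall w, f w <= g w) -> Ex f <= Ex g.
Proof. by move=> ? ? fg; apply: le_Rintegral => // w _; exact: fg. Qed.

Lemma Ex_ge0 f : (forall w, 0 <= f w) -> 0 <= Ex f.
Proof. by move=> f0; apply: Rintegral_ge0 => w _; exact: f0. Qed.

Lemma Ex_indic A : measurable A -> Ex (\1_A) = pr A.
Proof.
by move=> mA; rewrite /Ex /Rintegral integral_indic // setIT.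
Qed.

Lemma Ex_sum (I : Type) (s : seq I) (F : I -> T -> R) :
  (forall i, bmf (F i)) -> Ex (fun w => \sum_(i <- s) F i w) = \sum_(i <- s) Ex (F i).
Proof.
move=> hF; elim: s => [|i s IH].
  by under eq_fun do rewrite big_nil; rewrite Ex_cst big_nil.
under eq_fun do rewrite big_cons.
rewrite ExD ?IH ?big_cons //; apply: bmf_integrable => //.
exact: bmf_sum.
Qed.

Lemma Ex_norm_le f : bmf f -> `|Ex f| <= Ex (fun w => `|f w|).
Proof. by move=> hf; apply: le_normr_Rintegral => //; exact: bmf_integrable. Qed.

Lemma pr_markov f c : P.-integrable setT (EFin \o f) -> (forall w, 0 <= f w) ->
  measurable [set w | c <= f w] -> c * pr [set w | c <= f w] <= Ex f.
Proof.
move=> If f0 mA; have bA := bmf_integrable (bmf_indic mA).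
rewrite -Ex_indic // -ExZ //; apply: Ex_le => //.
  exact/bmf_integrable/bmfZ/bmf_indic.
move=> w; rewrite indicE; case: (boolP (w \in _)) => [|_]; last by rewrite mulr0.
by rewrite inE /= mulr1.
Qed.

Lemma measurable_ge f c : measurable_fun setT f -> measurable [set w | c <= f w].
Proof.
move=> mf; rewrite (_ : [set w | _] = setT `&` f @^-1` `[c, +oo[%classic).
  exact: mf.
by rewrite setTI; apply/seteqP; split => w /=; rewrite in_itv /= andbT.
Qed.

Lemma measurable_lt f c : measurable_fun setT f -> measurable [set w | f w < c].
Proof.
move=> mf; rewrite (_ : [set w | _] = setT `&` f @^-1` `]-oo, c[%classic).
  exact: mf.
by rewrite setTI; apply/seteqP; split => w /=; rewrite in_itv.
Qed.

End RealExpectation.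

(** * Independence of lists of random variables, and product formulas *)

Section Independence.
Context {R : realType} {d} {T : measurableType d} (P : probability T R).
Implicit Types (l p s : seq (T -> R)).
Local Notation pr := (pr P).
Local Notation Ex := (Ex P).

(* [evl l G]: [G] is a rectangle, an intersection of events [X \in B], one for each [X] in [l]. *)
Fixpoint evl l (G : set T) : Prop :=
  if l is a :: l' then exists (B : set R) (G' : set T),
    [/\ measurable B, evl l' G' & G = a @^-1` B `&` G']
  else G = setT.

(** Recursive form of mutual independence, suited to replacing consecutive variables by a function
    of them. Factors of a rectangle may be [setT], so events about only some of the variables are
    covered. *)
Fixpoint indepl l : Prop :=
  if l is a :: l' then
    (forall (B : set R) G, measurable B -> evl l' G ->
       pr (a @^-1` B `&` G) = pr (a @^-1` B) * pr G) /\ indepl l'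
  else True.

Definition mfl l := forall f, List.In f l -> measurable_fun setT f.

Lemma mfl_cons a l : mfl (a :: l) <-> measurable_fun setT a /\ mfl l.
Proof.
split=> [h|[ma ml] f /= [<-//|]]; last exact: ml.
by split=> [|f fl]; apply: h; [left|right].
Qed.

Lemma mfl_cat p l : mfl (p ++ l) <-> mfl p /\ mfl l.
Proof.
elim: p => [|a p IH] /=; first by split => [h|[]//]; split.
by rewrite !mfl_cons IH; tauto.
Qed.

Lemma measurable_preim (a : T -> R) B : measurable_fun setT a -> measurable B ->
  measurable (a @^-1` B).
Proof. by move=> ma mB; rewrite -[_ @^-1` _]setTI; exact: ma. Qed.

Lemma evl_setT l : evl l setT.
Proof.
elim: l => //= a l IH; exists setT, setT; split => //.
by rewrite preimage_setT setIT.
Qed.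

Lemma evl_measurable l G : mfl l -> evl l G -> measurable G.
Proof.
elim: l G => [G _ ->//|a l IH G] /= /mfl_cons[ma ml] [B [G' [mB hG ->]]].
by apply: measurableI; [exact: measurable_preim|exact: IH].
Qed.

Lemma evl_cat p l G : evl (p ++ l) G <->
  exists G1 G2, [/\ evl p G1, evl l G2 & G = G1 `&` G2].
Proof.
elim: p G => [|a p IH] G /=.
  split=> [h|[G1 [G2 [-> h ->]]]]; last by rewrite setTI.
  by exists setT, G; rewrite setTI.
split=> [[B [G' [mB /IH [G1 [G2 [h1 h2 ->]]] ->]]]|].
  by exists (a @^-1` B `&` G1), G2; split => //; [exists B, G1|rewrite setIA].
move=> [_ [G2 [[B [G' [mB h1 ->]] h2 ->]]]].
exists B, (G' `&` G2); split => //; last by rewrite setIA.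
by apply/IH; exists G', G2.
Qed.

(* Both sides are finite measures in the plane event, so they are determined by their values on rectangles. *)
Lemma pr_rectangle_unique (K1 K2 : set T) (c : R) (a b : T -> R) :
  measurable K1 -> measurable K2 -> 0 <= c ->
  measurable_fun setT a -> measurable_fun setT b ->
  (forall A B : set R, measurable A -> measurable B ->
     pr (K1 `&` (a @^-1` A `&` b @^-1` B)) =
     c * pr (K2 `&` (a @^-1` A `&` b @^-1` B))) ->
  forall C : set (R * R), measurable C ->
    pr (K1 `&` (fun w => (a w, b w)) @^-1` C) =
    c * pr (K2 `&` (fun w => (a w, b w)) @^-1` C).
Proof.
move=> mK1 mK2 c0 ma mb H C mC.
pose ab : T -> (R * R)%type := fun w => (a w, b w).
have mab : measurable_fun setT ab by exact: measurable_fun_pair.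
have mabC D : measurable D -> measurable (ab @^-1` D).
  by move=> mD; rewrite -[_ @^-1` _]setTI; exact: mab.
pose m1 := pushforward (mrestr P mK1) ab : {measure set (R * R) -> \bar R}.
pose m2 := mscale (NngNum c0) (pushforward (mrestr P mK2) ab) :
  {measure set (R * R) -> \bar R}.
have E1 D : measurable D -> m1 mab D = (pr (K1 `&` ab @^-1` D))%:E.
  move=> mD; transitivity (P (ab @^-1` D `&` K1)); first by [].
  rewrite setIC prE //.
  by apply: measurableI => //; exact: mabC.
have E2 D : measurable D -> m2 mab D = (c * pr (K2 `&` ab @^-1` D))%:E.
  move=> mD; transitivity (c%:E * P (ab @^-1` D `&` K2))%E; first by [].
  rewrite setIC EFinM prE //.
  by apply: measurableI => //; exact: mabC.
have : m1 mab C = m2 mab C; last by rewrite E1 // E2 // => -[].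
apply: (@measure_unique _ R (R * R)%type
  [set A `*` B | A in measurable & B in measurable] (fun=> setT `*` setT)) => //.
- exact: measurable_prod_measurableType.
- move=> _ _ [A1 mA1 [B1 mB1 <-]] [A2 mA2 [B2 mB2 <-]].
  exists (A1 `&` A2); first exact: measurableI.
  exists (B1 `&` B2); first exact: measurableI.
  by rewrite setXI.
- by move=> _; exists setT => //; exists setT.
- by apply/seteqP; split => // z _; exists 0%N.
- move=> _ [A mA [B mB <-]].
  by rewrite E1 ?E2 ?(H A B mA mB) //; exact: measurableX.
- by move=> _; rewrite E1 ?ltry //; exact: measurableX.
Qed.

(** The event that [h (a, b)] lies in [D] is a plane event in [(a, b)], so each factorisation need
    only be checked on rectangles. The prefix [p] allows merging in the middle of the list. *)
Lemma indepl_merge (h : R * R -> R) p a b l :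
  measurable_fun setT h -> mfl (p ++ a :: b :: l) ->
  indepl (p ++ a :: b :: l) -> indepl (p ++ (fun w => h (a w, b w)) :: l).
Proof.
move=> mh; pose ab w := (a w, b w).
have preh D : (fun w => h (a w, b w)) @^-1` D = ab @^-1` (h @^-1` D) by [].
have mhD (D : set R) : measurable D -> measurable (h @^-1` D).
  by move=> mD; rewrite -[_ @^-1` _]setTI; exact: mh.
elim: p => [|c p IH] /=.
  move=> /mfl_cons[ma /mfl_cons[mb ml]] [Ha [Hb Hl]]; split => // D G mD hG.
  have mG := evl_measurable ml hG.
  rewrite preh setIC [RHS]mulrC -[ab @^-1` _]setTI.
  rewrite [G `&` _]setIA setIT.
  (* Here [K1 = G], [K2 = setT] and the constant is [pr G]. *)
  apply: pr_rectangle_unique => //; [exact: pr_ge0| |exact: mhD].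
  move=> A B mA mB; rewrite setTI setIC -setIA.
  rewrite Ha //; last by exists B, G.
  rewrite Hb // -[in RHS](setIT (b @^-1` B)) Ha //; last first.
    by exists B, setT; split => //; exact: evl_setT.
  by rewrite setIT; ring.
move=> /mfl_cons[mc mpl] [Hc Hp]; split; last exact: IH.
move: mpl (mpl) => /mfl_cat[mp /mfl_cons[ma /mfl_cons[mb ml]]] mpl.
move=> B G mB /evl_cat[G1 [_ [h1 [D [G2 [mD h2 ->]]] ->]]].
have mG1 := evl_measurable mp h1; have mG2 := evl_measurable ml h2.
have mcB := measurable_preim mc mB.
rewrite (_ : G1 `&` _ = (G1 `&` G2) `&` ab @^-1` (h @^-1` D)); last first.
  by rewrite preh -!setIA [X in G1 `&` X]setIC.
(* Here [K1] is [K2 = G1] intersected with [G2], cut by the event on the head [c]; the constant is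
   the probability of that event. *)
rewrite setIA; apply: pr_rectangle_unique; rewrite ?pr_ge0 //.
- by apply: measurableI => //; apply: measurableI.
- by apply: measurableI.
- move=> A A' mA mA'; rewrite -setIA Hc //.
  apply/evl_cat; exists G1, (a @^-1` A `&` (b @^-1` A' `&` G2)); split => //.
    by exists A, (b @^-1` A' `&` G2); split => //; exists A', G2.
  by rewrite -!setIA; congr (_ `&` _); rewrite [LHS]setIC -setIA.
- exact: mhD.
Qed.

Lemma indepl_fold (op : R -> R -> R) (idx : R) p b l s :
  (forall x, op x idx = x) ->
  measurable_fun setT (fun z : R * R => op z.1 z.2) ->
  mfl (p ++ (b :: l) ++ s) -> indepl (p ++ (b :: l) ++ s) ->
  indepl (p ++ (fun w => \big[op/idx]_(f <- b :: l) f w) :: s).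
Proof.
move=> opx mop; elim: l p b => [|c l IH] p b.
  move=> _ h; rewrite [X in X :: s](_ : _ = b) //.
  by apply/funext => w; rewrite big_cons big_nil opx.
move=> m h; rewrite -cat_rcons in m; rewrite -cat_rcons in h.
have h2 := IH (rcons p b) c m h; rewrite cat_rcons in h2.
have -> : (fun w => \big[op/idx]_(f <- b :: c :: l) f w) =
  (fun w => op (b w) (\big[op/idx]_(f <- c :: l) f w)).
  by apply/funext => w; rewrite big_cons.
apply: (indepl_merge mop _ h2).
move: m; rewrite cat_rcons => /mfl_cat[mp /mfl_cons[mb m]].
apply/mfl_cat; split => //; apply/mfl_cons; split => //.
move: m; rewrite -cat_cons => /mfl_cat[mcl ms].
apply/mfl_cons; split => //; case/mfl_cons: mcl => mc ml.
elim: l c mc ml {IH h h2} => [|e l IHl] c mc ml.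
  by under eq_fun do rewrite big_cons big_nil opx.
move: ml => /mfl_cons[me ml].
under eq_fun do rewrite big_cons.
exact: (measurableT_comp mop (measurable_fun_pair mc (IHl _ me ml))).
Qed.

(** The prefix [p] collects the row sums already formed; each induction step folds one more row into
    it. Rows must be nonempty because an empty one contributes no variable to the flattened list. *)
Lemma indepl_rows p (rows : seq (seq (T -> R))) :
  (forall r, List.In r rows -> r <> [::]) ->
  mfl (p ++ flatten rows) -> indepl (p ++ flatten rows) ->
  indepl (p ++ [seq (fun w => \sum_(f <- r) f w) | r <- rows]).
Proof.
elim: rows p => [|r rows IH] p //= nz m h.
case: r nz m h => [|b l] nz m h; first by have := nz [::] (or_introl erefl).
have mF : measurable_fun setT (fun w => \sum_(f <- b :: l) f w).
  move: m => /mfl_cat[_ /mfl_cat[m _]].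
  elim: {nz h} (b :: l) m => [|e k IHk].
    by move=> _; under eq_fun do rewrite big_nil; exact: measurable_cst.
  move=> /mfl_cons[me mk]; under eq_fun do rewrite big_cons.
  by apply: measurable_funD => //; exact: IHk.
rewrite -cat_rcons; apply: IH; first by move=> r hr; apply: nz; right.
  rewrite cat_rcons; move: m => /mfl_cat[mp /mfl_cat[_ m]].
  by apply/mfl_cat; split => //; apply/mfl_cons.
rewrite cat_rcons; apply: indepl_fold => //; first by move=> x; rewrite addr0.
by apply: measurable_funD; [exact: measurable_fst|exact: measurable_snd].
Qed.

Lemma indepl_pr_bigcap l (B : set R) : mfl l -> measurable B -> indepl l ->
  pr (\big[setI/setT]_(f <- l) (f @^-1` B)) = \prod_(f <- l) pr (f @^-1` B).
Proof.
move=> + mB; elim: l => [|a l IH]; first by rewrite !big_nil pr_setT.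
move=> /mfl_cons[ma ml] /= [h hl]; rewrite !big_cons h ?IH //.
elim: l {IH ml h hl} => [|b l IH]; first by rewrite big_nil.
by rewrite big_cons; exists B, (\big[setI/setT]_(f <- l) f @^-1` B).
Qed.

(** The joint law of [(a, b)] is the product of the marginal laws, so Tonelli's theorem applies. *)
Lemma Ex_mul_ge0 (a b : T -> R) : bmf a -> bmf b ->
  (forall w, 0 <= a w) -> (forall w, 0 <= b w) ->
  (forall A B : set R, measurable A -> measurable B ->
     pr (a @^-1` A `&` b @^-1` B) = pr (a @^-1` A) * pr (b @^-1` B)) ->
  Ex (fun w => a w * b w) = Ex a * Ex b.
Proof.
move=> ba bb a0 b0 H; have [ma _] := ba; have [mb _] := bb.
pose am : {RV P >-> R} := mfun_Sub (mem_set ma).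
pose bm : {RV P >-> R} := mfun_Sub (mem_set mb).
have mab : measurable_fun setT (fun w => (a w, b w)).
  exact: measurable_fun_pair.
pose m1 := pushforward P (fun w => (a w, b w)) : {measure set (R * R) -> \bar R}.
have EA (C : set (R * R)) : measurable C ->
    (distribution P am \x distribution P bm)%E C = m1 mab C.
  apply: product_measure_unique => A B mA mB.
  transitivity (P (a @^-1` A `&` b @^-1` B)); first by [].
  rewrite prE; last by apply: measurableI; apply: measurable_preim.
  rewrite H // EFinM -!prE //; exact: measurable_preim.
(* Absolute values make [f] nonnegative on the whole plane, as Tonelli requires; at values taken by
   [a] and [b] they change nothing. *)
pose f (z : R * R) : \bar R := (`|z.1| * `|z.2|)%:E.
have mf : measurable_fun setT f.
  apply/measurable_EFinP; apply: measurable_funM.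
    by apply: measurableT_comp => //; exact: measurable_fst.
  by apply: measurableT_comp => //; exact: measurable_snd.
have L : (\int[distribution P am \x distribution P bm]_z f z)%E =
   (\int[P]_w (a w * b w)%:E)%E.
  transitivity (\int[m1 mab]_z f z)%E.
    by apply: eq_measure_integral => A mA _; exact: EA.
  rewrite (ge0_integral_pushforward mab) //.
    by apply: eq_integral => w _; rewrite /f /= !ger0_norm.
  by move=> z _; rewrite lee_fin mulr_ge0.
have mabs : measurable_fun setT (fun x : R => (`|x|)%:E).
  by apply/measurable_EFinP; exact: normr_measurable.
have Eb : (\int[distribution P bm]_y (`|y|)%:E)%E = (Ex b)%:E.
  rewrite ge0_integral_distribution //.
  rewrite /Ex /Rintegral fineK; last exact/integrable_fin_num/bmf_integrable.
  by apply: eq_integral => w _ /=; rewrite ger0_norm //; exact: b0.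
have Ea : (\int[distribution P am]_y (`|y|)%:E)%E = (Ex a)%:E.
  rewrite ge0_integral_distribution //.
  rewrite /Ex /Rintegral fineK; last exact/integrable_fin_num/bmf_integrable.
  by apply: eq_integral => w _ /=; rewrite ger0_norm //; exact: a0.
transitivity (fine (\int[P]_w (a w * b w)%:E)%E); first by [].
rewrite -L fubini_tonelli1 //; last first.
  by move=> z; rewrite lee_fin mulr_ge0.
rewrite /fubini_F (eq_integral (fun x : R => (Ex b)%:E * (`|x|)%:E)%E); last first.
  move=> x _; transitivity (\int[distribution P bm]_y (`|x|%:E * `|y|%:E))%E.
    by apply: eq_integral => y _.
  by rewrite ge0_integralZl // Eb muleC.
rewrite ge0_integralZl //; last by rewrite lee_fin; exact: Ex_ge0.
by rewrite Ea -EFinM /= mulrC.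
Qed.

(** Adding the bounds [M] and [M'] makes both factors nonnegative and keeps them independent;
    expanding the product then removes the shifts. *)
Lemma Ex_mul (a b : T -> R) : bmf a -> bmf b ->
  (forall A B : set R, measurable A -> measurable B ->
     pr (a @^-1` A `&` b @^-1` B) = pr (a @^-1` A) * pr (b @^-1` B)) ->
  Ex (fun w => a w * b w) = Ex a * Ex b.
Proof.
move=> ba bb H; have [ma [M aM]] := ba; have [mb [M' bM]] := bb.
have shiftP (f : T -> R) c (A : set R) :
    (fun w => f w + c) @^-1` A = f @^-1` ((fun x => x + c) @^-1` A) by [].
have mshift c (A : set R) : measurable A -> measurable ((fun x : R => x + c) @^-1` A).
  move=> mA; rewrite -[_ @^-1` _]setTI.
  have h : measurable_fun setT (fun x : R => x + c).
    by apply: measurable_funD; [exact: measurable_id|exact: measurable_cst].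
  exact: h.
have bc c (f : T -> R) : bmf f -> bmf (fun w => f w + c).
  by move=> ?; apply: bmfD => //; exact: bmf_cst.
have Exc c (f : T -> R) : bmf f -> Ex (fun w => f w + c) = Ex f + c.
  move=> ?; rewrite ExD ?Ex_cst //; apply: bmf_integrable => //; exact: bmf_cst.
have E : Ex (fun w => (a w + M) * (b w + M')) = (Ex a + M) * (Ex b + M').
  rewrite Ex_mul_ge0 ?Exc //; try exact: bc.
  - by move=> w; have := aM w; rewrite ler_norml; lra.
  - by move=> w; have := bM w; rewrite ler_norml; lra.
  - by move=> A B mA mB; rewrite !shiftP H //; exact: mshift.
move: E; rewrite (_ : (fun w => _) =
   (fun w => a w * b w + (M' * a w + (M * b w + M * M')))); last first.
  by apply/funext => w; ring.
have b1 := bmfM ba bb; have b2 := bmfZ M' ba; have b3 := bmfZ M bb.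
have b4 : bmf (fun _ : T => M * M') by exact: bmf_cst.
have bi := @bmf_integrable _ _ _ P.
rewrite (ExD (bi _ b1) (bi _ (bmfD b2 (bmfD b3 b4)))).
rewrite (ExD (bi _ b2) (bi _ (bmfD b3 b4))) (ExD (bi _ b3) (bi _ b4)).
rewrite (ExZ M' (bi _ ba)) (ExZ M (bi _ bb)) Ex_cst.
by move=> h; rewrite -[LHS](addrK (M' * Ex a + (M * Ex b + M * M'))) h; ring.
Qed.

Lemma Ex_prod_indepl l : (forall f, List.In f l -> bmf f) -> indepl l ->
  Ex (fun w => \prod_(f <- l) f w) = \prod_(f <- l) Ex f.
Proof.
elim: l => [|a l IH] bl h.
  by under eq_fun do rewrite big_nil; rewrite Ex_cst big_nil.
have ml : mfl (a :: l) by move=> f fl; have [] := bl f fl.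
have ba : bmf a by apply: bl; left.
under eq_fun do rewrite big_cons.
rewrite big_cons -IH; last by case: h.
2: by move=> f fl; apply: bl; right.
case: l {IH} bl ml h => [|b l] bl ml h.
  under eq_fun do rewrite big_nil mulr1.
  by under [X in _ * Ex X]eq_fun do rewrite big_nil; rewrite Ex_cst mulr1.
apply: Ex_mul => //.
  have : forall f, List.In f (b :: l) -> bmf f by move=> f fl; apply: bl; right.
  elim: (b :: l) => [|c k IH] hk.
    by under eq_fun do rewrite big_nil; exact: bmf_cst.
  under eq_fun do rewrite big_cons.
  by apply: bmfM; [apply: hk; left|apply: IH => f fk; apply: hk; right].
move=> A B mA mB.
have /= [h1 _] : indepl [:: a; (fun w => \prod_(f <- b :: l) f w)].
  apply: (@indepl_fold _ _ [:: a] b l [::]); rewrite /= ?cats0 //.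
  - by move=> x; rewrite mulr1.
  - by apply: measurable_funM; [exact: measurable_fst|exact: measurable_snd].
by apply: h1 => //; exists B, setT; rewrite setIT.
Qed.

(** Bridge from independence of an indexed family to the list form, with a measurable transformation
    applied to each variable on the way. *)
Lemma mutually_independent_indepl (I : eqType) (D : set I) (X : I -> T -> R)
  (f : I -> R -> R) (s : seq I) :
  mutually_independent P D X -> (forall i, D i -> measurable_fun setT (X i)) ->
  (forall i, measurable_fun setT (f i)) -> uniq s -> (forall i, i \in s -> D i) ->
  indepl [seq (fun w => f i (X i w)) | i <- s].
Proof.
move=> H mX mf us sD.
have evE (t : seq I) G : uniq t ->
    evl [seq (fun w => f i (X i w)) | i <- t] G ->
    exists B : I -> set R, (forall i, measurable (B i)) /\
      G = \bigcap_(i in [set j | j \in t]) (X i @^-1` B i).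
  elim: t G => [|i t IH] G /=.
    move=> _ ->; exists (fun=> setT); split=> //.
    by apply/seteqP; split => // w _ i /=; rewrite in_nil.
  move=> /andP[it ut] [B [G' [mB hG' ->]]].
  have [B' [mB' ->]] := IH G' ut hG'.
  (* As the list has no duplicates, the set assigned to [i] does not disturb those of the tail. *)
  exists (fun j => if j == i then f i @^-1` B else B' j); split.
    move=> j; case: eqP => // _; rewrite -[_ @^-1` _]setTI; exact: mf.
  apply/seteqP; split => w /=.
    move=> [h1 h2] j /=; rewrite inE => /orP[/eqP ->|jt]; first by rewrite eqxx.
    case: eqP => [e|_]; last exact: h2.
    by move: it; rewrite -e jt.
  move=> h; split; first by have := h i (mem_head _ _); rewrite eqxx.
  move=> j /= jt; have := h j; rewrite /= inE jt orbT => /(_ isT).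
  by case: eqP => // e; move: it; rewrite -e jt.
have prbig (t : seq I) (B : I -> set R) : uniq t -> (forall i, i \in t -> D i) ->
    (forall i, measurable (B i)) ->
    pr (\bigcap_(i in [set j | j \in t]) (X i @^-1` B i)) =
    \prod_(i <- t) pr (X i @^-1` B i).
  move=> ut tD mB; rewrite /pr H //.
  elim: t tD {ut} => [|i t IH] tD; first by rewrite !big_nil.
  rewrite !big_cons fineM.
  - by rewrite IH // => j jt; apply: tD; rewrite inE jt orbT.
  - apply: fin_num_measure; apply: measurable_preim => //; apply: mX.
    by apply: tD; rewrite mem_head.
  elim: t {IH} tD => [|j t IH] tD; first by rewrite big_nil.
  rewrite big_cons fin_numM //.
    apply: fin_num_measure; apply: measurable_preim => //; apply: mX.
    by apply: tD; rewrite !inE eqxx orbT.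
  apply: IH => k; rewrite inE => /orP[/eqP ->|kt]; first by apply: tD; rewrite mem_head.
  by apply: tD; rewrite !inE kt !orbT.
elim: s us sD => [//|i s IH] /= /andP[is_ us] sD; split; last first.
  by apply: IH => // j js; apply: sD; rewrite inE js orbT.
move=> B G mB /(evE _ _ us)[B' [mB' ->]].
have usi : uniq (i :: s) by rewrite /= is_.
have mfB : measurable (f i @^-1` B) by rewrite -[_ @^-1` _]setTI; exact: mf.
have sD' j : j \in s -> D j by move=> js; apply: sD; rewrite inE js orbT.
rewrite prbig //.
pose B2 j := if j == i then f i @^-1` B else B' j.
have mB2 j : measurable (B2 j) by rewrite /B2; case: eqP.
have := prbig (i :: s) B2 usi sD mB2.
rewrite big_cons (_ : B2 i = f i @^-1` B); last by rewrite /B2 eqxx.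
rewrite (_ : \bigcap_(_ in _) _ = (fun w => f i (X i w)) @^-1` B `&`
   \bigcap_(i in [set j | j \in s]) (X i @^-1` B' i)); last first.
  apply/seteqP; split => w /=.
    move=> h; split; first by have := h i (mem_head _ _); rewrite /B2 /= eqxx.
    move=> j /= jt; have := h j; rewrite /B2 /= inE jt orbT => /(_ isT).
    by case: eqP => // e; move: is_; rewrite -e jt.
  move=> [h1 h2] j /=; rewrite inE /B2 => /orP[/eqP ->|jt]; first by rewrite eqxx.
  case: eqP => [e|_]; last exact: h2.
  by move: is_; rewrite -e jt.
move=> ->; congr (_ * _); apply: eq_big_seq => j js.
by rewrite /B2; case: eqP => // e; move: is_; rewrite -e js.
Qed.

End Independence.

Lemma bmf_norm {R : realType} {d} {T : measurableType d} (f : T -> R) :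
  bmf f -> bmf (fun w => `|f w|).
Proof.
move=> [mf [M fM]]; split; first exact: measurableT_comp.
by exists M => w; rewrite normr_id.
Qed.

Definition upper N (e : 'I_N * 'I_N) := (e.1 <= e.2)%N.

(** * Trace method: expected traces of powers, by counting walks *)

Section TraceMethod.
Context {R : realType} {d} {T : measurableType d} (P : probability T R).
Local Notation Ex := (Ex P).
Variables (N : nat) (Y : 'I_N * 'I_N -> T -> R) (B : R).
Hypothesis indY : mutually_independent P [set e | upper e] Y.
Hypothesis mY : forall e, measurable_fun setT (Y e).
Hypothesis YB : forall e w, `|Y e w| <= B.
Hypothesis B1 : 1 <= B.
Hypothesis EY : forall e, upper e -> Ex (Y e) = 0.
Hypothesis EY2 : forall e, upper e -> Ex (fun w => Y e w ^+ 2) <= 1.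

(** Sorting the pair makes [symx] symmetric and ensures that only the independent variables, those
    with [upper] index, occur in it. *)
Definition edge (x y : 'I_N) := if (x <= y)%N then (x, y) else (y, x).
Definition symx w : 'M[R]_N := \matrix_(i, j) Y (edge i j) w.

Implicit Types (m : 'I_N * 'I_N -> nat) (V : {set 'I_N}).

Definition monomial m w : R := \prod_(e | upper e) Y e w ^+ m e.
Definition incr m x y : 'I_N * 'I_N -> nat := fun e => (m e + (e == edge x y))%N.
(** Edges still to be traversed again: one that stays open contributes a mean-zero factor. *)
Definition open_edges m := (\sum_(e | upper e) (m e == 1))%N.
(** The subtraction truncates at 0, so only traversals beyond the second are counted; each of them
    costs a factor [B]. *)
Definition excess m := (\sum_(e | upper e) (m e - 2))%N.
Definition open_degree m v := (\sum_u (m (edge v u) == 1))%N.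

Lemma edgeC x y : edge x y = edge y x.
Proof.
rewrite /edge; case: ltngtP => // h.
by rewrite (val_inj h).
Qed.

Lemma edge_upper x y : upper (edge x y).
Proof. by rewrite /edge; case: leqP => h; rewrite /upper //= ltnW. Qed.

Lemma eq_edge x y u v : (edge u v == edge x y) =
  ((u == x) && (v == y)) || ((u == y) && (v == x)).
Proof.
apply/eqP/idP; last first.
  by case/orP => /andP[/eqP -> /eqP ->] //; rewrite edgeC.
rewrite /edge; case: ifP => _; case: ifP => _ [-> ->]; rewrite !eqxx ?orbT //.
Qed.

Lemma bY e : bmf (Y e).
Proof. by split=> //; exists B. Qed.

Lemma Ex_monomial m :
  Ex (monomial m) = \prod_(e | upper e) Ex (fun w => Y e w ^+ m e).
Proof.
pose s := [seq e <- index_enum ('I_N * 'I_N)%type | upper e].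
pose l := [seq (fun w => Y e w ^+ m e) | e <- s].
rewrite (_ : monomial m = (fun w => \prod_(f <- l) f w)); last first.
  by apply/funext => w; rewrite big_map big_filter.
rewrite Ex_prod_indepl; first by rewrite big_map big_filter.
  rewrite /l => f; elim: (s) => //= e s' IH [<-|//].
  exact/bmfX/bY.
apply: (mutually_independent_indepl (f := fun e x => x ^+ m e) indY) => //.
- by rewrite filter_uniq // index_enum_uniq.
- by move=> e; rewrite mem_filter => /andP[].
Qed.

(** For [k >= 2] all but two factors are bounded by [B], the others by the second moment. For
    [k < 2] the right-hand side is 1 by truncated subtraction. *)
Lemma Ex_power e k : upper e -> `|Ex (fun w => Y e w ^+ k)| <= B ^+ (k - 2).
Proof.
move=> he; case: k => [|[|k]].
- by under eq_fun do rewrite expr0; rewrite Ex_cst normr1.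
- by under eq_fun do rewrite expr1; rewrite EY // normr0 ler01.
rewrite -addn2 addnK; apply: (le_trans (Ex_norm_le P (bmfX _ (bY e)))).
have b2 : bmf (fun w => B ^+ k * Y e w ^+ 2) by apply/bmfZ/bmfX/bY.
apply: (@le_trans _ _ (Ex (fun w => B ^+ k * Y e w ^+ 2))).
  apply: Ex_le; [exact/bmf_integrable/bmf_norm/bmfX/bY|exact: bmf_integrable|].
  move=> w; rewrite exprD normrM (ger0_norm (sqr_ge0 _)) ler_wpM2r ?sqr_ge0 //.
  by rewrite normrX lerXn2r // nnegrE (le_trans ler01).
rewrite ExZ; last exact/bmf_integrable/bmfX/bY.
by rewrite ler_piMr ?EY2 // exprn_ge0 // (le_trans ler01).
Qed.

Lemma Ex_monomial_le m : `|Ex (monomial m)| <= B ^+ excess m.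
Proof.
rewrite Ex_monomial normr_prod /excess expr_sum.
by apply: ler_prod => e he; rewrite normr_ge0 Ex_power.
Qed.

Lemma Ex_monomial_open m : (0 < open_edges m)%N -> Ex (monomial m) = 0.
Proof.
rewrite lt0n sum_nat_eq0 negb_forall => /existsP[e].
rewrite negb_imply => /andP[he]; rewrite eqb0 negbK => /eqP me.
rewrite Ex_monomial (bigD1 e) //= me.
by under [X in Ex X * _]eq_fun do rewrite expr1; rewrite EY // mul0r.
Qed.

Lemma monomial_incr m x y w :
  monomial (incr m x y) w = monomial m w * Y (edge x y) w.
Proof.
rewrite /monomial (bigD1 (edge x y)) ?edge_upper //=.
rewrite [X in _ = X * _](bigD1 (edge x y)) ?edge_upper //=.
rewrite /incr eqxx addn1 exprSr mulrAC; congr (_ * _ * _).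
by apply: eq_bigr => e /andP[_ /negPf ->]; rewrite addn0.
Qed.

Lemma open_edges_incr m x y (k := m (edge x y)) :
  (open_edges (incr m x y) + (k == 1) = open_edges m + (k == 0))%N.
Proof.
rewrite /open_edges (bigD1 (edge x y)) ?edge_upper //=.
rewrite [X in _ = (X + _)%N](bigD1 (edge x y)) ?edge_upper //=.
rewrite -/k (eq_bigr (fun e => (m e == 1%N) : nat)); last first.
  by move=> e /andP[_ /negPf h]; rewrite /incr h addn0.
rewrite /incr eqxx addn1 eqSS -/k; lia.
Qed.

Lemma excess_incr m x y : excess (incr m x y) = (excess m + (1 < m (edge x y)))%N.
Proof.
rewrite /excess (bigD1 (edge x y)) ?edge_upper //=.
rewrite [X in _ = (X + _)%N](bigD1 (edge x y)) ?edge_upper //=.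
rewrite (eq_bigr (fun e => m e - 2)%N); last first.
  by move=> e /andP[_ /negPf h]; rewrite /incr h addn0.
rewrite /incr eqxx addn1; lia.
Qed.

Lemma sum_nat_eq1 (o : 'I_N) : (\sum_u (u == o))%N = 1%N.
Proof. by rewrite (bigD1 o) //= eqxx big1 // => u /negPf ->. Qed.

Lemma open_degree_incr m x y v :
  (open_degree (incr m x y) v <= open_degree m v + ((v == x) || (v == y)))%N.
Proof.
(* The neighbour of [v] across the new edge, the only index whose summand can grow. *)
pose o := if v == x then y else x.
apply: (@leq_trans (\sum_u ((m (edge v u) == 1) +
    (u == o) * ((v == x) || (v == y))))%N).
  apply: leq_sum => u _; rewrite /incr eq_edge /o.
  have [->|_] := eqVneq v x; rewrite /=.
    have [->|_] := eqVneq x y; rewrite /=; case: (u == y) => /=; lia.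
  case: (v == y); case: (u == x) => /=; lia.
by rewrite big_split /= -big_distrl /= sum_nat_eq1 mul1n.
Qed.

(** The drop at [y] is what the walk invariant needs: there the current end is held one below the
    bound for the other vertices, and [y] becomes the current end. *)
Lemma open_degree_close m x y v : m (edge x y) = 1%N ->
  (open_degree (incr m x y) v + (v == y) <= open_degree m v)%N.
Proof.
move=> h; have -> : (v == y) = (\sum_u ((u == x) * (v == y)))%N :> nat.
  by rewrite -big_distrl /= sum_nat_eq1 mul1n.
rewrite -big_split /=; apply: leq_sum => u _; rewrite /incr.
have [e|ne] := eqVneq (edge v u) (edge x y); first by rewrite e h; lia.
have [ux|_] := eqVneq u x; last by lia.
have [vy|_] := eqVneq v y; last by lia.
by move: ne; rewrite ux vy edgeC eqxx.
Qed.

Lemma bmf_monomial m : bmf (monomial m).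
Proof. by apply: bmf_prod => e; exact/bmfX/bY. Qed.

Lemma bmf_symx_exp n x z : bmf (fun w => (symx w ^+ n) x z).
Proof.
elim: n x z => [|n IH] x z.
  by under eq_fun do rewrite expr0; exact: bmf_cst.
under eq_fun do rewrite exprS -mulmxE mxE.
apply: bmf_sum => y; under eq_fun do rewrite mxE.
by apply: bmfM => //; exact: bY.
Qed.

Variable Q : R.
Hypothesis Q2 : Q ^+ 2 = N%:R.
Hypothesis Q1 : 1 <= Q.

(* [m] records how often each edge was used by the walk so far, [x] is its current end, [V] contains all visited vertices. An edge used once must be used again, which costs nothing but offers at most [2 c + 1] choices, where [c] counts the defects, i.e. the steps between visited vertices other than closing an open edge. A step to a new vertex has [N = Q^2] choices and opens an edge, worth [1/Q] now and [1/Q] when it is closed; a defect has at most [|V|] choices, each gaining a factor [B/Q]. *)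
Lemma Ex_monomial_symx_exp n m x z (c : nat) V : x \in V ->
  (forall u v, m (edge u v) != 0%N -> u \in V) ->
  (forall v, open_degree m v <= c.*2.+1 + (v != x))%N ->
  2 ^+ n * (#|V| + n)%:R * B <= Q ->
  `|Ex (fun w => monomial m w * (symx w ^+ n) x z)| <=
    3 ^+ n * 2 ^+ (c * n) * (B ^+ excess m * Q ^+ n / Q ^+ open_edges m).
Proof.
have Q0 : 0 < Q by exact: lt_le_trans Q1.
have B0 : 0 < B by exact: lt_le_trans B1.
have Qn0 : Q != 0 by rewrite gt_eqF.
elim: n m x z c V => [|n IH] m x z c V xV mV deg hB.
  under eq_fun do rewrite expr0 mxE mulr_natr.
  rewrite muln0 !expr0 !mul1r mulr1.
  have F0 : 0 <= B ^+ excess m / Q ^+ open_edges m.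
    by rewrite divr_ge0 ?exprn_ge0 ?(ltW B0) ?(ltW Q0).
  case: eqP => _; last first.
    by under eq_fun do rewrite mulr0n; rewrite Ex_cst normr0.
  under eq_fun do rewrite mulr1n.
  case: (posnP (open_edges m)) => [->|/Ex_monomial_open]; last first.
    by rewrite -/(monomial m) => ->; rewrite normr0.
  by rewrite expr0 divr1; exact: Ex_monomial_le.
have -> : (fun w => monomial m w * (symx w ^+ n.+1) x z) =
    (fun w => \sum_y monomial (incr m x y) w * (symx w ^+ n) y z).
  apply/funext => w; rewrite exprS -mulmxE mxE mulr_sumr.
  by apply: eq_bigr => y _; rewrite mxE monomial_incr mulrA.
rewrite Ex_sum; last first.
  by move=> y; apply: bmfM; [exact: bmf_monomial|exact: bmf_symx_exp].
apply: (le_trans (ler_norm_sum _ _ _)).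
pose G := B ^+ excess m * Q ^+ n.+1 / Q ^+ open_edges m.
have G0 : 0 <= G.
  by rewrite /G divr_ge0 ?mulr_ge0 ?exprn_ge0 ?(ltW B0) ?(ltW Q0).
have Qo0 : Q ^+ open_edges m != 0 by rewrite expf_neq0.
(* One more defect raises the allowance for the remaining [n] steps by [2 ^+ n]. By [hB], all
   defects available at this step still cost at most 1 together. *)
pose K c : R := 3 ^+ n * 2 ^+ (c * n).
have K0 c' : 0 <= K c' by rewrite /K mulr_ge0 ?exprn_ge0.
have hB' V' : (#|V'| <= #|V|.+1)%N -> 2 ^+ n * (#|V'| + n)%:R * B <= Q.
  move=> hV; apply: le_trans hB; rewrite ler_wpM2r ?(ltW B0) //.
  rewrite ler_pM ?exprn_ge0 //; first by rewrite ler_weXn2l ?ler1n.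
  by rewrite ler_nat addnS -addSn leq_add2r.
apply: (@le_trans _ _ (\sum_y (K c * (G / Q ^+ 2) +
    (m (edge x y) == 1%N)%:R * (K c * G) +
    (y \in V)%:R * (K c.+1 * (G * (B / Q)))))).
  apply: ler_sum => y _.
  have mV' V' : V \subset V' -> y \in V' -> forall u v, incr m x y (edge u v) != 0%N -> u \in V'.
    move=> /fintype.subsetP sV yV' u v; rewrite /incr addn_eq0 negb_and.
    case/orP => [/mV/sV //|]; rewrite eqb0 negbK eq_edge.
    by case/orP => /andP[/eqP -> _] //; exact: sV.
  have T1 : 0 <= K c * (G / Q ^+ 2).
    apply: mulr_ge0 => //; apply: divr_ge0 => //; apply: exprn_ge0; exact: ltW.
  have T2 : 0 <= K c * G by rewrite mulr_ge0.
  have T3 : 0 <= K c.+1 * (G * (B / Q)).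
    apply: mulr_ge0 => //; apply: mulr_ge0 => //; apply: divr_ge0; exact: ltW.
  have OE := open_edges_incr m x y.
  case: (boolP (y \in V)) => yV; last first.
    have m0 u : m (edge y u) = 0%N.
      by apply/eqP; apply: contraNT yV => /mV.
    have mxy : m (edge x y) = 0%N by rewrite edgeC.
    rewrite mxy /= !mul0r !addr0 in OE *.
    have := IH (incr m x y) y z c (y |: V).
    rewrite excess_incr mxy /= addn0 in OE *.
    rewrite OE => /(_ _ _ _ _)/le_trans; apply.
    - by rewrite setU11.
    - by apply: mV'; rewrite ?finset.subsetUr ?setU11.
    - move=> v; have h := open_degree_incr m x y v.
      apply: (leq_trans h); case: (eqVneq v y) => [->|vy].
        by rewrite orbT /open_degree big1 // => u _; rewrite m0.
      by rewrite orbF; move: (deg v); clear; case: (v == x) => /=; lia.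
    - by apply: hB'; rewrite cardsU1 yV.
    rewrite /K ler_wpM2l ?mulr_ge0 ?exprn_ge0 //.
    rewrite addn0 /G addn1 [Q ^+ n.+1]exprS [Q ^+ (_).+1]exprS le_eqVlt; apply/orP; left; apply/eqP.
    by field; rewrite ?Qn0 ?Qo0 ?expf_neq0.
  have hV : V \subset V by [].
  case: (eqVneq (m (edge x y)) 1%N) => mxy.
    rewrite mxy /= addn0 mul1r addn1 in OE *.
    apply: (@le_trans _ _ (K c * G)); last first.
      by rewrite -addrA ler_wpDl // ler_wpDr // mulr_ge0.
    have := IH (incr m x y) y z c V yV (mV' V hV yV).
    rewrite excess_incr mxy /= addn0 => /(_ _ _)/le_trans; apply.
    - move=> v; move: (open_degree_close v mxy) (deg v); clear.
      by case: (eqVneq v y) => [->|vy]; case: (_ == x) => /=; lia.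
    - by apply: hB'.
    rewrite /K ler_wpM2l ?mulr_ge0 ?exprn_ge0 //.
    rewrite /G -OE exprS [Q ^+ (open_edges _).+1]exprS le_eqVlt; apply/orP; left; apply/eqP.
    by field; rewrite ?Qn0 ?Qo0 ?expf_neq0.
  rewrite mul0r addr0 mul1r.
  apply: (@le_trans _ _ (K c.+1 * (G * (B / Q)))); last by rewrite ler_wpDl.
  have := IH (incr m x y) y z c.+1 V yV (mV' V hV yV).
  rewrite excess_incr => /(_ _ _)/le_trans; apply.
  - move=> v; move: (open_degree_incr m x y v) (deg v); clear.
    by case: (v == x); case: (v == y) => /=; lia.
  - by apply: hB'.
  rewrite /K ler_wpM2l ?mulr_ge0 ?exprn_ge0 //.
  rewrite /= (negPf mxy) addn0 in OE; rewrite OE.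
  (* A defect either opens an edge between visited vertices, where there is room to spare, or
     repeats an edge used at least twice, where [excess] grows and the estimate is an equality. *)
  case: (posnP (m (edge x y))) => mxy0.
    rewrite mxy0 /= addn0 addn1 [Q ^+ (_).+1]exprS /G [Q ^+ n.+1]exprS.
    rewrite (_ : B ^+ excess m * Q ^+ n / (Q * _) =
      B ^+ excess m * Q ^+ n / Q ^+ open_edges m * (1 / Q)); last first.
      by field; rewrite ?Qn0 ?Qo0 ?expf_neq0.
    rewrite (_ : _ * (B / Q) =
      B ^+ excess m * Q ^+ n / Q ^+ open_edges m * B); last first.
      by field; rewrite ?Qn0 ?Qo0 ?expf_neq0.
    rewrite ler_wpM2l ?divr_ge0 ?mulr_ge0 ?exprn_ge0 ?(ltW B0) ?(ltW Q0) //.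
    by rewrite ler_pdivrMr // (le_trans B1) // ler_peMr // ltW.
  have -> : (1 < m (edge x y))%N by move: mxy mxy0; clear; lia.
  rewrite /= addn0 addn1 /G [B ^+ (_).+1]exprS [Q ^+ n.+1]exprS le_eqVlt; apply/orP; left; apply/eqP.
  by field; rewrite ?Qn0 ?Qo0 ?expf_neq0.
rewrite !big_split /= sumr_const card_ord -!mulr_suml -!natr_sum.
rewrite -/(open_degree m x).
have -> : (\sum_y (y \in V))%N = #|V|.
  by rewrite -sum1_card [RHS]big_mkcond /=; apply: eq_bigr => u _; case: (u \in V).
rewrite -[X in X + _ + _ <= _]mulr_natr -Q2 -[X in X + _ + _ <= _]mulrA.
rewrite (divfK (expf_neq0 2 Qn0)).
set V0 := #|V|%:R; set o := (open_degree m x)%:R.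
have hK : K c.+1 = K c * 2 ^+ n by rewrite /K mulSn exprD; ring.
have o1 : o <= c.*2.+1%:R.
  by rewrite ler_nat; have := deg x; rewrite eqxx addn0.
have o2 : 2 ^+ n * V0 * B / Q <= 1.
  rewrite ler_pdivrMr // mul1r; apply: le_trans hB.
  rewrite ler_wpM2r ?(ltW B0) // ler_pM ?exprn_ge0 ?ler0n //.
    by rewrite ler_weXn2l ?ler1n.
  by rewrite ler_nat leq_addr.
(* The left side is the sum of the three shares: 1 for new vertices, [2 c + 1] for closing an open
   edge, 1 for defects. *)
have h2 : c.+1.*2%:R + 1 <= 3 * 2 ^+ c :> R.
  have : (c.+1 <= 2 ^ c)%N by exact: ltn_expl.
  rewrite -(ler_nat R) natrX -muln2 natrM => h.
  have : 1 <= 2 ^+ c :> R by rewrite exprn_ege1 // ler1n.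
  lra.
have KG : 0 <= K c * G by rewrite mulr_ge0.
have -> : 3 ^+ n.+1 * 2 ^+ (c * n.+1) *
    (B ^+ excess m * Q ^+ n.+1 / Q ^+ open_edges m) = K c * G * (3 * 2 ^+ c).
  by rewrite -/G /K mulnS exprD [3 ^+ n.+1]exprS; ring.
have -> : K c * G + o * (K c * G) + V0 * (K c.+1 * (G * (B / Q))) =
    K c * G * (1 + o + 2 ^+ n * V0 * B / Q).
  by rewrite hK; ring.
rewrite ler_wpM2l // (le_trans _ h2) //.
move: o1; rewrite doubleS -[c.*2.+2]addn2 -[c.*2.+1]addn1 !natrD; lra.
Qed.

(** The empty walk at each of the [N] starting points: no edge used, no defect, and [V] a
    singleton. *)
Lemma Ex_trace_symx_exp n : 2 ^+ n * n.+1%:R * B <= Q ->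
  Ex (fun w => \tr (symx w ^+ n)) <= N%:R * (3 * Q) ^+ n.
Proof.
move=> hB; rewrite /mxtrace Ex_sum; last by move=> i; exact: bmf_symx_exp.
rewrite -[X in X%:R * _](card_ord N) mulr_natl -sumr_const.
apply: ler_sum => x _; apply: (le_trans (ler_norm _)).
have := @Ex_monomial_symx_exp n (fun=> 0%N) x x 0%N [set x]%SET.
have -> : monomial (fun=> 0%N) = fun=> 1.
  by apply/funext => w; rewrite /monomial big1.
have -> : excess (fun=> 0%N) = 0%N by rewrite /excess big1.
have -> : open_edges (fun=> 0%N) = 0%N by rewrite /open_edges big1.
have -> : (fun w => 1 * (symx w ^+ n) x x) = (fun w => (symx w ^+ n) x x).
  by apply/funext => w; rewrite mul1r.
rewrite mul0n !expr0 mulr1 mul1r divr1 -exprMn; apply.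
- by rewrite inE.
- by [].
- by move=> v; rewrite /open_degree big1.
- by rewrite cards1 add1n.
Qed.

Lemma bmf_trace_symx_exp n : bmf (fun w => \tr (symx w ^+ n)).
Proof. by apply: bmf_sum => i; exact: bmf_symx_exp. Qed.

End TraceMethod.

(** * Second order Taylor bounds for the exponential *)

Section ExpTaylor.
Context {R : realType}.

Lemma derive_ge0_le (f df : R -> R) (a b : R) : a <= b ->
  (forall x : R, is_derive x 1 f (df x)) -> (forall x, a <= x <= b -> 0 <= df x) ->
  f a <= f b.
Proof.
move=> ab df1 df0.
have [c] : exists2 c, c \in `[a, b] & f b - f a = df c * (b - a).
  apply: MVT_segment => //; apply: continuous_subspaceT => x.
  by apply: differentiable_continuous; apply/derivable1_diffP; apply: ex_derive.
by rewrite in_itv /= => /df0 dc E; rewrite -subr_ge0 E mulr_ge0 // subr_ge0.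
Qed.

Let g (c x : R) := (1 + x + x ^+ 2 / 2 + c * x ^+ 3) * expR (- x).
Let dg (c x : R) := ((3 * c - 2^-1) * x ^+ 2 - c * x ^+ 3) * expR (- x).

Let g_derive c (x : R) : is_derive x 1 (g c) (dg c x).
Proof.
pose p : R -> R := cst 1 + id + 2^-1 \*: (id ^+ 2) + c \*: (id ^+ 3).
have -> : g c = p * (expR \o -%R).
  by apply/funext => y; rewrite /g /p /= !fctE /= /GRing.scale /=; ring.
apply: is_derive_eq; rewrite /dg /p /= !fctE /= /GRing.scale /=. by field.
Qed.

(** The ratio [g c] of the cubic to [expR] is 1 at 0. On [[-1, 1]] it increases for [c = 1] and
    decreases for [c = -1]. For [x < 0] the two values of [c] exchange roles, as then
    [|x|^3 = - x^3]. *)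
Lemma expR_taylor2 (x : R) : `|x| <= 1 ->
  1 + x + x ^+ 2 / 2 - `|x| ^+ 3 <= expR x <= 1 + x + x ^+ 2 / 2 + `|x| ^+ 3.
Proof.
have ngd (y : R) : is_derive y 1 (fun z => - g (-1) z) (- dg (-1) y) by exact: is_deriveN.
have ge1 c : (1 <= g c x) = (expR x <= 1 + x + x ^+ 2 / 2 + c * x ^+ 3).
  by rewrite /g expRN ler_pdivlMr ?expR_gt0 // mul1r.
have le1 c : (g c x <= 1) = (1 + x + x ^+ 2 / 2 + c * x ^+ 3 <= expR x).
  by rewrite /g expRN ler_pdivrMr ?expR_gt0 // mul1r.
have g0 c : g c 0 = 1 by rewrite /g oppr0 expR0 !expr0n /=; ring.
have pos y : 0 <= expR (- y) :> R by exact: expR_ge0.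
move=> x1; have [x0|x0] := leP 0 x.
  rewrite ger0_norm // in x1 *.
  rewrite -[X in _ <= _ <= _ + X]mul1r -ge1 -[X in _ - X]mul1r -mulNr -le1.
  apply/andP; split.
    rewrite -[leRHS](g0 (-1)) -lerN2; apply: (derive_ge0_le (f := fun y => - g (-1) y)
      (df := fun y => - dg (-1) y)) => // y /andP[y0 yx].
    rewrite /dg -mulNr mulr_ge0 //.
    have -> : - ((3 * -1 - 2^-1) * y ^+ 2 - -1 * y ^+ 3) = y ^+ 2 * (7 / 2 - y).
      by field.
    by rewrite mulr_ge0 ?sqr_ge0 //; lra.
  rewrite -[leLHS](g0 1).
  apply: (derive_ge0_le (df := dg 1)) => // y /andP[y0 yx].
  rewrite /dg mulr_ge0 //.
  have -> : (3 * 1 - 2^-1) * y ^+ 2 - 1 * y ^+ 3 = y ^+ 2 * (5 / 2 - y) by field.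
  by rewrite mulr_ge0 ?sqr_ge0 //; lra.
have x0' := ltW x0; rewrite ler0_norm // in x1 *.
have -> : (- x) ^+ 3 = -1 * x ^+ 3 by ring.
rewrite -ge1 (_ : - (-1 * x ^+ 3) = 1 * x ^+ 3); last by ring.
rewrite -le1; apply/andP; split.
  rewrite -[leRHS](g0 1); apply: (derive_ge0_le (df := dg 1)) => // y /andP[y0 yx].
  rewrite /dg mulr_ge0 //.
  have -> : (3 * 1 - 2^-1) * y ^+ 2 - 1 * y ^+ 3 = y ^+ 2 * (5 / 2 - y) by field.
  by rewrite mulr_ge0 ?sqr_ge0 //; lra.
rewrite -[leLHS](g0 (-1)) -lerN2; apply: (derive_ge0_le (f := fun y => - g (-1) y)
  (df := fun y => - dg (-1) y)) => // y /andP[y0 yx].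
rewrite /dg -mulNr mulr_ge0 //.
have -> : - ((3 * -1 - 2^-1) * y ^+ 2 - -1 * y ^+ 3) = y ^+ 2 * (7 / 2 - y).
  by field.
by rewrite mulr_ge0 ?sqr_ge0 //; lra.
Qed.

End ExpTaylor.

(** * Exponential moments and tail bounds in both directions *)

Section MomentGenerating.
Context {R : realType} {d} {T : measurableType d} (P : probability T R).
Local Notation Ex := (Ex P).
Local Notation pr := (pr P).

(** Taylor's bound gives [1 + l^2 v / 2 * (1 +- 2 xi)]. Passing to exponentials is free above;
    below, the change from 2 to 4 pays for it. *)
Lemma mgf_bounds (f : T -> R) (B l : R) : bmf f -> (forall w, `|f w| <= B) ->
  Ex f = 0 -> `|l| * B <= 4^-1 ->
  expR (l ^+ 2 * Ex (fun w => f w ^+ 2) / 2 * (1 - 4 * (`|l| * B))) <=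
  Ex (fun w => expR (l * f w)) <=
  expR (l ^+ 2 * Ex (fun w => f w ^+ 2) / 2 * (1 + 4 * (`|l| * B))).
Proof.
move=> bf fB f0 lB; set v := Ex _; set xi : R := `|l| * B in lB *.
(* A probability space is nonempty, which is needed to read off [0 <= B] from [fB]. *)
have [w0|T0] := pselect (exists w : T, True); last first.
  have e : pr setT = 0.
    rewrite (_ : setT = set0) ?pr_set0 //; apply/seteqP; split => // w _.
    by apply: T0; exists w.
  by move: (pr_setT P); rewrite e => /eqP; rewrite eq_sym oner_eq0.
have B0 : 0 <= B by case: w0 => w _; exact: le_trans (normr_ge0 _) (fB w).
have bi := @bmf_integrable _ _ _ P.
have b2 : bmf (fun w => f w ^+ 2) by exact: bmfX.
have v0 : 0 <= v by apply: Ex_ge0 => w; exact: sqr_ge0.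
have quad (c : R) : Ex (fun w => 1 + (l * f w + c * f w ^+ 2)) = 1 + c * v.
  have b1 := @bmf_cst R _ T 1; have b3 := bmfZ l bf; have b4 := bmfZ c b2.
  rewrite (ExD (bi _ b1) (bi _ (bmfD b3 b4))) (ExD (bi _ b3) (bi _ b4)) Ex_cst.
  by rewrite (ExZ l (bi _ bf)) (ExZ c (bi _ b2)) f0 mulr0 add0r.
have bq (c : R) : bmf (fun w => 1 + (l * f w + c * f w ^+ 2)).
  by apply: bmfD; [exact: bmf_cst|apply: bmfD; exact: bmfZ].
have be : bmf (fun w => expR (l * f w)) by apply/bmf_expR/bmfZ.
have pt w : `|l * f w| ^+ 3 <= xi * l ^+ 2 * f w ^+ 2.
  rewrite exprSr -normrX ger0_norm ?sqr_ge0 // exprMn normrM mulrC.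
  by rewrite mulrA ler_wpM2r ?sqr_ge0 // ler_wpM2r ?sqr_ge0 // ler_wpM2l.
have lfw w : `|l * f w| <= 1.
  rewrite normrM (@le_trans _ _ xi) ?ler_wpM2l //; lra.
have up : Ex (fun w => expR (l * f w)) <= 1 + (l ^+ 2 / 2 + xi * l ^+ 2) * v.
  rewrite -quad; apply: Ex_le; [exact: bi|exact: bi|] => w.
  have /andP[_ h] := expR_taylor2 (lfw w); apply: (le_trans h).
  by have := pt w; rewrite exprMn; lra.
have lo : 1 + (l ^+ 2 / 2 - xi * l ^+ 2) * v <= Ex (fun w => expR (l * f w)).
  rewrite -quad; apply: Ex_le; [exact: bi|exact: bi|] => w.
  have /andP[h _] := expR_taylor2 (lfw w); apply: (le_trans _ h).
  by have := pt w; rewrite exprMn; lra.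
have l2v0 : 0 <= l ^+ 2 * v by rewrite mulr_ge0 ?sqr_ge0.
have xi0 : 0 <= xi by rewrite mulr_ge0 ?B0.
have vB : v <= B ^+ 2.
  rewrite -(Ex_cst P (B ^+ 2)); apply: Ex_le; [exact: bi|exact/bi/bmf_cst|] => w.
  by rewrite -(real_normK (num_real (f w))) ler_sqr ?nnegrE ?B0.
have l2v : l ^+ 2 * v <= xi ^+ 2.
  by rewrite /xi exprMn (real_normK (num_real l)) ler_wpM2l ?sqr_ge0.
have xi2 : xi ^+ 2 <= xi by rewrite expr2 ler_piMl //; lra.
apply/andP; split; last first.
  apply: (le_trans up); apply: le_trans (expR_ge1Dx _).
  have : 0 <= l ^+ 2 * v * xi by rewrite mulr_ge0.
  lra.
apply: le_trans lo.
set u' := _ * (1 - 4 * xi).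
have u'1 : u' < 1.
  apply: (@le_lt_trans _ _ (l ^+ 2 * v / 2)); last by lra.
  by rewrite /u' ler_piMr; lra.
have -> : expR u' = (expR (- u'))^-1 by rewrite expRN invrK.
rewrite -[leLHS]div1r ler_pdivrMr ?expR_gt0 //.
have u0 : 0 <= (l ^+ 2 / 2 - xi * l ^+ 2) * v.
  have -> : (l ^+ 2 / 2 - xi * l ^+ 2) * v = l ^+ 2 * v / 2 * (1 - 2 * xi) by field.
  by rewrite mulr_ge0; lra.
(* With [u] the Taylor term, [(1 + u) (1 - u') >= 1] is needed. The difference [u - u'] is
   [l^2 v xi], and it dominates [u u'] because [l^2 v <= xi^2 <= xi]. *)
apply: (@le_trans _ _ ((1 + (l ^+ 2 / 2 - xi * l ^+ 2) * v) * (1 - u'))); last first.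
  by rewrite ler_wpM2l ?addr_ge0 // expR_ge1Dx.
have -> : (1 + (l ^+ 2 / 2 - xi * l ^+ 2) * v) * (1 - u') =
  1 + l ^+ 2 * v * (xi - l ^+ 2 * v / 4 * ((1 - 2 * xi) * (1 - 4 * xi))).
  by rewrite /u'; field.
rewrite lerDl mulr_ge0 // subr_ge0.
apply: (@le_trans _ _ (l ^+ 2 * v / 4 * 1)); last by lra.
rewrite ler_wpM2l //; first by lra.
by rewrite mulr_ile1; lra.
Qed.

Lemma mgf_sum_bounds (I : eqType) (D : set I) (Y : I -> T -> R) (B l : R)
  (s : seq I) (V := \sum_(e <- s) Ex (fun w => Y e w ^+ 2)) :
  mutually_independent P D Y -> (forall e, measurable_fun setT (Y e)) ->
  (forall e w, `|Y e w| <= B) -> (forall e, D e -> Ex (Y e) = 0) ->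
  `|l| * B <= 4^-1 -> uniq s -> (forall e, e \in s -> D e) ->
  expR (l ^+ 2 * V / 2 * (1 - 4 * (`|l| * B))) <=
  Ex (fun w => expR (l * \sum_(e <- s) Y e w)) <=
  expR (l ^+ 2 * V / 2 * (1 + 4 * (`|l| * B))).
Proof.
move=> ind mY YB EY lB us sD.
have bY e : bmf (Y e) by split => //; exists B.
pose q := [seq (fun w => expR (l * Y e w)) | e <- s].
have -> : (fun w => expR (l * \sum_(e <- s) Y e w)) = (fun w => \prod_(f <- q) f w).
  by apply/funext => w; rewrite big_map mulr_sumr expR_sum.
rewrite Ex_prod_indepl; first last.
- apply: (mutually_independent_indepl (f := fun e x => expR (l * x)) ind) => //.
  by move=> e; apply: measurableT_comp => //; exact: mulrl_measurable.
- rewrite /q => f; elim: (s) => //= e s' IH [<-|//].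
  exact/bmf_expR/bmfZ.
have sumE (c : R) : l ^+ 2 * V / 2 * c =
    \sum_(e <- s) l ^+ 2 * Ex (fun w => Y e w ^+ 2) / 2 * c.
  by rewrite /V mulr_sumr !mulr_suml.
rewrite big_map !sumE !expR_sum.
have key e : e \in s -> _ := fun es => mgf_bounds (bY e) (YB e) (EY e (sD e es)) lB.
by apply/andP; split; rewrite big_seq [leRHS]big_seq; apply: ler_prod => e /key
  /andP[h1 h2]; rewrite ?h1 ?h2 ?expR_ge0 // Ex_ge0 // => w; exact: expR_ge0.
Qed.

Lemma chernoff_bound (S : T -> R) (l t : R) : bmf S -> 0 <= l ->
  pr [set w | t <= S w] <= expR (- (l * t)) * Ex (fun w => expR (l * S w)).
Proof.
move=> bS l0; have [mS _] := bS; have mA := measurable_ge t mS.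
have bi := @bmf_integrable _ _ _ P.
have be : bmf (fun w => expR (l * S w)) by apply/bmf_expR/bmfZ.
rewrite -Ex_indic // -(ExZ _ (bi _ be)); apply: Ex_le.
- exact/bi/bmf_indic.
- exact/bi/bmfZ.
move=> w; rewrite indicE; case: (boolP (w \in _)) => [|_] /=; last first.
  by rewrite mulr_ge0 ?expR_ge0.
rewrite inE /= => h; rewrite -expRD -[leLHS](@expR0 R) ler_expR addrC subr_ge0.
by rewrite ler_wpM2l.
Qed.

(* Under the measure tilted by [expR (l * S)] the variable [S] concentrates in the window [[t, t']]; outside of it, compare with slightly smaller or larger tilts. *)
Lemma tilted_window (S : T -> R) (l u t t' : R) : bmf S -> 0 <= l -> 0 <= u ->
  Ex (fun w => expR (l * S w)) <=
    expR (u * t) * Ex (fun w => expR ((l - u) * S w)) +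
    expR (- (u * t')) * Ex (fun w => expR ((l + u) * S w)) +
    expR (l * t') * pr [set w | t <= S w].
Proof.
move=> bS l0 u0; have [mS _] := bS; have mA := measurable_ge t mS.
have bi := @bmf_integrable _ _ _ P.
have be c : bmf (fun w => expR (c * S w)) by apply/bmf_expR/bmfZ.
have bA := bmf_indic (R := R) mA.
have b1 := bmfZ (expR (u * t)) (be (l - u)).
have b2 := bmfZ (expR (- (u * t'))) (be (l + u)).
have b3 := bmfZ (expR (l * t')) bA.
rewrite -Ex_indic // -(ExZ _ (bi _ (be (l - u)))) -(ExZ _ (bi _ (be (l + u)))).
rewrite -(ExZ _ (bi _ bA)) -(ExD (bi _ b1) (bi _ b2)).
rewrite -(ExD (bi _ (bmfD b1 b2)) (bi _ b3)).
apply: Ex_le; [exact: bi|by apply/bi/bmfD => //; exact: bmfD|] => w.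
rewrite -!expRD; have e1 := expR_ge0 (u * t + (l - u) * S w).
have e2 := expR_ge0 (- (u * t') + (l + u) * S w).
have e3 : 0 <= expR (l * t') * (\1_[set w | t <= S w] : T -> R) w.
  by rewrite mulr_ge0 ?expR_ge0 // indicE ler0n.
have [tS|St] := leP t (S w); last first.
  apply: (@le_trans _ _ (expR (u * t + (l - u) * S w))); last by lra.
  rewrite ler_expR; have : 0 <= u * (t - S w) by rewrite mulr_ge0 //; lra.
  lra.
have [tS'|St'] := leP t' (S w).
  apply: (@le_trans _ _ (expR (- (u * t') + (l + u) * S w))); last by lra.
  rewrite ler_expR; have : 0 <= u * (S w - t') by rewrite mulr_ge0 //; lra.
  lra.
apply: (@le_trans _ _ (expR (l * t') * (\1_[set w | t <= S w] : T -> R) w)); last by lra.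
rewrite indicE mem_set //= mulr1 ler_expR ler_wpM2l // ltW //.
Qed.

(* Cramer's lower bound: [L] plays the role of [log N], and [tau s] is the threshold. *)
Lemma tail_lower (S : T -> R) (L ell s v tau h gam : R) : bmf S ->
  0 < L -> 0 < ell -> ell * s = L -> 0 < v -> 0 <= tau -> 0 < h ->
  gam <= h ^+ 2 / (8 * v) -> 0 <= gam ->
  expR (- (h ^+ 2 / (4 * v) * L)) <= 4^-1 ->
  (forall c, `|c| <= (tau + 2 * h) / v ->
    expR ((c ^+ 2 * v / 2 - gam) * L) <= Ex (fun w => expR (c * ell * S w)) <=
    expR ((c ^+ 2 * v / 2 + gam) * L)) ->
  2^-1 * expR (- (((tau + h) * (tau + 3 * h) / (2 * v) + gam) * L)) <=
  pr [set w | tau * s <= S w].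
Proof.
move=> bS L0 ell0 els v0 tau0 h0 gamh gam0 small H.
(* For Gaussian moments with variance parameter [v], the tilt [a * ell] centres the sum at
   [(tau + h) * s], the midpoint of the window; changing [a] by [u] moves the centre to an end of
   it. *)
pose a := (tau + h) / v; pose u := h / v; pose tau' := tau + 2 * h.
have vn0 : v != 0 by rewrite gt_eqF.
have a0 : 0 <= a by rewrite divr_ge0; lra.
have u0 : 0 <= u by rewrite divr_ge0; lra.
have Ha : `|a| <= (tau + 2 * h) / v.
  by rewrite ger0_norm // ler_wpM2r ?invr_ge0; lra.
have Hd : `|a - u| <= (tau + 2 * h) / v.
  have -> : a - u = tau / v by rewrite /a /u; field.
  by rewrite ger0_norm ?divr_ge0 ?ler_wpM2r ?invr_ge0; lra.
have Hp : `|a + u| <= (tau + 2 * h) / v.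
  have -> : a + u = (tau + 2 * h) / v by rewrite /a /u; field.
  by rewrite ger0_norm ?divr_ge0; lra.
have /andP[h1 _] := H _ Ha; have /andP[_ h2] := H _ Hd; have /andP[_ h3] := H _ Hp.
have := @tilted_window S (a * ell) (u * ell) (tau * s) (tau' * s) bS
  (mulr_ge0 a0 (ltW ell0)) (mulr_ge0 u0 (ltW ell0)).
have e1 c c' : c * ell * (c' * s) = c * c' * L by rewrite -els; ring.
rewrite -mulrBl -mulrDl !e1 => W.
set p := pr _ in W *.
pose G := expR ((a ^+ 2 * v / 2 - gam) * L).
have G0 : 0 < G by exact: expR_gt0.
(* Outside the window the exponent falls by [h^2 / (2 v)]: half of this absorbs the errors [gam],
   the other half makes each tail at most a quarter of [G]. *)
have gap x : x <= a ^+ 2 * v / 2 - gam - h ^+ 2 / (4 * v) -> expR (x * L) <= 4^-1 * G.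
  move=> hx; apply: (@le_trans _ _ (expR (- (h ^+ 2 / (4 * v) * L)) * G)).
    rewrite -expRD ler_expR -mulNr -mulrDl ler_wpM2r ?(ltW L0) //; lra.
  by rewrite ler_wpM2r ?(ltW G0).
have h4 : h ^+ 2 / (4 * v) = 2 * (h ^+ 2 / (8 * v)) by field.
have h2v : h ^+ 2 / (2 * v) = 4 * (h ^+ 2 / (8 * v)) by field.
have W1 : expR (u * tau * L) * Ex (fun w => expR ((a - u) * ell * S w)) <= 4^-1 * G.
  apply: (@le_trans _ _ (expR (u * tau * L) * expR (((a - u) ^+ 2 * v / 2 + gam) * L))).
    by rewrite ler_wpM2l ?expR_ge0.
  rewrite -expRD -mulrDl gap //.
  have -> : u * tau + ((a - u) ^+ 2 * v / 2 + gam) =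
     a ^+ 2 * v / 2 + gam - h ^+ 2 / (2 * v) by rewrite /a /u; field.
  lra.
have W2 : expR (- (u * tau' * L)) * Ex (fun w => expR ((a + u) * ell * S w)) <= 4^-1 * G.
  apply: (@le_trans _ _ (expR (- (u * tau' * L)) * expR (((a + u) ^+ 2 * v / 2 + gam) * L))).
    by rewrite ler_wpM2l ?expR_ge0.
  rewrite -expRD -mulNr -mulrDl gap //.
  have -> : - (u * tau') + ((a + u) ^+ 2 * v / 2 + gam) =
     a ^+ 2 * v / 2 + gam - h ^+ 2 / (2 * v) by rewrite /a /u /tau'; field.
  lra.
have W3 : 2^-1 * G <= expR (a * tau' * L) * p by move: h1; rewrite -/G; lra.
have -> : expR (- (((tau + h) * (tau + 3 * h) / (2 * v) + gam) * L)) =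
   expR (- (a * tau' * L)) * G.
  by rewrite -expRD; congr expR; rewrite /a /tau'; field.
rewrite mulrCA expRN ler_pdivrMl ?expR_gt0 //.
Qed.

End MomentGenerating.

(** * Truncation and recentring of one variable with six moments *)

Section Truncation.
Context {R : realType}.

Definition cutoff (b y : R) : R := if `|y| <= b then y else 0.

Lemma cutoff_norm b y : 0 <= b -> `|cutoff b y| <= b.
Proof. by rewrite /cutoff; case: ifP => // _ b0; rewrite normr0. Qed.

Lemma measurable_cutoff b : measurable_fun setT (cutoff b).
Proof.
apply: measurable_fun_if => //.
- apply: measurable_fun_ler; last exact: measurable_cst.
  exact: normr_measurable.
Qed.

(** The difference is nonzero only where [|y| > b], and there the factor [(|y| / b)^5] exceeds 1. *)
Lemma norm_sub_cutoff b y : 0 < b -> `|y - cutoff b y| <= y ^+ 6 / b ^+ 5.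
Proof.
move=> b0; rewrite /cutoff; have e6 : 0 <= y ^+ 6 by rewrite (exprM y 2 3) exprn_ge0 ?sqr_ge0.
case: ifPn => [_|]; first by rewrite subrr normr0 divr_ge0 // exprn_ge0 // ltW.
rewrite -ltNge subr0 => by_; rewrite ler_pdivlMr ?exprn_gt0 //.
have -> : y ^+ 6 = `|y| * `|y| ^+ 5.
  by rewrite -exprS -normrX ger0_norm.
by rewrite ler_wpM2l // lerXn2r // ?nnegrE ?(ltW b0) // ltW.
Qed.

Lemma sqr_sub_cutoff b y : 0 < b ->
  y ^+ 2 - cutoff b y ^+ 2 <= y ^+ 6 / b ^+ 4.
Proof.
move=> b0; rewrite /cutoff; have e6 : 0 <= y ^+ 6 by rewrite (exprM y 2 3) exprn_ge0 ?sqr_ge0.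
case: ifPn => [_|]; first by rewrite subrr divr_ge0 // exprn_ge0 // ltW.
rewrite -ltNge expr0n subr0 => by_; rewrite ler_pdivlMr ?exprn_gt0 //.
have -> : y ^+ 6 = y ^+ 2 * `|y| ^+ 4.
  by rewrite -(real_normK (num_real y)) -exprD -normrX ger0_norm.
by rewrite ler_wpM2l ?sqr_ge0 // lerXn2r // ?nnegrE ?(ltW b0) // ltW.
Qed.

Lemma sqr_cutoff_le b y : cutoff b y ^+ 2 <= y ^+ 2.
Proof. by rewrite /cutoff; case: ifP => // _; rewrite expr0n sqr_ge0. Qed.

Context {d} {T : measurableType d} (P : probability T R).
Local Notation Ex := (Ex P).
Local Notation pr := (pr P).
Local Notation intg f := (P.-integrable setT (EFin \o f)).

Lemma integrable_dominated (f g : T -> R) : measurable_fun setT f -> intg g ->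
  (forall w, `|f w| <= g w) -> intg f.
Proof.
move=> mf ig fg; apply: (le_integrable _ _ _ ig) => //.
  exact/measurable_EFinP.
by move=> w _ /=; rewrite lee_fin (le_trans (fg w)) // ler_norm.
Qed.

Section OneVariable.
Variables (x : T -> R) (K b : R).
Hypothesis mx : measurable_fun setT x.
Hypothesis i6 : intg (fun w => x w ^+ 6).
Hypothesis K6 : Ex (fun w => x w ^+ 6) <= K.
Hypothesis Ex0 : Ex x = 0.
Hypothesis b1 : 1 <= b.
Let b0 : 0 < b. Proof. exact: lt_le_trans b1. Qed.

Definition trmean := Ex (fun w => cutoff b (x w)).
Definition trcent w := cutoff b (x w) - trmean.

Let x6 w : 0 <= x w ^+ 6.
Proof. by rewrite (exprM _ 2 3) exprn_ge0 ?sqr_ge0. Qed.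

Let i6c c : intg (fun w => c * x w ^+ 6).
Proof.
have := integrableZl measurableT c i6.
by apply: eq_integrable => // w _ /=; rewrite EFinM.
Qed.

Let i61 : intg (fun w => 1 + x w ^+ 6).
Proof.
have := @integrableD _ T R P setT measurableT _ _ (bmf_integrable P (bmf_cst 1)) i6.
by apply: eq_integrable.
Qed.

Lemma integrable_sqr : intg (fun w => x w ^+ 2).
Proof.
apply: (integrable_dominated _ i61).
  exact: measurable_funX.
move=> w; rewrite ger0_norm ?sqr_ge0 //.
have -> : x w ^+ 6 = (x w ^+ 2) ^+ 3 by rewrite -exprM.
move: (x w ^+ 2) (sqr_ge0 (x w)) => z z0.
have [z1|/ltW z1] := leP z 1; first by rewrite ler_wpDr ?exprn_ge0.
by rewrite ler_wpDl // exprS ler_peMr // exprn_ege1.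
Qed.

Lemma integrable_id : intg x.
Proof.
apply: (integrable_dominated mx i61) => w.
have -> : x w ^+ 6 = `|x w| ^+ 6 by rewrite -normrX ger0_norm.
move: `|x w| (normr_ge0 (x w)) => z z0.
have [z1|/ltW z1] := leP z 1; first by rewrite ler_wpDr ?exprn_ge0.
by rewrite ler_wpDl // exprS ler_peMr // exprn_ege1.
Qed.

Lemma bmf_cutoff : bmf (fun w => cutoff b (x w)).
Proof.
split; first by apply: measurableT_comp => //; exact: measurable_cutoff.
by exists b => w; exact/cutoff_norm/ltW.
Qed.

(** As [x] is centred, the mean of the truncated part is minus the mean of the removed part. *)
Lemma trmean_bound : `|trmean| <= K / b ^+ 5.
Proof.
have it := bmf_integrable P bmf_cutoff.
have E : trmean = - Ex (fun w => x w + (-1) * cutoff b (x w)).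
  rewrite (ExD integrable_id (bmf_integrable P (bmfZ (-1) bmf_cutoff))).
  by rewrite Ex0 (ExZ _ it) add0r mulN1r opprK.
have i1 : intg (fun w => x w + (-1) * cutoff b (x w)).
  have := @integrableD _ T R P setT measurableT _ _ integrable_id
    (bmf_integrable P (bmfZ (-1) bmf_cutoff)).
  by apply: eq_integrable.
have m1 : measurable_fun setT (fun w => x w + (-1) * cutoff b (x w)).
  by apply: measurable_funD => //; case: (bmfZ (-1) bmf_cutoff).
rewrite E normrN.
apply: (le_trans (le_normr_Rintegral _ i1)) => //.
apply: (@le_trans _ _ (Ex (fun w => (b ^+ 5)^-1 * x w ^+ 6))).
  apply: Ex_le => //.
    apply: (integrable_dominated _ (i6c (b ^+ 5)^-1)).
      exact: measurableT_comp.
    by move=> w; rewrite normr_id mulN1r mulrC norm_sub_cutoff.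
  by move=> w; rewrite mulN1r mulrC norm_sub_cutoff.
by rewrite ExZ // mulrC ler_wpM2r // invr_ge0 exprn_ge0 // ltW.
Qed.

Lemma trcent_bmf : bmf trcent.
Proof. by apply: bmfB; [exact: bmf_cutoff|exact: bmf_cst]. Qed.

Lemma trcent_norm w : `|trcent w| <= 2 * b.
Proof.
have mb : `|trmean| <= b.
  apply: (le_trans (Ex_norm_le P bmf_cutoff)); rewrite -[leRHS](Ex_cst P).
  apply: Ex_le => [||v]; [|exact/bmf_integrable/bmf_cst|exact/cutoff_norm/ltW].
  exact/bmf_integrable/bmf_norm/bmf_cutoff.
have tb : `|cutoff b (x w)| <= b by exact/cutoff_norm/ltW.
by rewrite (le_trans (ler_normB _ _)) //; lra.
Qed.

Lemma Ex_trcent : Ex trcent = 0.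
Proof.
rewrite ExD; [|exact/bmf_integrable/bmf_cutoff|exact/bmf_integrable/bmf_cst].
by rewrite Ex_cst subrr.
Qed.

Lemma Ex_trcent_sqr : Ex (fun w => trcent w ^+ 2) =
  Ex (fun w => cutoff b (x w) ^+ 2) - trmean ^+ 2.
Proof.
have bi := @bmf_integrable _ _ _ P.
have h1 := bmfX 2 bmf_cutoff; have h2 := bmfZ (-2 * trmean) bmf_cutoff.
have h3 : bmf (fun _ : T => trmean ^+ 2) by exact: bmf_cst.
rewrite (_ : (fun w => trcent w ^+ 2) = (fun w => cutoff b (x w) ^+ 2 +
  (-2 * trmean * cutoff b (x w) + trmean ^+ 2))); last first.
  by apply/funext => w; rewrite /trcent; ring.
rewrite (ExD (bi _ h1) (bi _ (bmfD h2 h3))) (ExD (bi _ h2) (bi _ h3)).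
rewrite (ExZ _ (bi _ bmf_cutoff)) Ex_cst -/trmean; ring.
Qed.

Lemma Ex_trcent_sqr_le : Ex (fun w => trcent w ^+ 2) <= Ex (fun w => x w ^+ 2).
Proof.
rewrite Ex_trcent_sqr; apply: (@le_trans _ _ (Ex (fun w => cutoff b (x w) ^+ 2))).
  by rewrite gerBl sqr_ge0.
apply: Ex_le; [exact/bmf_integrable/bmfX/bmf_cutoff|exact: integrable_sqr|].
by move=> w; exact: sqr_cutoff_le.
Qed.

Lemma Ex_trcent_sqr_ge :
  Ex (fun w => x w ^+ 2) - K / b ^+ 4 - (K / b ^+ 5) ^+ 2 <=
  Ex (fun w => trcent w ^+ 2).
Proof.
rewrite Ex_trcent_sqr; apply: lerB; last first.
  rewrite -(real_normK (num_real trmean)) lerXn2r ?nnegrE ?trmean_bound //.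
  exact: le_trans trmean_bound.
rewrite lerBlDl.
apply: (@le_trans _ _ (Ex (fun w => (b ^+ 4)^-1 * x w ^+ 6 + cutoff b (x w) ^+ 2))).
  apply: Ex_le; [exact: integrable_sqr| |].
    have := @integrableD _ T R P setT measurableT _ _ (i6c (b ^+ 4)^-1)
      (bmf_integrable P (bmfX 2 bmf_cutoff)).
    by apply: eq_integrable.
  by move=> w; have := sqr_sub_cutoff (x w) b0; rewrite [_ / _]mulrC; lra.
rewrite (ExD (i6c _) (bmf_integrable P (bmfX 2 bmf_cutoff))).
rewrite ExZ // lerD2r mulrC ler_wpM2r // invr_ge0 exprn_ge0 // ltW //.
Qed.

Lemma pr_cutoff_neq : pr [set w | ~ `|x w| <= b] <= K / b ^+ 6.
Proof.
have mA : measurable [set w | ~ `|x w| <= b].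
  rewrite (_ : [set w | _] = ~` [set w | `|x w| <= b]) //.
  apply: measurableC.
  rewrite (_ : [set w | _] = ~` [set w | b < `|x w|]).
    apply: measurableC.
    rewrite (_ : [set w | _] = [set w | - `|x w| < - b]).
      apply: measurable_lt; apply: measurableT_comp => //.
      exact: measurableT_comp.
    by apply/seteqP; split => w /=; rewrite ltrN2.
  by apply/seteqP; split => w /=; [rewrite leNgt => /negP|move/negP; rewrite -leNgt].
have mB : measurable [set w | b ^+ 6 <= x w ^+ 6].
  by apply: measurable_ge; exact: measurable_funX.
rewrite ler_pdivlMr ?exprn_gt0 // mulrC.
apply: (le_trans _ (le_trans (pr_markov i6 x6 mB) K6)).
rewrite ler_wpM2l ?exprn_ge0 ?(ltW b0) //; apply: le_pr => // w /= /negP.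
rewrite -ltNge => bx.
have -> : x w ^+ 6 = `|x w| ^+ 6 by rewrite -normrX ger0_norm.
by rewrite lerXn2r ?nnegrE ?(ltW b0) ?(ltW bx).
Qed.

End OneVariable.

(** Pointwise, [z^6 <= 1 + z^(6 + delta)] for [z >= 0]: compare separately for [z <= 1] and
    [z > 1]. *)
Lemma sixth_moment (X : {RV P >-> R}) (delta K : R) : 0 < delta ->
  ('E_P[fun w => (`|X w| `^ (6 + delta))%R] <= K%:E)%E ->
  intg (fun w => X w ^+ 6) /\ Ex (fun w => X w ^+ 6) <= 1 + K.
Proof.
move=> d0 hE.
have mX6 : measurable_fun setT (fun w => X w ^+ 6) by exact: measurable_funX.
have x6 w : 0 <= X w ^+ 6 by rewrite (exprM _ 2 3) exprn_ge0 ?sqr_ge0.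
have mp : measurable_fun setT (fun w => `|X w| `^ (6 + delta)).
  by apply: (measurableT_comp (measurable_powR _)); exact: measurableT_comp.
have pt w : X w ^+ 6 <= 1 + `|X w| `^ (6 + delta).
  have -> : X w ^+ 6 = `|X w| ^+ 6 by rewrite -normrX ger0_norm.
  have [x1|x1] := leP `|X w| 1.
    by rewrite ler_wpDr ?powR_ge0 // exprn_ile1.
  rewrite ler_wpDl // -powR_mulrn // ler_powR ?(ltW x1) //.
  by rewrite lerDl ltW.
have Ib : (\int[P]_w (X w ^+ 6)%:E <= (1 + K)%:E)%E.
  apply: (@le_trans _ _ (\int[P]_w (1%:E + (`|X w| `^ (6 + delta))%:E))%E).
    apply: ge0_le_integral => //.
    - by move=> w _; rewrite lee_fin.
    - exact/measurable_EFinP.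
    - by apply: emeasurable_funD; apply/measurable_EFinP => //; exact: measurable_cst.
    - by move=> w _; rewrite -EFinD lee_fin.
  rewrite ge0_integralD //; last exact/measurable_EFinP.
  rewrite (_ : (\int[P]__ 1)%E = 1%:E); last first.
    by rewrite integral_cst // mul1e; exact: probability_setT.
  rewrite EFinD leeD2l //.
  by move: hE; rewrite unlock.
have i6 : intg (fun w => X w ^+ 6).
  apply/integrableP; split; first exact/measurable_EFinP.
  rewrite (eq_integral (fun w => (X w ^+ 6)%:E)); last first.
    by move=> w _ /=; rewrite ger0_norm.
  by apply: (le_lt_trans Ib); rewrite ltry.
split => //; rewrite -lee_fin; apply: le_trans Ib.
by rewrite /Ex /Rintegral fineK //; exact: integrable_fin_num.
Qed.

Lemma variance_centered (X : {RV P >-> R}) : ('E_P[X] = 0)%E ->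
  fine ('V_P[X])%E = Ex (fun w => X w ^+ 2).
Proof.
move=> E0; rewrite /variance unlock E0 /= unlock /Ex /Rintegral.
congr fine; apply: eq_integral => w _ /=.
by rewrite !fctE /= subr0 expr2.
Qed.

Lemma Ex_expectation (X : {RV P >-> R}) : ('E_P[X] = 0)%E -> Ex X = 0.
Proof. by rewrite unlock => h; rewrite /Ex /Rintegral h. Qed.

End Truncation.

Lemma mutually_independent_comp {R : realType} {d} {T : measurableType d}
  (P : probability T R) (I : eqType) (D : set I) (X : I -> T -> R)
  (f : I -> R -> R) : (forall i, measurable_fun setT (f i)) ->
  mutually_independent P D X ->
  mutually_independent P D (fun i w => f i (X i w)).
Proof.
move=> mf H s B us sD mB; apply: (H s (fun i => f i @^-1` B i)) => // i is_.
by rewrite -[_ @^-1` _]setTI; apply: mf => //; exact: mB.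
Qed.

(** * Row sums and the Laplacian for a fixed matrix size *)

Section FixedSize.
Context {R : realType} {d} {T : measurableType d} (P : probability T R).
Local Notation Ex := (Ex P).
Local Notation pr := (pr P).
Local Notation intg f := (P.-integrable setT (EFin \o f)).
Variables (N : nat) (x : 'I_N * 'I_N -> T -> R) (K b : R).
Hypothesis indx : mutually_independent P [set e | upper e] x.
Hypothesis mx : forall e, measurable_fun setT (x e).
Hypothesis i6 : forall e, upper e -> intg (fun w => x e w ^+ 6).
Hypothesis K6 : forall e, upper e -> Ex (fun w => x e w ^+ 6) <= K.
Hypothesis Ex0 : forall e, upper e -> Ex (x e) = 0.
Hypothesis Ex2 : forall e, upper e -> Ex (fun w => x e w ^+ 2) <= 1.
Hypothesis b1 : 1 <= b.

Definition Y (e : 'I_N * 'I_N) : T -> R := trcent P (x e) b.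
(** [J] selects columns: all of them for the upper bound, [m <= k] and [k < m] for the lower one.
    With [predT] the diagonal entry is included, matching [A - diag(S)]. *)
Definition rowsum (J : pred 'I_N) (i : 'I_N) w := \sum_(k | J k) Y (edge i k) w.
Definition rowvar (J : pred 'I_N) (i : 'I_N) :=
  \sum_(k | J k) Ex (fun w => Y (edge i k) w ^+ 2).
Definition laplacian w : 'M[R]_N := \matrix_(i, j)
  (if i == j then - \sum_(k < N | k != i) x (edge i k) w else x (edge i j) w).

Let indY : mutually_independent P [set e | upper e] Y.
Proof.
have mf e : measurable_fun setT (fun y => cutoff b y - trmean P (x e) b).
  by apply: measurable_funB; [exact: measurable_cutoff|exact: measurable_cst].
exact: (mutually_independent_comp mf indx).
Qed.

Let bY e : bmf (Y e). Proof. exact: trcent_bmf. Qed.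

Let mY e : measurable_fun setT (Y e). Proof. by case: (bY e). Qed.

Let YB e w : `|Y e w| <= 2 * b. Proof. exact: trcent_norm. Qed.

Let EY e : upper e -> Ex (Y e) = 0. Proof. by move=> he; exact: Ex_trcent. Qed.

Let EY2 e : upper e -> Ex (fun w => Y e w ^+ 2) <= 1.
Proof.
move=> he; apply: le_trans (Ex2 he); apply: Ex_trcent_sqr_le => //.
exact: i6.
Qed.

Let twob : 1 <= 2 * b. Proof. by move: b1; lra. Qed.

Lemma edge_inj (i : 'I_N) : injective (edge i).
Proof.
move=> j k /eqP; rewrite eq_edge => /orP[/andP[_ /eqP]//|/andP[/eqP -> /eqP ->]//].
Qed.

Lemma bmf_rowsum J i : bmf (rowsum J i).
Proof. by apply: bmf_sum => k; exact: bY. Qed.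

Lemma mgf_rowsum J i l : `|l| * (2 * b) <= 4^-1 ->
  expR (l ^+ 2 * rowvar J i / 2 * (1 - 4 * (`|l| * (2 * b)))) <=
  Ex (fun w => expR (l * rowsum J i w)) <=
  expR (l ^+ 2 * rowvar J i / 2 * (1 + 4 * (`|l| * (2 * b)))).
Proof.
move=> lb; pose s := [seq edge i k | k <- index_enum 'I_N & J k].
have us : uniq s.
  by rewrite map_inj_uniq; [rewrite filter_uniq // index_enum_uniq|exact: edge_inj].
have sD e : e \in s -> [set e | upper e] e.
  by move=> /mapP[k _ ->]; exact: edge_upper.
have -> : rowvar J i = \sum_(e <- s) Ex (fun w => Y e w ^+ 2).
  by rewrite big_map big_filter.
have -> : rowsum J i = (fun w => \sum_(e <- s) Y e w).
  by apply/funext => w; rewrite big_map big_filter.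
exact: (mgf_sum_bounds indY mY YB EY lb us sD).
Qed.

Lemma rowvar_le J i : rowvar J i <= (\sum_(k | J k) 1)%N%:R.
Proof.
rewrite /rowvar natr_sum; apply: ler_sum => k _; apply: EY2; exact: edge_upper.
Qed.

Lemma rowvar_ge0 J i : 0 <= rowvar J i.
Proof. by apply: sumr_ge0 => k _; apply: Ex_ge0 => w; exact: sqr_ge0. Qed.

Lemma rowvarT i (J : pred 'I_N) :
  rowvar predT i = rowvar J i + rowvar (predC J) i.
Proof. by rewrite /rowvar (bigID J). Qed.

Lemma rowvar_close i :
  \sum_k Ex (fun w => x (edge i k) w ^+ 2) - N%:R * (K / b ^+ 4 + (K / b ^+ 5) ^+ 2)
   <= rowvar predT i <= \sum_k Ex (fun w => x (edge i k) w ^+ 2).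
Proof.
apply/andP; split; last first.
  apply: ler_sum => k _; apply: Ex_trcent_sqr_le => //; exact/i6/edge_upper.
rewrite -[N%:R](_ : \sum_(k < N) 1 = _); last by rewrite sumr_const card_ord.
rewrite mulr_suml -sumrB; apply: ler_sum => k _.
have he : upper (edge i k) by exact: edge_upper.
have := Ex_trcent_sqr_ge (mx (edge i k)) (i6 he) (K6 he) (Ex0 he) b1.
rewrite -/(Y _); lra.
Qed.

(* The entries [(i, k)] with [i < m <= k] are above the diagonal, so that these partial row sums involve disjoint sets of variables. *)
Lemma pr_rowsum_all_lt (m : nat) t : (m < N)%N ->
  pr [set w | forall i : 'I_N, (i < m)%N ->
        rowsum (fun k => (m <= k)%N) i w < t] =
  \prod_(i < N | (i < m)%N) pr [set w | rowsum (fun k => (m <= k)%N) i w < t].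
Proof.
move=> mN; pose J := fun k : 'I_N => (m <= k)%N.
pose I1 := seq.filter (fun i : 'I_N => (i < m)%N) (index_enum 'I_N).
pose I2 := seq.filter (fun k : 'I_N => (m <= k)%N) (index_enum 'I_N).
have e_ i k : i \in I1 -> k \in I2 -> edge i k = (i, k).
  rewrite !mem_filter => /andP[im _] /andP[mk _]; rewrite /edge ltnW //.
  exact: leq_trans im mk.
pose es := [seq edge i k | i <- I1, k <- I2].
have us : uniq es.
  apply: allpairs_uniq; rewrite ?filter_uniq ?index_enum_uniq //.
  move=> _ _ /allpairsP[[i k] [/= h1 h2 ->]] /allpairsP[[i' k'] [/= h1' h2' ->]] /=.
  by rewrite !e_.
have ud e : e \in es -> [set e | upper e] e.
  by move=> /allpairsP[[i k] [_ _ ->]]; exact: edge_upper.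
pose rows := [seq [seq Y (edge i k) | k <- I2] | i <- I1].
have mYid : forall e : 'I_N * 'I_N, measurable_fun setT (@id R) by move=> e; exact: measurable_id.
have ind := mutually_independent_indepl (f := fun _ y => y) indY (fun e _ => mY e) mYid us ud.
have rowsE : [seq (fun w => Y e w) | e <- es] = flatten rows.
  rewrite map_flatten -map_comp; congr flatten.
  by apply: eq_map => i /=; rewrite -map_comp.
rewrite rowsE in ind.
have mrows : mfl (flatten rows).
  rewrite -rowsE => f; elim: (es) => //= e l IH [<-|//]; exact: mY.
have nz r : List.In r rows -> r <> [::].
  rewrite /rows; elim: (I1) => //= i l IH [<-|//].
  have : Ordinal mN \in I2 by rewrite mem_filter /= leqnn mem_index_enum.
  by case: (I2).
have ind2 := @indepl_rows _ _ _ P [::] rows nz mrows ind.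
pose l := [seq rowsum J i | i <- I1].
have lE : [seq (fun w => \sum_(f <- r) f w) | r <- rows] = l.
  rewrite /rows -map_comp; apply: eq_map => i; apply/funext => w /=.
  by rewrite big_map big_filter.
rewrite /= lE in ind2.
have ml : mfl l.
  rewrite /l => f; elim: (I1) => //= i l' IH [<-|//].
  by case: (bmf_rowsum J i).
have mB : measurable (`]-oo, t[%classic : set R) by exact: measurable_itv.
have := indepl_pr_bigcap ml mB ind2.
have setE (f : T -> R) : f @^-1` `]-oo, t[%classic = [set w | f w < t].
  by apply/seteqP; split => w /=; rewrite in_itv.
rewrite /l !big_map /I1 !big_filter => h.
have {}h : pr (\big[setI/setT]_(i < N | (i < m)%N) (rowsum J i @^-1` `]-oo, t[)) =
    \prod_(i < N | (i < m)%N) pr [set w | rowsum J i w < t].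
  by rewrite h; apply: eq_bigr => i _; rewrite setE.
rewrite -[RHS]h; congr (pr _).
apply/seteqP; split => w.
  move=> /= hw; elim/big_ind: _ => // i im; rewrite setE; exact: hw.
by move=> hw i im; move: hw; rewrite (bigD1 i) //= => -[+ _]; rewrite in_itv.
Qed.

Lemma card_lt_ord (m : nat) : (m <= N)%N -> (\sum_(i < N | (i < m)%N) 1)%N = m.
Proof.
move=> mN; rewrite -(big_ord_widen N (fun=> 1%N) mN) sum_nat_const card_ord muln1.
by [].
Qed.

(** Each of the [m] independent factors is at most [1 - p0 <= expR (- p0)]. *)
Lemma pr_rowsum_all_lt_le (m : nat) t p0 : (m < N)%N -> 0 <= p0 ->
  (forall i : 'I_N, (i < m)%N -> p0 <= pr [set w | t <= rowsum (fun k => (m <= k)%N) i w]) ->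
  pr [set w | forall i : 'I_N, (i < m)%N ->
        rowsum (fun k => (m <= k)%N) i w < t] <= expR (- (m%:R * p0)).
Proof.
move=> mN p00 hp; rewrite pr_rowsum_all_lt //.
have -> : - (m%:R * p0) = \sum_(i < N | (i < m)%N) (- p0).
  by rewrite sumr_const -sum1_card card_lt_ord ?(ltnW mN) // mulr_natl mulNrn.
rewrite expR_sum; apply: ler_prod => i im; rewrite pr_ge0 /=.
apply: le_trans (expR_ge1Dx _).
have [mS _] := bmf_rowsum (fun k => (m <= k)%N) i.
have mA := measurable_ge t mS; have mB := measurable_lt t mS.
have -> : [set w | rowsum (fun k => (m <= k)%N) i w < t] =
          ~` [set w | t <= rowsum (fun k => (m <= k)%N) i w].
  by apply/seteqP; split => w /=; rewrite ltNge => /negP.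
rewrite {1}/pr probability_setC // (prE P mA) -EFinB /= lerD2l lerN2.
exact: hp.
Qed.

(** Chernoff's bound from an upper estimate of the variance alone, as available for the few columns
    [k < m]. *)
Lemma pr_rowsum_ge J i (c ell s v : R) : 0 <= c -> 0 <= ell ->
  c * ell * (2 * b) <= 4^-1 ->
  (c * ell) ^+ 2 * rowvar J i / 2 * (1 + 4 * (c * ell * (2 * b))) <= v ->
  pr [set w | s <= rowsum J i w] <= expR (v - c * ell * s) /\
  pr [set w | s <= - rowsum J i w] <= expR (v - c * ell * s).
Proof.
move=> c0 ell0 hb hv; have ce0 : 0 <= c * ell by rewrite mulr_ge0.
have bS := bmf_rowsum J i.
have nce : `|c * ell| = c * ell by rewrite ger0_norm.
have nceN : `|- (c * ell)| = c * ell by rewrite normrN ger0_norm.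
split.
  apply: (le_trans (chernoff_bound _ s bS ce0)).
  rewrite addrC expRD ler_wpM2l ?expR_ge0 //.
  have := @mgf_rowsum J i (c * ell); rewrite nce => /(_ hb) /andP[_ h].
  by apply: (le_trans h); rewrite ler_expR.
apply: (le_trans (chernoff_bound _ s (bmfN bS) ce0)).
rewrite addrC expRD ler_wpM2l ?expR_ge0 //.
have := @mgf_rowsum J i (- (c * ell)); rewrite nceN => /(_ hb) /andP[_ h].
under eq_fun do rewrite mulrN -mulNr.
by apply: (le_trans h); rewrite ler_expR sqrrN.
Qed.

(** * Deterministic estimates at an outcome where no truncation acts and the trace is small *)

Section GoodEvent.
Variables (w : T) (c mu : R) (p : nat).
Hypothesis xb : forall e, upper e -> `|x e w| <= b.
Hypothesis c0 : 0 <= c.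
Hypothesis trc : \tr (symx Y w ^+ (2 * 2 ^ p)) <= c ^+ (2 * 2 ^ p).
Hypothesis mub : forall e, upper e -> `|trmean P (x e) b| <= mu.

Let mu0 : (0 < N)%N -> 0 <= mu.
Proof.
move=> N0; have := mub (edge_upper (Ordinal N0) (Ordinal N0)).
exact: le_trans.
Qed.

Let A : 'M[R]_N := \matrix_(i, j) x (edge i j) w.
Let M : 'M[R]_N := \matrix_(i, j) trmean P (x (edge i j)) b.
Let S i := \sum_k x (edge i k) w.

Let xY i j : x (edge i j) w = Y (edge i j) w + trmean P (x (edge i j)) b.
Proof.
have h : cutoff b (x (edge i j) w) = x (edge i j) w.
  by rewrite /cutoff (xb (edge_upper i j)).
by rewrite /Y /trcent h subrK.
Qed.

Let lapE i j : laplacian w i j = A i j - S i *+ (i == j).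
Proof.
rewrite !mxE; case: eqP => [->|_]; last by rewrite mulr0n subr0.
by rewrite mulr1n /S [in RHS](bigD1 j) //= opprD addrA subrr add0r.
Qed.

(** Since no truncation acts, [A] is [symx Y w] plus the matrix of means; the trace controls the
    first, the size of the entries the second. *)
Let normA (v : 'cV[R]_N) : vnorm v = 1 -> vnorm (A *m v) <= c + N%:R * mu.
Proof.
move=> v1; have [N0|N0] := posnP N.
  have E : v = 0 by apply/colP => i; have := ltn_ord i; rewrite {2}N0.
  by have := oner_neq0 R; rewrite -v1 E -(scale0r (0 : 'cV[R]_N)) vnormZ normr0 mul0r eqxx.
have -> : A = symx Y w + M by apply/matrixP => i j; rewrite !mxE xY.
rewrite mulmxDl; apply: (le_trans (vnormD _ _)); apply: lerD.
  have sym : (symx Y w)^T = symx Y w by apply/matrixP => i j; rewrite !mxE edgeC.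
  have := le_trans (vnorm_sym_trace p sym v1) trc.
  by rewrite ler_pXn2r ?nnegrE ?vnorm_ge0 // muln_gt0 expn_gt0.
have := @vnorm_mulmx_entries _ _ M mu v (mu0 N0).
rewrite v1 mulr1; apply=> i j; rewrite mxE; exact/mub/edge_upper.
Qed.

Let SY i : `|S i - rowsum predT i w| <= N%:R * mu.
Proof.
rewrite /S /rowsum -sumrB (le_trans (ler_norm_sum _ _ _)) //.
rewrite -[N%:R](_ : \sum_(k < N) 1 = _); last by rewrite sumr_const card_ord.
rewrite mulr_suml; apply: ler_sum => k _.
by rewrite xY addrC addKr mul1r; exact/mub/edge_upper.
Qed.

Lemma laplacian_norm_le s1 : 0 <= s1 -> (forall i, `|rowsum predT i w| <= s1) ->
  spectral_norm (laplacian w) <= c + 2 * (N%:R * mu) + s1.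
Proof.
move=> s10 hs; have Nmu0 : 0 <= N%:R * mu.
  by have [->|/mu0 ?] := posnP N; [rewrite mul0r|rewrite mulr_ge0].
have -> : c + 2 * (N%:R * mu) + s1 = (c + N%:R * mu) + (N%:R * mu + s1) by ring.
apply: (spectral_norm_sub_diag_le lapE normA); rewrite ?addr_ge0 // => i.
have := ler_normD (S i - rowsum predT i w) (rowsum predT i w).
rewrite subrK => /le_trans; apply; exact: lerD.
Qed.

Lemma laplacian_norm_ge i :
  rowsum predT i w - 2 * (N%:R * mu) - c <= spectral_norm (laplacian w).
Proof.
apply: le_trans (spectral_norm_sub_diag_ge i lapE normA).
have := SY i; rewrite ler_norml => /andP[h _]; lra.
Qed.

End GoodEvent.

Lemma pr_union5 (E B0 B1 B2 B3 B4 : set T) : measurable E -> measurable B0 ->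
  measurable B1 -> measurable B2 -> measurable B3 -> measurable B4 ->
  E `<=` B0 `|` B1 `|` B2 `|` B3 `|` B4 ->
  pr E <= pr B0 + pr B1 + pr B2 + pr B3 + pr B4.
Proof.
move=> mE m0 m1 m2 m3 m4 sub.
have m01 := measurableU _ _ m0 m1; have m012 := measurableU _ _ m01 m2.
have m0123 := measurableU _ _ m012 m3; have mall := measurableU _ _ m0123 m4.
apply: (le_trans (le_pr P mE mall sub)); apply: (le_trans (pr_setU P m0123 m4)).
rewrite lerD2r; apply: (le_trans (pr_setU P m012 m3)).
rewrite lerD2r; apply: (le_trans (pr_setU P m01 m2)).
by rewrite lerD2r; exact: pr_setU.
Qed.

(** The five summands belong to five bad events: a truncation acts; the trace is large; some full
    row sum is large in absolute value; some row has a very negative part in the columns [k < m];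
    all partial sums of the first [m] rows stay below [t]. Outside them the norm lies in the
    excluded interval. *)
Lemma pr_laplacian_norm (E : set T) (c mu Q s1 s3 t : R) (p m : nat)
    (n := (2 * 2 ^ p)%N) (g3 g4 g2 : R) :
  measurable E -> Q ^+ 2 = N%:R -> 1 <= Q -> 0 < c -> 0 <= s1 -> (m < N)%N ->
  2 ^+ n * n.+1%:R * (2 * b) <= Q ->
  (forall e, upper e -> `|trmean P (x e) b| <= mu) ->
  (forall i, pr [set w | s1 <= rowsum predT i w] <= g2 /\
             pr [set w | s1 <= - rowsum predT i w] <= g2) ->
  (forall i, pr [set w | s3 <= - rowsum (fun k => k < m)%N i w] <= g3) ->
  pr [set w | forall i : 'I_N, (i < m)%N ->
        rowsum (fun k => (m <= k)%N) i w < t] <= g4 ->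
  (forall w, E w -> ~ (t - s3 - 2 * (N%:R * mu) - c <= spectral_norm (laplacian w)
       <= c + 2 * (N%:R * mu) + s1)) ->
  pr E <= (N%:R ^+ 2 * (K / b ^+ 6)) + (N%:R * (3 * Q) ^+ n / c ^+ n) +
          (N%:R * (2 * g2)) + N%:R * g3 + g4.
Proof.
move=> mE Q2 Q1 c0 s10 mN hQ hmu h2 h3 h4 hE.
have mxb e : measurable [set w | b < `|x e w|].
  rewrite (_ : [set w | _] = [set w | - `|x e w| < - b]).
    apply: measurable_lt; apply: measurableT_comp => //; exact: measurableT_comp.
  by apply/seteqP; split => w /=; rewrite ltrN2.
pose F0 e := if upper e then [set w | b < `|x e w|] else set0.
have mF0 e : measurable (F0 e) by rewrite /F0; case: ifP.
pose B0 := \big[setU/set0]_(e : 'I_N * 'I_N) F0 e.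
pose B1 := [set w | c ^+ n <= \tr (symx Y w ^+ n)].
pose F2 i := [set w | s1 <= rowsum predT i w] `|` [set w | s1 <= - rowsum predT i w].
pose F3 i := [set w | s3 <= - rowsum (fun k => k < m)%N i w].
pose B2 := \big[setU/set0]_(i < N) F2 i.
pose B3 := \big[setU/set0]_(i < N) F3 i.
pose B4 := [set w | forall i : 'I_N, (i < m)%N -> rowsum (fun k => (m <= k)%N) i w < t].
have mS J i : measurable_fun setT (rowsum J i) by case: (bmf_rowsum J i).
have mNS J i : measurable_fun setT (fun w => - rowsum J i w) by case: (bmfN (bmf_rowsum J i)).
have mF2a i : measurable [set w | s1 <= rowsum predT i w] by exact: measurable_ge.
have mF2b i : measurable [set w | s1 <= - rowsum predT i w].
  exact: (measurable_ge _ (mNS predT i)).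
have mF2 i : measurable (F2 i) by exact: measurableU.
have mF3 i : measurable (F3 i) by exact: (measurable_ge _ (mNS _ i)).
have btr := bmf_trace_symx_exp mY YB n.
have mB0 : measurable B0 by exact: bigsetU_measurable.
have mB1 : measurable B1 by apply: measurable_ge; case: btr.
have mB2 : measurable B2 by exact: bigsetU_measurable.
have mB3 : measurable B3 by exact: bigsetU_measurable.
have mB4 : measurable B4.
  rewrite (_ : B4 = \big[setI/setT]_(i < N | (i < m)%N)
     [set w | rowsum (fun k => (m <= k)%N) i w < t]).
    by apply: bigsetI_measurable => i _; exact: measurable_lt.
  apply/seteqP; split => w.
    move=> /= h; elim/big_ind: _ => // i im; exact: h.
  by move=> h i im; move: h; rewrite (bigD1 i) //= => -[].
have inU (I : finType) (F : I -> set T) i w :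
    F i w -> (\big[setU/set0]_(i : I) F i) w.
  by move=> h; rewrite (bigD1 i) //=; left.
have ord : 'I_N := Ordinal mN.
have K0 : 0 <= K.
  by apply: le_trans (K6 (edge_upper ord ord)); apply: Ex_ge0 => w;
    rewrite (exprM _ 2 3) exprn_ge0 ?sqr_ge0.
have tr0 w : 0 <= \tr (symx Y w ^+ n).
  have sym : (symx Y w)^T = symx Y w by apply/matrixP => i j; rewrite !mxE edgeC.
  apply: le_trans (vnorm_sym_trace p sym (@vnorm_delta R N ord)).
  by rewrite exprn_ge0 ?vnorm_ge0.
apply: (le_trans (pr_union5 mE mB0 mB1 mB2 mB3 mB4 _)); last first.
  have bigN (g : R) : N%:R * g = \sum_(i < N) g.
    by rewrite sumr_const card_ord mulr_natl.
  apply: lerD => //; apply: lerD; last first.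
    by rewrite bigN; apply: (le_trans (pr_bigsetU P _ mF3)); apply: ler_sum => i _; exact: h3.
  apply: lerD; last first.
    rewrite bigN; apply: (le_trans (pr_bigsetU P _ mF2)); apply: ler_sum => i _.
    apply: (le_trans (pr_setU P (mF2a i) (mF2b i))).
    by have [? ?] := h2 i; rewrite mulr_natl mulr2n lerD.
  apply: lerD.
    apply: (le_trans (pr_bigsetU P _ mF0)).
    have -> : N%:R ^+ 2 * (K / b ^+ 6) = \sum_(e : 'I_N * 'I_N) K / b ^+ 6.
      by rewrite sumr_const card_prod card_ord -natrX mulr_natl -mulnn.
    apply: ler_sum => e _; rewrite /F0; case: ifP => he.
      have := pr_cutoff_neq (mx e) (i6 he) (K6 he) b1.
      congr (pr _ <= _); apply/seteqP; split => w /=; first by move/negP; rewrite -ltNge.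
      by rewrite ltNge => /negP.
    by rewrite pr_set0 divr_ge0 ?exprn_ge0 ?(le_trans ler01 b1).
  rewrite ler_pdivlMr ?exprn_gt0 // mulrC.
  have tri := bmf_integrable P btr.
  apply: (le_trans (pr_markov tri tr0 mB1)).
  exact: (Ex_trace_symx_exp indY mY YB twob EY EY2 Q2 Q1 hQ).
move=> w Ew; have [h|n0] := pselect (B0 w); first by do 4 left.
have [h|n1] := pselect (B1 w); first by do 3 left; right.
have [h|n2] := pselect (B2 w); first by do 2 left; right.
have [h|n3] := pselect (B3 w); first by left; right.
have [h|n4] := pselect (B4 w); first by right.
exfalso; apply: (hE w Ew).
have xb e : upper e -> `|x e w| <= b.
  move=> he; rewrite leNgt; apply/negP => h; apply: n0; apply: (inU _ _ e).
  by rewrite /F0 he.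
have trc : \tr (symx Y w ^+ (2 * 2 ^ p)) <= c ^+ (2 * 2 ^ p).
  by apply/ltW; rewrite ltNge; apply/negP.
apply/andP; split.
  have [i [im hi]] : exists i : 'I_N, (i < m)%N /\ t <= rowsum (fun k => (m <= k)%N) i w.
    apply: contrapT => hn; apply: n4 => i im; rewrite ltNge; apply/negP => hi.
    by apply: hn; exists i.
  have hi3 : - rowsum (fun k => k < m)%N i w < s3.
    by rewrite ltNge; apply/negP => h; apply: n3; apply: (inU _ _ i).
  apply: le_trans (laplacian_norm_ge xb (ltW c0) trc hmu i).
  have -> : rowsum predT i w = rowsum (fun k => (m <= k)%N) i w +
     rowsum (fun k => k < m)%N i w.
    rewrite /rowsum (bigID (fun k : 'I_N => (m <= k)%N)) /=; congr (_ + _).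
    by apply: eq_bigl => k; rewrite ltnNge.
  by rewrite !lerD2r; lra.
apply: (laplacian_norm_le xb (ltW c0) trc hmu s10) => i.
rewrite ler_norml; apply/andP; split.
  rewrite lerNl; apply/ltW; rewrite ltNge; apply/negP => h.
  by apply: n2; apply: (inU _ _ i); right.
apply/ltW; rewrite ltNge; apply/negP => h.
by apply: n2; apply: (inU _ _ i); left.
Qed.

End FixedSize.

(** * Measurability of the spectral norm *)

Section MeasurableNorm.
Context {R : realType} {d} {T : measurableType d}.

Lemma measurable_le (f : T -> R) c : measurable_fun setT f ->
  measurable [set w | f w <= c].
Proof.
move=> mf; rewrite (_ : [set w | _] = setT `&` f @^-1` `]-oo, c]%classic).
  exact: mf.
by rewrite setTI; apply/seteqP; split => w /=; rewrite in_itv.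
Qed.

Lemma measurable_spectral_norm n (M : T -> 'M[R]_n) :
  (forall i j, measurable_fun setT (fun w => M w i j)) ->
  measurable_fun setT (fun w => spectral_norm (M w)).
Proof.
move=> mM.
have le_meas a : measurable [set w | spectral_norm (M w) <= a].
  have [a0|a0] := ltP a 0.
    rewrite (_ : [set w | _] = set0) //; apply/seteqP; split => w //= h.
    by have := le_lt_trans (le_trans (spectral_norm_ge0 (M w)) h) a0; rewrite ltxx.
  pose F (q : 'cV[rat]_n) := [set w | vnorm (M w *m map_mx ratr q) <=
    a * vnorm (map_mx (@ratr R) q)].
  have mF q : measurable (F q).
    rewrite (_ : F q = [set w | \sum_i (M w *m map_mx ratr q) i ord0 ^+ 2 <=
       (a * vnorm (map_mx (@ratr R) q)) ^+ 2]).
      apply: measurable_le; apply: measurable_sum => i.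
      apply: measurable_funX; under eq_fun do rewrite mxE.
      apply: measurable_sum => j; apply: measurable_funM; first exact: mM.
      exact: measurable_cst.
    by apply/seteqP; split => w /=; rewrite -vnorm_le // mulr_ge0 ?vnorm_ge0.
  (* Rational vectors are enumerated by [unpickle]; codes of no vector are sent to 0, where the
     condition is harmless. *)
  rewrite (_ : [set w | _] = \bigcap_k F (odflt 0 (choice.unpickle k))).
    exact: bigcapT_measurable.
  apply/seteqP; split => w /=.
    move=> h k _; set q := odflt _ _; rewrite /F /=.
    set v := map_mx _ q; have [v0|v0] := eqVneq (vnorm v) 0.
      rewrite (vnorm0_eq v0) mulmx0 -(scale0r (0 : 'cV[R]_n)) vnormZ normr0 mul0r.
      by rewrite mulr_ge0 ?vnorm_ge0.
    have vp : 0 < vnorm v by rewrite lt_def v0 vnorm_ge0.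
    have u1 : vnorm ((vnorm v)^-1 *: v) = 1.
      by rewrite vnormZ ger0_norm ?invr_ge0 ?vnorm_ge0 // mulVf.
    have := le_trans (le_spectral_norm (M w) u1) h.
    rewrite -scalemxAr vnormZ ger0_norm ?invr_ge0 ?vnorm_ge0 //.
    by rewrite mulrC ler_pdivrMr.
  move=> h; apply: spectral_norm_le_rat => // q.
  by have := h (choice.pickle q) Logic.I; rewrite choice.pickleK.
apply: (measurability _ (RGenOInfty.measurableE R)) => _ [_ [a ->] <-].
rewrite setTI (_ : _ @^-1` _ = ~` [set w | spectral_norm (M w) <= a]).
  exact: measurableC.
by apply/seteqP; split => w /=; rewrite in_itv /= andbT ltNge => /negP.
Qed.

End MeasurableNorm.

(** * Change of index set, and row sums on the logarithmic scale *)

Section Transport.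
Context {R : realType} {d} {T : measurableType d} (P : probability T R).

Lemma mutually_independent_ord (N : nat) (X : nat * nat -> T -> R) :
  mutually_independent P
    [set ij : nat * nat | (1 <= ij.1 <= ij.2)%N /\ (ij.2 <= N)%N] X ->
  mutually_independent P [set e : 'I_N * 'I_N | upper e]
    (fun e => X (e.1.+1, e.2.+1)).
Proof.
move=> H s B us sD mB.
pose f (e : 'I_N * 'I_N) : nat * nat := (e.1.+1, e.2.+1).
have finj : injective f.
  by move=> [a b] [a' b'] [/val_inj -> /val_inj ->].
(* Transports [B] along the injection [f]; values off its range are immaterial. *)
pose B' ij := if [pick e | f e == ij] is Some e then B e else setT.
have B'f e : B' (f e) = B e.
  rewrite /B'; case: pickP => [e' /eqP/finj -> //|/(_ e)].
  by rewrite eqxx.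
have := H (map f s) B'.
rewrite big_map map_inj_uniq // => /(_ us).
under eq_bigr do rewrite B'f.
rewrite (_ : \bigcap_(i in [set j | j \in map f s]) (X i @^-1` B' i) =
   \bigcap_(e in [set e | e \in s]) (X (e.1.+1, e.2.+1) @^-1` B e)).
  apply.
    move=> _ /mapP[e es ->]; have := sD e es; rewrite /upper /= => h.
    by split => //; exact: ltn_ord.
  by move=> _ /mapP[e es ->]; rewrite B'f; exact: mB.
apply/seteqP; split => w /= h e /= es.
  by have := h (f e) (map_f f es); rewrite B'f.
by move/mapP: es => [e' es' ->]; rewrite B'f; exact: h.
Qed.

End Transport.

Section ScaledRows.
Context {R : realType} {d} {T : measurableType d} (P : probability T R).
Variables (N : nat) (x : 'I_N * 'I_N -> T -> R) (K b : R).
Hypothesis indx : mutually_independent P [set e | upper e] x.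
Hypothesis mx : forall e, measurable_fun setT (x e).
Hypothesis i6 : forall e, upper e -> P.-integrable setT (EFin \o (fun w => x e w ^+ 6)).
Hypothesis Ex2 : forall e, upper e -> Ex P (fun w => x e w ^+ 2) <= 1.
Hypothesis b1 : 1 <= b.
Local Notation rowsum := (rowsum P x b).
Local Notation rowvar := (rowvar P x b).

(** The normalisation [ell ^+ 2 * N = L] turns variance [N r] into the exponent [c^2 r / 2 * L]. The
    error [gam] collects the deviation [g1] of the variance and the Taylor error [4 xi], uniformly
    over the tilts up to [C0]. *)
Lemma mgf_rowsum_scaled J i (L ell C0 gam r g1 xi : R) : 0 <= L -> 0 <= ell ->
  ell ^+ 2 * N%:R = L -> `|rowvar J i - N%:R * r| <= g1 * N%:R ->
  rowvar J i <= N%:R -> 0 <= C0 -> C0 * ell * (2 * b) <= xi -> xi <= 4^-1 ->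
  0 <= g1 -> C0 ^+ 2 / 2 * (g1 + 4 * xi) <= gam ->
  forall c : R, `|c| <= C0 ->
    expR ((c ^+ 2 * r / 2 - gam) * L) <= Ex P (fun w => expR (c * ell * rowsum J i w)) <=
    expR ((c ^+ 2 * r / 2 + gam) * L).
Proof.
move=> L0 ell0 ellN hV hV1 C00 hxi xi4 g10 hgam c cC.
have b0 : 0 <= b by rewrite (le_trans ler01).
set z : R := `|c * ell| * (2 * b).
have z0 : 0 <= z by rewrite mulr_ge0 // mulr_ge0.
have zxi : z <= xi.
  apply: le_trans hxi; rewrite /z normrM (ger0_norm ell0).
  by rewrite ler_wpM2r ?mulr_ge0 // ler_wpM2r.
have z4 : z <= 4^-1 by exact: le_trans xi4.
have /andP[h1 h2] := mgf_rowsum indx mx b1 J i z4.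
have c2 : c ^+ 2 <= C0 ^+ 2.
  by rewrite -(real_normK (num_real c)) lerXn2r ?nnegrE.
have c20 := sqr_ge0 c.
set V := rowvar J i in hV hV1 h1 h2.
have V0 : 0 <= V by exact: rowvar_ge0.
have eV : ell ^+ 2 * V <= L by rewrite -ellN ler_wpM2l ?sqr_ge0.
have eV0 : 0 <= ell ^+ 2 * V by rewrite mulr_ge0 ?sqr_ge0.
have eVr : `|ell ^+ 2 * V - L * r| <= g1 * L.
  have -> : ell ^+ 2 * V - L * r = ell ^+ 2 * (V - N%:R * r) by rewrite -ellN; ring.
  rewrite normrM ger0_norm ?sqr_ge0 // -ellN mulrCA ler_wpM2l ?sqr_ge0 //.
have key : c ^+ 2 / 2 * (g1 * L + 4 * (z * L)) <= gam * L.
  apply: (@le_trans _ _ (C0 ^+ 2 / 2 * (g1 + 4 * xi) * L)); last by rewrite ler_wpM2r.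
  have -> : C0 ^+ 2 / 2 * (g1 + 4 * xi) * L = C0 ^+ 2 / 2 * (g1 * L + 4 * (xi * L)).
    by ring.
  apply: ler_pM.
  - by rewrite divr_ge0.
  - by rewrite addr_ge0 ?mulr_ge0.
  - by rewrite ler_wpM2r.
  - by rewrite lerD2l ler_wpM2l // ler_wpM2r.
have zV : z * (ell ^+ 2 * V) <= z * L by rewrite ler_wpM2l.
move: eVr; rewrite ler_norml => /andP[e1 e2].
have f1 : c ^+ 2 / 2 * (ell ^+ 2 * V - L * r + 4 * (z * (ell ^+ 2 * V))) <= gam * L.
  apply: le_trans key; rewrite ler_wpM2l ?divr_ge0 //; lra.
have f2 : c ^+ 2 / 2 * (L * r - ell ^+ 2 * V + 4 * (z * (ell ^+ 2 * V))) <= gam * L.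
  apply: le_trans key; rewrite ler_wpM2l ?divr_ge0 //; lra.
apply/andP; split.
  apply: le_trans h1; rewrite ler_expR exprMn -/z.
  clear - f2; lra.
apply: (le_trans h2); rewrite ler_expR exprMn -/z.
clear - f1; lra.
Qed.

End ScaledRows.

(** * Growth estimates in [L = log N] *)

Section Growth.
Context {R : realType}.

Lemma lnN_large (M : R) : \forall N \near \oo, M <= ln (N%:R : R).
Proof.
near=> N.
have h : expR M <= N%:R by near: N; exact: nbhs_infty_ger.
by rewrite -[M]expRK ler_ln ?posrE ?expR_gt0 // (lt_le_trans (expR_gt0 M)).
Unshelve. all: by end_near. Qed.

Lemma expR_small (c e : R) : 0 < c -> 0 < e ->
  exists L0, forall L, L0 <= L -> expR (- (c * L)) <= e.
Proof.
move=> c0 e0; exists (- ln e / c) => L.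
rewrite ler_pdivrMr // lerNl => h.
by rewrite -[leRHS]lnK ?posrE // ler_expR mulrC.
Qed.

(** From [sqrt L <= L] and the quadratic term [(L / 10)^2 / 2 = L^2 / 200] of the exponential. *)
Lemma sqrt_le_expR (e : R) : 0 < e ->
  exists L0, forall L, L0 <= L -> Num.sqrt L <= e * expR (L / 10).
Proof.
move=> e0; exists (1 + 200 / e) => L hL.
have e2 : 0 < 200 / e by rewrite divr_gt0.
have L1 : 1 <= L by lra.
have sL : Num.sqrt L <= L.
  rewrite -{2}(sqr_sqrtr (le_trans ler01 L1)) expr2 ler_peMr ?sqrtr_ge0 //.
  by rewrite -sqrtr1 ler_wsqrtr.
apply: (le_trans sL).
have h := @expR_ge1Dxn R (L / 10) 1 ltac:(lra).
have h2 : L ^+ 2 / 200 <= expR (L / 10).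
  apply: le_trans h; rewrite (_ : 2`!%:R = 2) //; lra.
apply: (@le_trans _ _ (e * (L ^+ 2 / 200))); last by rewrite ler_wpM2l // ltW.
have : 200 <= e * L.
  have : 200 / e <= L by lra.
  by rewrite ler_pdivrMr // mulrC.
move=> h3; rewrite (_ : e * (L ^+ 2 / 200) = L * (e * L / 200)); last by field.
by rewrite ler_peMr; lra.
Qed.

(** The constant in [|A| <= norm_cst * sqrt N]; its factor 3 cancels the 3 of the trace bound. *)
Definition norm_cst : R := 3 * 2 ^+ 51.

(* Take [p] largest such that [2^(2 n + 1) <= expR (L / 10)], with [n] as in the statement; then [expR L < 2^(50 n)], which is beaten by [(3 / norm_cst)^n = 2^(- 51 n)]. *)
Lemma choose_exponent (e : R) : 0 < e -> exists L0, forall L, L0 <= L ->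
  exists p, let n := (2 * 2 ^ p)%N in
    2 ^+ n * n.+1%:R * 2 <= expR (L / 10) /\ expR L * (3 / norm_cst) ^+ n <= e.
Proof.
move=> e0.
have [n0 hn0] : exists n0 : nat, e^-1 <= n0%:R.
  by exists (Num.truncn e^-1).+1; apply/ltW/truncnS_gt.
pose a p := (2 ^ (2 * (2 * 2 ^ p) + 1))%N.
have le_a p : (p <= a p)%N.
  rewrite /a; apply: (leq_trans (ltnW (ltn_expl p (isT : 1 < 2)%N))).
  by rewrite leq_exp2l //; have := ltn_expl p (isT : 1 < 2)%N; lia.
(* The [+ 5] rules out [p1 = 0], as [a 0 = 2 ^ 5]; the [5 * n0] forces [n0 < n], hence
   [e^-1 <= 2 ^+ n]. *)
exists (10 * ln (2 ^+ (5 * n0 + 5))) => L hL.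
set rho := expR (L / 10).
have rho_big : 2 ^+ (5 * n0 + 5) <= rho.
  rewrite -[leLHS]lnK ?posrE ?exprn_gt0 // ler_expR; lra.
have [p0 hp0] : exists p, rho < (a p)%:R.
  exists (Num.truncn rho).+1; apply: (lt_le_trans (truncnS_gt rho)).
  by rewrite ler_nat; exact: le_a.
pose p1 := ex_minn (ex_intro (fun p => rho < (a p)%:R) p0 hp0).
have [hp1 hmin] : rho < (a p1)%:R /\ forall p, rho < (a p)%:R -> (p1 <= p)%N.
  by rewrite /p1; case: ex_minnP.
have p1pos : (0 < p1)%N.
  rewrite lt0n; apply/eqP => p10; move: hp1; rewrite p10 ltNge.
  move/negP; apply; apply: le_trans rho_big; rewrite /a natrX ler_weXn2l ?ler1n //.
  by rewrite expn0; lia.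
exists p1.-1; set n := (2 * 2 ^ p1.-1)%N => /=.
have hn : (a p1.-1)%:R <= rho.
  by rewrite leNgt; apply/negP => /hmin; rewrite leqNgt ltn_predL p1pos.
have n2 : (2 ^ p1 = n)%N by rewrite /n -expnS prednK.
have n1 : (0 < n)%N by rewrite /n muln_gt0 expn_gt0.
split.
  apply: le_trans hn; rewrite /a -/n -natrX -!natrM ler_nat.
  rewrite addn1 expnSr leq_mul2r /= mul2n -addnn expnD leq_mul2l.
  by rewrite ltn_expl // orbT.
have rho_n : rho < 2 ^+ (5 * n).
  apply: (lt_le_trans hp1); rewrite /a natrX ler_weXn2l ?ler1n // n2; lia.
have n0n : (n0 < n)%N.
  have := le_lt_trans rho_big rho_n; rewrite ltr_eXn2l ?ltr1n //; lia.
have -> : expR L = rho ^+ 10.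
  by rewrite /rho -expRM_natl; congr expR; rewrite mulrC; field.
have -> : 3 / norm_cst = 2^-1 ^+ 51 :> R by rewrite /norm_cst; field.
apply: (@le_trans _ _ ((2 ^+ (5 * n)) ^+ 10 * (2^-1 ^+ 51) ^+ n)).
  rewrite ler_wpM2r ?exprn_ge0 ?invr_ge0 // lerXn2r ?nnegrE ?expR_ge0 ?exprn_ge0 //.
  exact: ltW.
have -> : (2 ^+ (5 * n)) ^+ 10 * (2^-1 ^+ 51) ^+ n = (2 ^+ n)^-1 :> R.
  rewrite -!exprM exprVn.
  rewrite (_ : (51 * n = 5 * n * 10 + n)%N); last by lia.
  by rewrite exprD invfM mulrA mulfV ?mul1r // expf_neq0.
have h1 : e^-1 <= 2 ^+ n.
  apply: (le_trans hn0); rewrite -natrX ler_nat.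
  by apply: (leq_trans (ltnW n0n)); apply/ltnW/ltn_expl.
by rewrite -[leRHS]invrK lef_pV2 ?posrE ?invr_gt0 ?exprn_gt0.
Qed.

End Growth.

(** * Concentration of the norm for fixed [N], given finitely many smallness conditions *)

Section Concentration.
Context {R : realType} {d} {T : measurableType d} (P : probability T R).
Variables (N : nat) (x : 'I_N * 'I_N -> T -> R) (K : R).
Let L : R := ln N%:R.
Let rho : R := expR (L / 10).
Let b : R := rho ^+ 4.
Let Q : R := rho ^+ 5.
Let s : R := Q * Num.sqrt L.
Let ell : R := Num.sqrt L / Q.
Hypothesis indx : mutually_independent P [set e | upper e] x.
Hypothesis mx : forall e, measurable_fun setT (x e).
Hypothesis i6 : forall e, upper e -> P.-integrable setT (EFin \o (fun w => x e w ^+ 6)).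
Hypothesis K6 : forall e, upper e -> Ex P (fun w => x e w ^+ 6) <= K.
Hypothesis Ex0 : forall e, upper e -> Ex P (x e) = 0.
Hypothesis Ex2 : forall e, upper e -> Ex P (fun w => x e w ^+ 2) <= 1.
Hypothesis N1 : (1 < N)%N.
Hypothesis L1 : 1 <= L.

Lemma expR_lnN : expR L = N%:R.
Proof. by rewrite /L lnK // posrE ltr0n ltnW. Qed.

Lemma rho_ge1 : 1 <= rho.
Proof. by rewrite -[leLHS](@expR0 R) ler_expR; move: L1; lra. Qed.

Let rho0 : 0 < rho. Proof. exact: expR_gt0. Qed.

Lemma rho10 : rho ^+ 10 = N%:R.
Proof.
by rewrite /rho -expRM_natl -expR_lnN; congr expR; rewrite mulrC; field.
Qed.

Let b1 : 1 <= b. Proof. by rewrite exprn_ege1 // rho_ge1. Qed.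

Let Q1 : 1 <= Q. Proof. by rewrite exprn_ege1 // rho_ge1. Qed.

Let Q0 : 0 < Q. Proof. exact: lt_le_trans Q1. Qed.

Let Q2 : Q ^+ 2 = N%:R. Proof. by rewrite /Q -exprM rho10. Qed.

Let L0 : 0 <= L. Proof. exact: le_trans L1. Qed.

Let sL2 : Num.sqrt L ^+ 2 = L. Proof. exact: sqr_sqrtr. Qed.

Let sL1 : 1 <= Num.sqrt L. Proof. by rewrite -sqrtr1 ler_wsqrtr. Qed.

Let ells : ell * s = L.
Proof. by rewrite /ell /s mulrA divfK ?gt_eqF // -expr2. Qed.

Let ell0 : 0 < ell. Proof. by rewrite divr_gt0 // (lt_le_trans _ sL1). Qed.

Let ellN : ell ^+ 2 * N%:R = L.
Proof. by rewrite /ell exprMn sL2 exprVn Q2 divfK // pnatr_eq0 -lt0n ltnW. Qed.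

Let ellb : ell * b = Num.sqrt L / rho.
Proof. by rewrite /ell /Q /b; field; rewrite gt_eqF. Qed.

Variables (r tau0 eps eta g1 xi : R) (q p : nat) (E : set T).
(** The lower bound starts its window at [tau0 - eps / 4 = tau0 - 6 h]. Its exponent is then
    governed by [(tau0 - 5 h) (tau0 - 3 h)], safely below [tau0 ^+ 2 = 2 r]. *)
Let h : R := eps / 24.
Let gam : R := h ^+ 2 / (8 * r).
Let C1 : R := (tau0 + eps) / r.
Let n := (2 * 2 ^ p)%N.
Hypothesis r0 : 0 < r.
Hypothesis tau00 : 0 < tau0.
Hypothesis tau02 : tau0 ^+ 2 = 2 * r.
Hypothesis eps0 : 0 < eps.
Hypothesis eps_tau : eps <= tau0.
Hypothesis g10 : 0 <= g1.
Hypothesis xi4 : xi <= 4^-1.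
Hypothesis hgam : C1 ^+ 2 / 2 * (g1 + 4 * xi) <= gam.
Hypothesis q_eps : 128 / eps ^+ 2 <= q%:R.
Hypothesis q_g1 : 2 <= q%:R * g1.
Hypothesis q2 : (1 < q)%N.
Hypothesis qN : (q <= N)%N.
Hypothesis c_b : K / rho ^+ 4 <= eta / 5.
Hypothesis c_p : 2 ^+ n * n.+1%:R * 2 <= rho.
Hypothesis c_p2 : expR L * (3 / @norm_cst R) ^+ n <= eta / 5.
Hypothesis c_C : @norm_cst R + 2 * K <= eps / 2 * Num.sqrt L.
Hypothesis c_xi : 2 * C1 * (Num.sqrt L / rho) <= xi.
Hypothesis c_q : q%:R * eps / 4 * (Num.sqrt L / rho) <= 4^-1.
Hypothesis c_var : forall i, `|rowvar P x b predT i - N%:R * r| <= g1 / 2 * N%:R.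
Hypothesis c_up : 2 * expR (- (gam * L)) <= eta / 5.
Hypothesis c_mid : expR (- (1 * L)) <= eta / 5.
Hypothesis c_low : expR (- (expR (gam * L) / (4 * q%:R))) <= eta / 5.
Hypothesis c_win : expR (- (h ^+ 2 / (4 * r) * L)) <= 4^-1.
Hypothesis mE : measurable E.
Hypothesis hE : forall w, E w ->
  ~ ((tau0 - eps) * s <= spectral_norm (laplacian x w) <= (tau0 + eps) * s).

Let m := (N %/ q)%N.

Let mN : (m < N)%N.
Proof. by rewrite ltn_Pdiv // ltnW. Qed.

Let mq : m%:R * q%:R <= N%:R :> R.
Proof. by rewrite -natrM ler_nat leq_trunc_div. Qed.

Let mq2 : N%:R <= 2 * q%:R * m%:R :> R.
Proof.
rewrite -!natrM ler_nat.
have m1 : (0 < m)%N by rewrite divn_gt0 // ltnW.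
have h2 : (m.+1 <= 2 * m)%N by rewrite mul2n -addnn -addn1 leq_add2l.
apply: (leq_trans (ltnW (ltn_ceil N (ltnW q2)))).
by rewrite mulnAC leq_mul2r h2 orbT.
Qed.

Let q0 : 0 < q%:R :> R. Proof. by rewrite ltr0n ltnW. Qed.

(** Dropping the first [m] columns changes the variance by at most [m], and [q g1 >= 2] makes this
    at most [g1 / 2 * N]. *)
Let var_low i :
  `|rowvar P x b (fun k => (m <= k)%N) i - N%:R * r| <= g1 * N%:R.
Proof.
have V2 := rowvarT P x b i (fun k : 'I_N => (m <= k)%N).
have V30 : 0 <= rowvar P x b (predC (fun k : 'I_N => (m <= k)%N)) i by exact: rowvar_ge0.
have V3 : rowvar P x b (predC (fun k : 'I_N => (m <= k)%N)) i <= m%:R.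
  apply: (le_trans (rowvar_le mx i6 Ex2 b1 _ _)); rewrite ler_nat.
  rewrite -[leqRHS](card_lt_ord (ltnW mN)) leq_eqVlt; apply/orP; left; apply/eqP.
  by apply: eq_bigl => k; rewrite /= ltnNge.
have m_g : m%:R <= g1 / 2 * N%:R.
  rewrite -(ler_pM2r q0); apply: (le_trans mq).
  have N0 : 0 <= N%:R :> R by [].
  have : 0 <= N%:R * (q%:R * g1 - 2) by rewrite mulr_ge0 // subr_ge0.
  lra.
have := c_var i; rewrite !ler_norml => /andP[h1 h2]; apply/andP.
by split; move: h1 h2 V30 V3 m_g; rewrite V2; lra.
Qed.

Let var_mid i : rowvar P x b (fun k => k < m)%N i <= N%:R / q%:R.
Proof.
apply: (le_trans (rowvar_le mx i6 Ex2 b1 _ _)).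
by rewrite card_lt_ord ?(ltnW mN) // ler_pdivlMr.
Qed.

Let C10 : 0 <= C1. Proof. by rewrite divr_ge0 ?addr_ge0 ?ltW. Qed.

Let C1b : C1 * ell * (2 * b) <= xi.
Proof. by apply: le_trans c_xi; rewrite -ellb; lra. Qed.

Let rowvarN J i : rowvar P x b J i <= N%:R.
Proof.
apply: (le_trans (rowvar_le mx i6 Ex2 b1 _ _)); rewrite ler_nat.
by rewrite sum1_card (leq_trans (max_card _)) ?card_ord.
Qed.

Let gam0 : 0 <= gam.
Proof. by apply: divr_ge0; [exact: sqr_ge0|apply: mulr_ge0 => //; exact: ltW]. Qed.

(** The tilt [(tau0 + eps / 2) / r] is the Gaussian optimum for this threshold. As
    [tau0 ^+ 2 = 2 r], the exponent exceeds 1 by more than [gam], which survives the union over [N]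
    rows. *)
Let up_bound i :
  pr P [set w | (tau0 + eps / 2) * s <= rowsum P x b predT i w] <= expR (- ((1 + gam) * L)) /\
  pr P [set w | (tau0 + eps / 2) * s <= - rowsum P x b predT i w] <= expR (- ((1 + gam) * L)).
Proof.
pose c := (tau0 + eps / 2) / r.
have c0 : 0 <= c by rewrite divr_ge0 ?addr_ge0 ?divr_ge0 ?ltW.
have cC : c <= C1 by rewrite ler_pM2r ?invr_gt0 //; move: eps0; lra.
have ncC : `|c| <= C1 by rewrite ger0_norm.
have hv : `|rowvar P x b predT i - N%:R * r| <= g1 * N%:R.
  apply: (le_trans (c_var i)); rewrite ler_wpM2r //; move: g10; lra.
have ncC' : `|- c| <= C1 by rewrite normrN.
have H := mgf_rowsum_scaled indx mx b1 L0 (ltW ell0) ellN hv (rowvarN _ i) C10 C1b xi4 g10 hgam.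
have bS := @bmf_rowsum _ _ _ P N x b mx b1 predT i.
have ce0 : 0 <= c * ell by rewrite mulr_ge0 // ltW.
have expo : - (c * ell * ((tau0 + eps / 2) * s)) + (c ^+ 2 * r / 2 + gam) * L <= - ((1 + gam) * L).
  have -> : c * ell * ((tau0 + eps / 2) * s) = c * (tau0 + eps / 2) * L by rewrite -ells; ring.
  suff hh : - (c * (tau0 + eps / 2)) + (c ^+ 2 * r / 2 + gam) <= - (1 + gam).
    by have := ler_wpM2r L0 hh; rewrite mulrDl !mulNr.
  have -> : - (c * (tau0 + eps / 2)) + (c ^+ 2 * r / 2 + gam) =
     - ((tau0 ^+ 2 + tau0 * eps + eps ^+ 2 / 4) / (2 * r)) + gam.
    by rewrite /c; field; rewrite gt_eqF.
  rewrite tau02.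
  have -> : (2 * r + tau0 * eps + eps ^+ 2 / 4) / (2 * r) =
     1 + tau0 * eps / (2 * r) + 24 ^+ 2 * gam by rewrite /gam /h; field; rewrite gt_eqF.
  have : 0 <= tau0 * eps / (2 * r) by rewrite divr_ge0 ?mulr_ge0 ?ltW.
  move: gam0; lra.
split.
  apply: (le_trans (chernoff_bound P _ bS ce0)).
  have /andP[_ h2] := H c ncC.
  apply: (@le_trans _ _ (expR (- (c * ell * ((tau0 + eps / 2) * s))) * expR ((c ^+ 2 * r / 2 + gam) * L))).
    by rewrite ler_wpM2l ?expR_ge0.
  by rewrite -expRD ler_expR.
apply: (le_trans (chernoff_bound P _ (bmfN bS) ce0)).
have /andP[_ h2] := H (- c) ncC'.
under eq_fun do rewrite mulrN -mulNr -mulNr.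
apply: (@le_trans _ _ (expR (- (c * ell * ((tau0 + eps / 2) * s))) * expR ((c ^+ 2 * r / 2 + gam) * L))).
  by rewrite ler_wpM2l ?expR_ge0 // -(sqrrN c).
by rewrite -expRD ler_expR.
Qed.

Let mid_bound i :
  pr P [set w | eps / 4 * s <= - rowsum P x b (fun k => k < m)%N i w] <= expR (- (2 * L)).
Proof.
(* Minimises [c^2 / q - c * eps / 4]; the minimum [- q eps^2 / 64] is at most [-2] because
   [q >= 128 / eps^2]. *)
pose c := q%:R * eps / 8.
have c0 : 0 <= c by rewrite /c divr_ge0 ?mulr_ge0 ?(ltW eps0).
have cb : c * ell * (2 * b) <= 4^-1.
  apply: le_trans c_q; rewrite -ellb /c; lra.
have hv : (c * ell) ^+ 2 * rowvar P x b (fun k => k < m)%N i / 2 *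
    (1 + 4 * (c * ell * (2 * b))) <= c ^+ 2 / q%:R * L.
  set V := rowvar _ _ _ _ _.
  have V0 : 0 <= V by exact: rowvar_ge0.
  have e1 : (c * ell) ^+ 2 * V <= c ^+ 2 / q%:R * L.
    have -> : c ^+ 2 / q%:R * L = (c * ell) ^+ 2 * (N%:R / q%:R).
      by rewrite -[in LHS]ellN; ring.
    by apply: ler_wpM2l; [exact: sqr_ge0|exact: var_mid].
  have e0 : 0 <= (c * ell) ^+ 2 * V by rewrite mulr_ge0 ?sqr_ge0.
  apply: le_trans e1; rewrite -mulrA ler_piMr //.
  move: cb; lra.
have [_ H] := pr_rowsum_ge indx mx b1 (eps / 4 * s) c0 (ltW ell0) cb hv.
apply: (le_trans H); rewrite ler_expR.
have -> : c * ell * (eps / 4 * s) = c * (eps / 4) * L by rewrite -ells; ring.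
suff hh : c ^+ 2 / q%:R - c * (eps / 4) <= - 2.
  by have := ler_wpM2r L0 hh; rewrite mulrBl mulNr.
rewrite /c.
have -> : (q%:R * eps / 8) ^+ 2 / q%:R - q%:R * eps / 8 * (eps / 4) = - (q%:R * eps ^+ 2 / 64).
  by field; rewrite gt_eqF.
have : 128 <= q%:R * eps ^+ 2 by rewrite -ler_pdivrMr // exprn_gt0.
lra.
Qed.

Let low_bound (i : 'I_N) : 2^-1 * expR (- ((1 - gam) * L)) <=
  pr P [set w | (tau0 - eps / 4) * s <= rowsum P x b (fun k => (m <= k)%N) i w].
Proof.
pose tau := tau0 - eps / 4.
have tau1 : 0 <= tau by rewrite /tau; move: eps_tau eps0; lra.
have h0 : 0 < h by rewrite /h divr_gt0.
have H := mgf_rowsum_scaled indx mx b1 L0 (ltW ell0) ellN (var_low i) (rowvarN _ i) C10 C1b xi4 g10 hgam.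
have bS := @bmf_rowsum _ _ _ P N x b mx b1 (fun k => (m <= k)%N) i.
have Hc (c : R) : `|c| <= (tau + 2 * h) / r -> `|c| <= C1.
  move=> /le_trans; apply; rewrite ler_pM2r ?invr_gt0 //.
  by rewrite /tau /h; move: eps0; lra.
have gamh : gam <= h ^+ 2 / (8 * r) by [].
have := tail_lower bS (lt_le_trans ltr01 L1) ell0 ells r0 tau1 h0 gamh gam0 c_win
  (fun c hc => H c (Hc c hc)).
move=> /(le_trans _); apply; rewrite ler_pM2l ?invr_gt0 // ler_expR lerN2 ler_wpM2r //.
suff hs : (tau + h) * (tau + 3 * h) / (2 * r) <= 1 - gam - gam by lra.
have -> : (tau + h) * (tau + 3 * h) / (2 * r) =
  (tau0 ^+ 2 - tau0 * eps / 3 + 5 / 192 * eps ^+ 2) / (2 * r).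
  by rewrite /tau /h; field; rewrite gt_eqF.
have e2 : eps ^+ 2 <= tau0 * eps by rewrite expr2 ler_wpM2r // ltW.
have -> : 1 - gam - gam = (2 * r - h ^+ 2 / 2) / (2 * r).
  by rewrite /gam; field; rewrite gt_eqF.
rewrite ler_pM2r ?invr_gt0 ?mulr_gt0 // tau02.
have := sqr_ge0 eps; have h2 : h ^+ 2 <= eps ^+ 2 / 4.
  rewrite (_ : eps ^+ 2 / 4 = (eps / 2) ^+ 2); last by field.
  by rewrite lerXn2r ?nnegrE ?divr_ge0 ?(ltW eps0) // /h; move: eps0; lra.
lra.
Qed.

(** Each of the five bad events gets [eta / 5]. Above, the margin [eps * s] is shared equally by the
    row sums and by [|A|] with the lost means. Below, the shares are a quarter for the retained
    columns, a quarter for the first [m] columns, and half for [|A|] and the means. *)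
Lemma laplacian_concentration : pr P E <= eta.
Proof.
have mu_b e : upper e -> `|trmean P (x e) b| <= K / b ^+ 5.
  by move=> he; exact: (trmean_bound (mx e) (i6 he) (K6 he) (Ex0 he) b1).
have low_all : pr P [set w | forall i : 'I_N, (i < m)%N ->
    rowsum P x b (fun k => (m <= k)%N) i w < (tau0 - eps / 4) * s] <= eta / 5.
  have p00 : 0 <= 2^-1 * expR (- ((1 - gam) * L)) by rewrite mulr_ge0 ?expR_ge0.
  apply: (le_trans (pr_rowsum_all_lt_le indx mx b1 mN p00 (fun i _ => low_bound i))).
  (* As [N <= 2 q m], the expected number of successful rows is at least [N^gam / (4 q)]. *)
  apply: le_trans c_low; rewrite ler_expR lerN2 ler_pdivrMr ?mulr_gt0 //.
  have -> : expR (gam * L) = N%:R * expR (- ((1 - gam) * L)).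
    by rewrite -expR_lnN -expRD; congr expR; ring.
  have : 0 <= expR (- ((1 - gam) * L)) * (2 * q%:R * m%:R - N%:R).
    by rewrite mulr_ge0 ?expR_ge0 // subr_ge0.
  lra.
have K0 : 0 <= K.
  have i : 'I_N := Ordinal (ltnW N1).
  apply: le_trans (K6 (edge_upper i i)); apply: Ex_ge0 => w.
  by rewrite (exprM _ 2 3) exprn_ge0 ?sqr_ge0.
have rn0 : rho != 0 by rewrite gt_eqF.
have NK : N%:R * (K / b ^+ 5) <= K.
  rewrite -rho10 /b -exprM (_ : _ * _ = K / rho ^+ 10); last by field; rewrite rn0.
  by rewrite ler_pdivrMr ?exprn_gt0 // ler_peMr // exprn_ege1 // rho_ge1.
have C0 : 0 < @norm_cst R * Q by rewrite mulr_gt0 // mulr_gt0 ?exprn_gt0.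
have hQ : 2 ^+ n * n.+1%:R * (2 * b) <= Q.
  rewrite mulrA /Q exprS ler_wpM2r // exprn_ge0 // ltW //.
have Cs : @norm_cst R * Q + 2 * (N%:R * (K / b ^+ 5)) <= eps / 2 * s.
  apply: (@le_trans _ _ ((@norm_cst R + 2 * K) * Q)); last first.
    rewrite (_ : eps / 2 * s = eps / 2 * Num.sqrt L * Q); last by rewrite /s; ring.
    by rewrite ler_wpM2r ?(ltW Q0).
  rewrite [leRHS]mulrDl lerD2l -[leRHS]mulrA ler_wpM2l //; apply: (le_trans NK).
  by rewrite ler_peMr.
have s10 : 0 <= (tau0 + eps / 2) * s.
  by rewrite mulr_ge0 ?addr_ge0 ?divr_ge0 ?mulr_ge0 ?sqrtr_ge0 ?ltW.
have hE' w : E w -> ~ ((tau0 - eps / 4) * s - eps / 4 * s - 2 * (N%:R * (K / b ^+ 5)) - @norm_cst R * Q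
    <= spectral_norm (laplacian x w)
    <= @norm_cst R * Q + 2 * (N%:R * (K / b ^+ 5)) + (tau0 + eps / 2) * s).
  move=> Ew /andP[h1 h2]; apply: (hE Ew); apply/andP; split.
    by apply: le_trans h1; move: Cs; lra.
  by apply: (le_trans h2); move: Cs; lra.
have := pr_laplacian_norm indx mx i6 K6 Ex2 b1 mE Q2 Q1 C0 s10 mN hQ mu_b
  up_bound mid_bound low_all hE'.
move=> /le_trans; apply.
have t1 : N%:R ^+ 2 * (K / b ^+ 6) <= eta / 5.
  apply: le_trans c_b; rewrite le_eqVlt; apply/orP; left; apply/eqP.
  by rewrite -rho10 /b; field; rewrite rn0.
have t2 : N%:R * (3 * Q) ^+ n / (@norm_cst R * Q) ^+ n <= eta / 5.
  apply: le_trans c_p2; rewrite expR_lnN -mulrA -expr_div_n le_eqVlt; apply/orP; left; apply/eqP.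
  congr (_ * _ ^+ _); rewrite invfM mulrACA divff ?mulr1 // gt_eqF //.
have t3 : N%:R * (2 * expR (- ((1 + gam) * L))) <= eta / 5.
  apply: le_trans c_up; rewrite mulrCA ler_pM2l // -expR_lnN -expRD ler_expR; lra.
have t4 : N%:R * expR (- (2 * L)) <= eta / 5.
  apply: le_trans c_mid; rewrite -expR_lnN -expRD ler_expR; lra.
lra.
Qed.

End Concentration.

(** * From the fixed-size estimate to the limit theorem *)

Section Conversions.
Context {R : realType}.

Lemma cutoff_error_le (K rho : R) : 0 <= K -> 1 <= rho ->
  K / (rho ^+ 4) ^+ 4 + (K / (rho ^+ 4) ^+ 5) ^+ 2 <= (K + K ^+ 2) / rho ^+ 4.
Proof.
move=> K0 r1; have r0 : 0 < rho by exact: lt_le_trans r1.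
have H a k : 0 <= a -> (4 <= k)%N -> a / rho ^+ k <= a / rho ^+ 4.
  move=> a0 k4; rewrite ler_wpM2l // lef_pV2 ?posrE ?exprn_gt0 //.
  by rewrite ler_weXn2l.
rewrite mulrDl expr_div_n -!exprM; apply: lerD; apply: H => //.
exact: sqr_ge0.
Qed.

Lemma expR_fourth_root (L : R) : expR (L / 10) ^- 4 = expR (- (2 / 5 * L)).
Proof. by rewrite expRN -expRM_natl; congr (_^-1); congr expR; field. Qed.

Lemma ler_mul_div (a b u v : R) : 0 < a -> 0 < v ->
  u <= b / a * v -> a * (u / v) <= b.
Proof.
by move=> a0 v0 h; rewrite mulrA ler_pdivrMr // -ler_pdivlMl // mulrA [_^-1 * b]mulrC.
Qed.

Context {d} {T : measurableType d}.

Lemma Deltamat_laplacian (N : nat) (X : nat -> nat -> T -> R) w :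
  Deltamat N X w = laplacian (fun e : 'I_N * 'I_N => X e.1.+1 e.2.+1) w.
Proof.
have entryE (i k : 'I_N) : Aentry X i.+1 k.+1 w =
    X (edge i k).1.+1 (edge i k).2.+1 w.
  rewrite /Aentry /edge minnSS maxnSS.
  by case: leqP => h /=; rewrite ?(minn_idPl h) ?(maxn_idPr h) //
     (minn_idPr (ltnW h)) (maxn_idPl (ltnW h)).
apply/matrixP => i j; rewrite !mxE; case: eqP => _; last exact: entryE.
by congr (- _); apply: eq_bigr => k _; exact: entryE.
Qed.

End Conversions.

Theorem mainTheorem6 (R : realType) (d : measure_display) (T : measurableType d)
  (P : probability T R)
  (X : nat -> nat -> nat -> {RV P >-> R})
  (* sigma_N(i,j)^2 = Var X^{(N)}_{i /\ j, i \/ j} *)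
  (sigma2 : nat -> nat -> nat -> R)
  (Hsigma2 : forall N i j, sigma2 N i j = fine ('V_P[X N (minn i j) (maxn i j)])%E)
  (* independence of {X^{(N)}_{i,j} : 1 <= i <= j <= N} for each N *)
  (Hindep : forall N, mutually_independent P
              [set ij : nat * nat | (1 <= ij.1 <= ij.2)%N /\ (ij.2 <= N)%N]
              (fun ij => (X N ij.1 ij.2 : T -> R)))
  (* centered *)
  (Hmean : forall N i j, (1 <= i <= j)%N -> (j <= N)%N -> ('E_P[X N i j] = 0)%E)
  (* (S.1) *)
  (HS1 : exists c : R, 0 < c /\
     forall N i j, (1 <= i <= N)%N -> (1 <= j <= N)%N ->
       c <= sigma2 N i j <= 1)
  (* (S.2), for centered variables *)
  (HS2 : exists (delta K : R), 0 < delta /\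
     forall N i j, (1 <= i <= j)%N -> (j <= N)%N ->
       ('E_P[fun w => (`|X N i j w| `^ (6 + delta))%R] <= K%:E)%E)
  (* (S.3) *)
  (HS3 : exists W : measurableTypeR R -> measurableTypeR R -> R,
     is_graphon W /\
     (fun N => cut_distance (empirical_graphon N (sigma2 N)) W) @ \oo --> 0%E)
  (* (S.4) *)
  (r : R) (Hr : 0 < r <= 1)
  (HS4 : (fun N => sup [set `| (N%:R)^-1 * \sum_(1 <= j < N.+1) sigma2 N i j - r |
                       | i in [set i : nat | (1 <= i <= N)%N]]) @ \oo --> 0) :
  (* ||Delta_N|| / sqrt(2 N log N) --> sqrt r in probability *)
  forall eps : R, 0 < eps ->
    (fun N => P [set w | eps <
        `| spectral_norm (Deltamat N (fun i j => (X N i j : T -> R)) w)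
             / Num.sqrt (2 * N%:R * ln N%:R) - Num.sqrt r |]) @ \oo --> 0%E.
Proof.
move=> eps eps0; have /andP[r0 r1] := Hr.
have [c [c0 Hc]] := HS1; have [delta [K0 [delta0 HK0]]] := HS2.
pose x N (e : 'I_N * 'I_N) : T -> R := X N e.1.+1 e.2.+1.
pose EN N := [set w | eps < `| spectral_norm (Deltamat N (fun i j => (X N i j : T -> R)) w)
             / Num.sqrt (2 * N%:R * ln N%:R) - Num.sqrt r |].
have mx N (e : 'I_N * 'I_N) : measurable_fun setT (x N e) by [].
have mE N : measurable (EN N).
  rewrite (_ : EN N = ~` [set w | `| spectral_norm (laplacian (x N) w)
             / Num.sqrt (2 * N%:R * ln N%:R) - Num.sqrt r | <= eps]); last first.
    apply/seteqP; split => w; rewrite /EN /= Deltamat_laplacian ltNge.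
      by move/negP.
    by move=> h; apply/negP.
  apply/measurableC/measurable_le.
  apply: measurableT_comp => //; apply: measurable_funB => //.
  apply: measurable_funM => //; apply: measurable_spectral_norm => i j.
  under eq_fun do rewrite mxE; case: eqP => _; last exact: mx.
  apply: measurableT_comp => //; under eq_fun do rewrite big_mkcond.
  by apply: measurable_sum => k; case: (k != i).
have bnd N (i : 'I_N) : (1 <= i.+1 <= N)%N by rewrite /= ltn_ord.
have up N (e : 'I_N * 'I_N) : upper e -> (1 <= e.1.+1 <= e.2.+1)%N /\ (e.2.+1 <= N)%N.
  by move=> he; split; [rewrite /= ltnS|exact: ltn_ord].
have varE N (e : 'I_N * 'I_N) : upper e ->
    sigma2 N e.1.+1 e.2.+1 = Ex P (fun w => x N e w ^+ 2).
  move=> he; have [h1 h2] := up N e he.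
  rewrite Hsigma2 minnSS maxnSS (minn_idPl he) (maxn_idPr he).
  exact/variance_centered/Hmean.
have varE2 N (i k : 'I_N) : sigma2 N i.+1 k.+1 = Ex P (fun w => x N (edge i k) w ^+ 2).
  rewrite -varE ?edge_upper // !Hsigma2 /edge; case: ifP => // _ /=.
  by rewrite minnC maxnC.
pose K : R := 1 + `|K0|.
have Kpos : 0 < K by rewrite ltr_wpDr.
have [i6 K6] : (forall N (e : 'I_N * 'I_N), upper e ->
      P.-integrable setT (EFin \o (fun w => x N e w ^+ 6))) /\
    (forall N (e : 'I_N * 'I_N), upper e -> Ex P (fun w => x N e w ^+ 6) <= K).
  split=> N e he; have [h1 h2] := up N e he;
    have [h3 h4] := sixth_moment delta0 (HK0 N _ _ h1 h2) => //.
  by apply: (le_trans h4); rewrite lerD2l ler_norm.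
have Ex0 N (e : 'I_N * 'I_N) : upper e -> Ex P (x N e) = 0.
  by move=> he; have [h1 h2] := up N e he; exact/Ex_expectation/Hmean.
have Ex2 N (e : 'I_N * 'I_N) : upper e -> Ex P (fun w => x N e w ^+ 2) <= 1.
  by move=> he; rewrite -varE //; have /andP[] := Hc N e.1.+1 e.2.+1 (bnd N _) (bnd N _).
have ind N : mutually_independent P [set e : 'I_N * 'I_N | upper e] (x N).
  exact: (mutually_independent_ord (Hindep N)).
pose tau0 := Num.sqrt (2 * r).
have tau00 : 0 < tau0 by rewrite sqrtr_gt0 mulr_gt0.
have tau02 : tau0 ^+ 2 = 2 * r by rewrite sqr_sqrtr // mulr_ge0 // ltW.
(* The fixed-size estimate needs a margin of at most [tau0]; shrinking it only strengthens the
   conclusion. *)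
pose e := Num.min eps tau0.
have e0 : 0 < e by rewrite lt_min eps0.
have e_eps : e <= eps by rewrite ge_min lexx.
have e_tau : e <= tau0 by rewrite ge_min lexx orbT.
pose h := e / 24; pose gam := h ^+ 2 / (8 * r); pose C1 := (tau0 + e) / r.
have h0 : 0 < h by rewrite divr_gt0.
have gam0 : 0 < gam by rewrite divr_gt0 ?exprn_gt0 // mulr_gt0.
have C10 : 0 < C1 by rewrite divr_gt0 // addr_gt0.
have C12 : 0 < C1 ^+ 2 by rewrite exprn_gt0.
(* The variance error and the Taylor error each receive half of [gam]. *)
pose g1 := gam / C1 ^+ 2; pose xi := Num.min 4^-1 (gam / (4 * C1 ^+ 2)).
have g10 : 0 < g1 by rewrite divr_gt0.
have xi0 : 0 < xi by rewrite lt_min invr_gt0 ltr0n divr_gt0 // mulr_gt0.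
have xi4 : xi <= 4^-1 by rewrite ge_min lexx.
have hgam : C1 ^+ 2 / 2 * (g1 + 4 * xi) <= gam.
  have xi1 : xi <= gam / (4 * C1 ^+ 2) by rewrite ge_min lexx orbT.
  apply: (@le_trans _ _ (C1 ^+ 2 / 2 * (g1 + 4 * (gam / (4 * C1 ^+ 2))))).
    by rewrite ler_wpM2l ?divr_ge0 ?(ltW C12) // lerD2l ler_wpM2l.
  rewrite le_eqVlt; apply/orP; left; apply/eqP; rewrite /g1; field.
  by rewrite gt_eqF.
pose q := (Num.truncn (128 / e ^+ 2 + 2 / g1)).+2.
have qbig : 128 / e ^+ 2 + 2 / g1 <= q%:R.
  by apply: (le_trans (ltW (truncnS_gt _))); rewrite ler_nat.
have e20 : 0 <= 128 / e ^+ 2 by rewrite divr_ge0 ?sqr_ge0.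
have g20 : 0 <= 2 / g1 by rewrite divr_ge0 // ltW.
have q_eps : 128 / e ^+ 2 <= q%:R by move: qbig g20; clear; lra.
have q_g1 : 2 <= q%:R * g1 by rewrite -ler_pdivrMr //; move: qbig e20; clear; lra.
have q2 : (1 < q)%N by [].
have q0 : 0 < q%:R :> R by rewrite ltr0n.
have fin N : P (EN N) \is a fin_num by exact: fin_num_measure.
apply/fine_cvgP; split; first by near=> N; exact: fin.
apply/cvgrPdist_le => eta eta0.
have eta5 : 0 < eta / 5 by rewrite divr_gt0.
have [La hLa] := choose_exponent eta5.
have [Lb hLb] := sqrt_le_expR (divr_gt0 xi0 (mulr_gt0 (ltr0n R 2) C10)).
have qe0 : 0 < q%:R * e / 4 by rewrite divr_gt0 // mulr_gt0.
have i4 : 0 < 4^-1 :> R by rewrite invr_gt0.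
have [Lc hLc] := sqrt_le_expR (divr_gt0 i4 qe0).
have [Ld hLd] := expR_small gam0 (divr_gt0 eta5 (ltr0n R 2)).
have [Le hLe] := expR_small (ltr01 : 0 < 1 :> R) eta5.
have qi0 : 0 < (4 * q%:R)^-1 :> R by rewrite invr_gt0 mulr_gt0.
have [Lf hLf] := expR_small qi0 eta5.
have w0 : 0 < h ^+ 2 / (4 * r) by rewrite divr_gt0 ?exprn_gt0 // mulr_gt0.
have [Lg hLg] := expR_small w0 i4.
have tf0 : 0 < 2 / 5 :> R by rewrite divr_gt0.
have KK0 : 0 < K + K ^+ 2 by rewrite addr_gt0 // exprn_gt0.
have [Lh hLh] := expR_small tf0 (divr_gt0 eta5 Kpos).
have g14 : 0 < g1 / 4 by rewrite divr_gt0.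
have [Li hLi] := expR_small tf0 (divr_gt0 g14 KK0).
have hS4 : \forall N \near \oo, `|0 - sup [set `| (N%:R)^-1 * \sum_(1 <= j < N.+1) sigma2 N i j - r |
                       | i in [set i : nat | (1 <= i <= N)%N]]| <= g1 / 4.
  by move/cvgrPdist_le: HS4 => /(_ _ g14).
(* From here on [sqrt L] outweighs the constants of [|A|] and of the means. *)
pose Lj := (2 * (norm_cst + 2 * K) / e) ^+ 2.
near=> N.
have N1 : (1 < N)%N by near: N; exact: nbhs_infty_gt.
have qN : (q <= N)%N by near: N; exact: nbhs_infty_ge.
have L1 : 1 <= ln N%:R :> R by near: N; exact: lnN_large.
have la : La <= ln N%:R by near: N; exact: lnN_large.
have lb : Lb <= ln N%:R by near: N; exact: lnN_large.
have lc : Lc <= ln N%:R by near: N; exact: lnN_large.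
have ld : Ld <= ln N%:R by near: N; exact: lnN_large.
have le_ : Le <= ln N%:R by near: N; exact: lnN_large.
have lf : Lf / gam <= ln N%:R by near: N; exact: lnN_large.
have lg : Lg <= ln N%:R by near: N; exact: lnN_large.
have lh : Lh <= ln N%:R by near: N; exact: lnN_large.
have li : Li <= ln N%:R by near: N; exact: lnN_large.
have lj : Lj <= ln N%:R by near: N; exact: lnN_large.
set L : R := ln N%:R in L1 la lb lc ld le_ lf lg lh li lj.
pose rho : R := expR (L / 10).
have rho1 : 1 <= rho by exact: (rho_ge1 L1).
have rho0 : 0 < rho by exact: expR_gt0.
have N0 : 0 < N%:R :> R by rewrite ltr0n ltnW.
pose S4 := [set `| (N%:R)^-1 * \sum_(1 <= j < N.+1) sigma2 N i j - r |
                       | i in [set i : nat | (1 <= i <= N)%N]].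
have supS : sup S4 <= g1 / 4.
  have : `|0 - sup S4| <= g1 / 4 by rewrite /S4; near: N; exact: hS4.
  by rewrite sub0r normrN; exact: le_trans (ler_norm _).
have sumE (i : 'I_N) : \sum_(1 <= j < N.+1) sigma2 N i.+1 j =
    \sum_k Ex P (fun w => x N (edge i k) w ^+ 2).
  by rewrite big_add1 big_mkord; apply: eq_bigr => k _; exact: varE2.
have hV (i : 'I_N) : `|N%:R^-1 * \sum_k Ex P (fun w => x N (edge i k) w ^+ 2) - r| <= g1 / 4.
  apply: le_trans supS; apply: ub_le_sup; last by exists i.+1; rewrite /= ?sumE ?ltn_ord.
  (* The supremum dominates its members only for a bounded set; the averages and [r] all lie in
     [[0, 1]]. *)
  exists 1 => _ [j /andP[j1 jN] <-].
  have j' : (j.-1 < N)%N by rewrite prednK.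
  have -> : j = (Ordinal j').+1 by rewrite /= prednK.
  rewrite sumE; set Sg := \sum_k _.
  have S0 : 0 <= Sg by apply: sumr_ge0 => k _; apply: Ex_ge0 => w; exact: sqr_ge0.
  have S1 : Sg <= N%:R.
    rewrite -[leRHS](_ : \sum_(k < N) 1 = _); last by rewrite sumr_const card_ord.
    by apply: ler_sum => k _; apply: Ex2; exact: edge_upper.
  have a1 : N%:R^-1 * Sg <= 1 by rewrite mulrC ler_pdivrMr // mul1r.
  have a0 : 0 <= N%:R^-1 * Sg by rewrite mulr_ge0 ?invr_ge0.
  by rewrite ler_norml; apply/andP; split; move: a1 a0 r0 r1; clear; lra.
have b1 : 1 <= rho ^+ 4 by rewrite exprn_ege1.
(* Variance lost by truncation, per entry. With the [g1 / 4] from (S.4) it makes up the [g1 / 2] of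
   [c_var]. *)
have kap : K / (rho ^+ 4) ^+ 4 + (K / (rho ^+ 4) ^+ 5) ^+ 2 <= g1 / 4.
  apply: (le_trans (cutoff_error_le (ltW Kpos) rho1)).
  rewrite -ler_pdivlMl // expR_fourth_root [leRHS]mulrC.
  exact: hLi.
have c_var (i : 'I_N) : `|rowvar P (x N) (rho ^+ 4) predT i - N%:R * r| <= g1 / 2 * N%:R.
  have /andP[v1 v2] := rowvar_close (mx N) (i6 N) (K6 N) (Ex0 N) b1 i.
  have := hV i; set Sg := \sum_k _ in v1 v2 *; rewrite ler_norml => /andP[s1 s2].
  have u1 : N%:R * (N%:R^-1 * Sg - r) = Sg - N%:R * r.
    by rewrite mulrBr mulrA divff ?mul1r // gt_eqF.
  have u2 := ler_wpM2l (ltW N0) s1; have u3 := ler_wpM2l (ltW N0) s2.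
  have u4 := ler_wpM2l (ltW N0) kap.
  rewrite u1 in u2 u3; rewrite ler_norml; apply/andP; split; move: u2 u3 u4 v1 v2; clear; lra.
have [p [c_p c_p2]] := hLa L la.
have c_b : K / rho ^+ 4 <= eta / 5.
  by rewrite -ler_pdivlMl // expR_fourth_root [leRHS]mulrC; exact: hLh.
have c_C : norm_cst + 2 * K <= e / 2 * Num.sqrt L.
  have C0 : 0 <= 2 * (norm_cst + 2 * K) / e.
    by rewrite divr_ge0 ?(ltW e0) // mulr_ge0 // addr_ge0 ?mulr_ge0 ?exprn_ge0 // ltW.
  have : 2 * (norm_cst + 2 * K) / e <= Num.sqrt L.
    by rewrite -(ger0_norm C0) -sqrtr_sqr ler_wsqrtr.
  by rewrite ler_pdivrMr //; clear; lra.
have c_xi : 2 * C1 * (Num.sqrt L / rho) <= xi.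
  by apply: ler_mul_div; [rewrite mulr_gt0| |exact: hLb].
have c_q : q%:R * e / 4 * (Num.sqrt L / rho) <= 4^-1.
  by apply: ler_mul_div => //; exact: hLc.
have c_up : 2 * expR (- (gam * L)) <= eta / 5.
  by rewrite -ler_pdivlMl // [leRHS]mulrC; exact: hLd.
have c_low : expR (- (expR (gam * L) / (4 * q%:R))) <= eta / 5.
  (* Here [expR (gam * L)] plays the role of the variable of [hLf]; it exceeds [gam * L], hence
     [Lf]. *)
  rewrite mulrC; apply: hLf; apply: le_trans (expR_ge1Dx _).
  by move: lf; rewrite ler_pdivrMr // mulrC; clear; lra.
rewrite /= sub0r normrN ger0_norm ?fine_ge0 //.
apply: (@laplacian_concentration R d T P N (x N) K (ind N) (mx N) (i6 N) (K6 N)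
  (Ex0 N) (Ex2 N) N1 L1 r tau0 e eta g1 xi q p (EN N)) => //.
- exact: ltW.
- exact: hLe.
- exact: hLg.
move=> w; rewrite /EN /= Deltamat_laplacian -/(x N) => Ew /andP[h1 h2].
move: Ew; apply/negP; rewrite -leNgt.
set sn := spectral_norm _ in h1 h2 *.
have sq2 : (1 : R) <= Num.sqrt 2 by rewrite -[leLHS]sqrtr1 ler_wsqrtr // ler1n.
have sL : 0 < Num.sqrt L by rewrite sqrtr_gt0 (lt_le_trans _ L1).
pose s := rho ^+ 5 * Num.sqrt L.
have s0 : 0 < s by rewrite mulr_gt0 ?exprn_gt0.
have -> : Num.sqrt (2 * N%:R * ln N%:R) = Num.sqrt 2 * s.
  have -> : 2 * N%:R * ln N%:R = 2 * (rho ^+ 5) ^+ 2 * L.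
    by rewrite -exprM /rho /L rho10.
  have r5 : 0 <= rho ^+ 5 by rewrite exprn_ge0 // ltW.
  have p2 : 0 <= 2 * (rho ^+ 5) ^+ 2 by rewrite mulr_ge0 // sqr_ge0.
  by rewrite sqrtrM // sqrtrM ?ler0n // sqrtr_sqr ger0_norm // -mulrA.
have tE : tau0 = Num.sqrt 2 * Num.sqrt r by rewrite /tau0 sqrtrM.
have D0 : 0 < Num.sqrt 2 * s by rewrite mulr_gt0 // (lt_le_trans _ sq2).
(* The normalisation is [sqrt 2 * s] and [tau0 = sqrt 2 * sqrt r], so a margin [e * s] becomes
   [e / sqrt 2] after division, at most [eps]. *)
have es : e * s <= eps * (Num.sqrt 2 * s).
  apply: ler_pM => //; [exact: ltW|exact: ltW|].
  by rewrite ler_peMl // ltW.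
rewrite ler_norml; apply/andP; split.
  rewrite lerBrDl ler_pdivlMr //; apply: le_trans h1.
  by rewrite tE -/rho -/s; move: es; clear; lra.
rewrite lerBlDl ler_pdivrMr //; apply: (le_trans h2).
by rewrite tE -/rho -/s; move: es; clear; lra.
Unshelve. all: by end_near. Qed.
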